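(* For every integer $k\ge1$ and every Young diagram $\lambda$, $$\tfrac1{k!}J^{\star,(\alpha)}_{(k)}(\lambda)=\mathrm{Ko}^{(\alpha)}_{(k)}(\lambda)=\sum_{\substack{A\subseteq\lambda,\ |A|=k\\ A\text{ column-distinct}}}\ \prod_{R\text{ row of }\lambda}P_{|R\cap A|}(\alpha),$$ where $P_i(\alpha)=\prod_{j=0}^{i-1}(1+j\alpha)$ for $i\ge0$.
   Context: A Young diagram $\lambda$ is viewed as a set of boxes; a subset $A$ of boxes is column-distinct if no two elements of $A$ lie in the same column; rows $R$ are viewed as sets of boxes. $J^{(\alpha)}_\lambda$ is the Jack symmetric function in Macdonald's $J$-normalization, with monomial expansion $J^{(\alpha)}_\lambda=\sum_\tau\widehat K^{\lambda,(\alpha)}_\tau M_\tau$. For $|\lambda|=n$, $\mathrm{Ko}^{(\alpha)}_{(k)}(\lambda)=\widehat K^{\lambda,(\alpha)}_{(k,1^{n-k})}/(n-k)!$ if $n\ge k$ and $0$ otherwise. For a box $s$ of $\lambda$, $a_\lambda(s)$ and $l_\lambda(s)$ are the numbers of boxes strictly to the right in its row and strictly below in its column; $H^{(\alpha)}_\lambda=\prod_s(\alpha a_\lambda(s)+l_\lambda(s)+1)$, $H'^{(\alpha)}_\lambda=\prod_s(\alpha a_\lambda(s)+l_\lambda(s)+\alpha)$. An $\alpha$-shifted symmetric function is a sequence $F=(F_N)_{N\ge1}$, $F_N\in\mathbb Q(\alpha)[x_1,\dots,x_N]$ symmetric in $x_1-1/\alpha,\dots,x_N-N/\alpha$, with $F_{N+1}(x_1,\dots,x_N,0)=F_N(x_1,\dots,x_N)$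 and bounded degrees; for $\lambda$ with $\ell$ rows $F(\lambda)=F_\ell(\lambda_1,\dots,\lambda_\ell)$. The shifted Jack polynomial $J^{\star,(\alpha)}_\mu$ is the unique $\alpha$-shifted symmetric function of degree at most $|\mu|$ such that for every partition $\lambda$ with $|\lambda|\le|\mu|$, $J^{\star,(\alpha)}_\mu(\lambda)=H^{(\alpha)}_\lambda H'^{(\alpha)}_\lambda/\alpha^{|\mu|}$ if $\lambda=\mu$ and $0$ otherwise. *)

(* Defs.v *)
From HB Require Import structures.
From mathcomp Require Import all_boot all_order all_algebra all_fingroup.
From mathcomp Require Import fraction.
From Stdlib Require Import ClassicalEpsilon.
Set Implicit Arguments. Unset Strict Implicit. Unset Printing Implicit Defensive.
Import Order.TTheory GRing.Theory Num.Theory.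
Local Open Scope ring_scope.

Definition K : fieldType := {fraction {poly rat}}.
Definition alpha : K := FracField.tofrac ('X : {poly rat}).

Definition is_part (la : seq nat) : bool := sorted geq la && (0%N \notin la).

(* all partitions of n with largest part <= m (fuel f >= n) *)
Fixpoint parts_aux (f m n : nat) : seq (seq nat) :=
  if n == 0%N then [:: [::]] else
  match f with
  | 0%N => [::]
  | f'.+1 => flatten [seq [seq i :: p | p <- parts_aux f' i (n - i)]
                     | i <- iota 1 (minn m n)]
  end.
Definition partitions (n : nat) : seq (seq nat) := parts_aux n n n.

Definition conjp (la : seq nat) (j : nat) : nat := count (fun r => j < r)%N la.
(* arm and leg of box (i,j) (0-indexed row i, column j) *)
Definition arm (la : seq nat) (i j : nat) : nat := (nth 0 la i - j - 1)%N.
Definition leg (la : seq nat) (i j : nat) : nat := (conjp la j - i - 1)%N.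

Definition hookH (la : seq nat) : K :=
  \prod_(i < size la) \prod_(j < nth 0%N la i)
     (alpha * (arm la i j)%:R + (leg la i j)%:R + 1).
Definition hookH' (la : seq nat) : K :=
  \prod_(i < size la) \prod_(j < nth 0%N la i)
     (alpha * (arm la i j)%:R + (leg la i j)%:R + alpha).

(* A homogeneous symmetric function of degree n is represented by its
   coefficients a rho on the power sums p_rho, rho a partition of n. *)
Definition symf := seq nat -> K.

(* p_rho = sum_mu R rho mu * m_mu, where R rho mu is the number of maps
   f : {rows of rho} -> {rows of mu} with sum_{f i = j} rho_i = mu_j. *)
Definition Rpm (rho mu : seq nat) : nat :=
  #|[pred f : {ffun 'I_(size rho) -> 'I_(size mu)} |
      [forall j : 'I_(size mu),
         (\sum_(i | f i == j) nth 0%N rho i)%N == nth 0%N mu j]]|.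

Definition mcoef (a : symf) (mu : seq nat) : K :=
  \sum_(rho <- partitions (sumn mu)) a rho * (Rpm rho mu)%:R.

Definition zee (rho : seq nat) : nat :=
  (\prod_(i <- undup rho) (i ^ count_mem i rho * (count_mem i rho)`!))%N.

Definition jinner (n : nat) (a b : symf) : K :=
  \sum_(rho <- partitions n) a rho * b rho * (zee rho)%:R * alpha ^+ size rho.

Definition dominated (mu la : seq nat) : Prop :=
  forall i : nat, (\sum_(j < i) nth 0%N mu j <= \sum_(j < i) nth 0%N la j)%N.

(* Macdonald's characterization (VI.10): J_la = c_la m_la + lower terms in
   dominance order, with c_la = hookH la, and the J_la (la |- n) pairwise
   orthogonal for the alpha-inner product. *)
Definition jack_family_spec (n : nat) (J : seq nat -> symf) : Prop :=
  forall la, la \in partitions n ->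
    [/\ forall mu, mu \in partitions n -> mcoef (J la) mu != 0 -> dominated mu la,
        mcoef (J la) la = hookH la &
        forall mu, mu \in partitions n -> mu != la -> jinner n (J la) (J mu) = 0].

Definition jack_family (n : nat) : seq nat -> symf :=
  epsilon (inhabits (fun _ _ => 0)) (jack_family_spec n).

Definition jackJ (la : seq nat) : symf := jack_family (sumn la) la.

Definition Ko (k : nat) (la : seq nat) : K :=
  let n := sumn la in
  if (k <= n)%N then mcoef (jackJ la) (k :: nseq (n - k) 1%N) / ((n - k)`!)%:R
  else 0.

(* F N is the polynomial function K^N -> K (K is infinite, so polynomials and
   polynomial functions coincide). Index N = 0 is included; it is determined by
   stability (F 0 = F 1 (0)). *)
Definition shfam := forall N : nat, ('I_N -> K) -> K.

Definition poly_fun_deg (N d : nat) (f : ('I_N -> K) -> K) : Prop :=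
  exists s : seq (K * ('I_N -> nat)),
    all (fun t => \sum_(i < N) t.2 i <= d)%N s /\
    forall x, f x = \sum_(t <- s) t.1 * \prod_(i < N) x i ^+ t.2 i.

Definition shifted_sym (N : nat) (f : ('I_N -> K) -> K) : Prop :=
  forall (s : 'S_N) (y : 'I_N -> K),
    f (fun i => y (s i) + (i.+1)%:R / alpha) = f (fun i => y i + (i.+1)%:R / alpha).

Definition ext0 (N : nat) (x : 'I_N -> K) : 'I_N.+1 -> K :=
  fun i => match unlift ord_max i with Some j => x j | None => 0 end.

Definition shf_eval (F : shfam) (la : seq nat) : K :=
  F (size la) (fun i => (nth 0%N la i)%:R).

Definition shifted_jack_spec (mu : seq nat) (F : shfam) : Prop :=
  [/\ forall N, poly_fun_deg (sumn mu) (F N),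
      forall N, shifted_sym (F N),
      forall N (x : 'I_N -> K), F N.+1 (ext0 x) = F N x &
      forall la, is_part la -> (sumn la <= sumn mu)%N ->
        shf_eval F la = if la == mu then hookH la * hookH' la / alpha ^+ sumn mu
                        else 0].

Definition shifted_jack (mu : seq nat) : shfam :=
  epsilon (inhabits (fun _ _ => 0)) (shifted_jack_spec mu).

Definition Ppoch (i : nat) : K := \prod_(j < i) (1 + j%:R * alpha).

Definition in_diagram (la : seq nat) (b : 'I_(size la) * 'I_(head 0%N la)) : bool :=
  (b.2 < nth 0%N la b.1)%N.

Definition col_distinct_b (la : seq nat) (A : {set 'I_(size la) * 'I_(head 0%N la)}) : bool :=
  [forall a in A, forall b in A, (a.2 == b.2) ==> (a == b)].

Definition coldist_sum (k : nat) (la : seq nat) : K :=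
  \sum_(A : {set 'I_(size la) * 'I_(head 0%N la)} |
          [&& A \subset [set b | in_diagram b], #|A| == k & col_distinct_b A])
    \prod_(r < size la) Ppoch #|[set b in A | b.1 == r]|.

(* Main.v *)
(** The Jack functions are the w^0-terms of the eigenvectors of the
    Nazarov-Sklyanin Lax operator. One induction on the size shows that the
    functions so constructed satisfy d/dp_1 J_la = sum_i a_i J_(la - e_i) with
    explicit coefficients a_i, and that they are orthogonal, triangular and
    normalized as J_la should be. This rule reduces the coefficient of m_(k,1^m)
    to the case m = 0.

    The column-distinct sum F_k satisfies
      sum_k F_k(la) / prod_(1 <= j <= k) (W - al j)
        = prod_(boxes) (W - c + 1) / (W - c),
    where c runs over the contents al (j + 1) - i of the boxes (i, j). Shifting W by al in this formula gives
    sum_i a_i F_k(la - e_i) = (n - k) F_k(la), the recursion of the Jack coefficients.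
    For two rows it gives a three-term recurrence in k with coefficients symmetric
    in al x_1 and al x_2 - 1, so that F_k is shifted symmetric. It vanishes at the
    partitions of size at most k other than (k), and such a function is unique. *)

Require Import Defs.
From mathcomp Require Import all_boot all_order all_algebra all_fingroup.
From mathcomp Require Import fraction.
From mathcomp Require Import boolp functions ring lra zify.
From Stdlib Require Import ClassicalEpsilon.
Import Order.TTheory GRing.Theory Num.Theory.
Local Open Scope ring_scope.
Set Implicit Arguments.
Unset Strict Implicit.
Unset Printing Implicit Defensive.

(** * Symmetric functions as Taylor coefficients *)

(** The Jack family and the shifted Jack function are given by [epsilon], so each needs existence
    and uniqueness: a family with the required properties has to be built, and this is the bulk of
    the work. The induction that builds it carries, besides J_la, one eigenvector for every box that
    can be added to la. J_la is obtained from smaller diagrams in several ways, one for each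
    removable box. They agree because a function without constant term that is killed by d/dp_1 and
    by the commutator of d/dp_1 with the Laplace-Beltrami operator is zero.

    The coefficients a_i are al^-1 times minus the residues of Q(u) = (u + N) prod_i (u - z_i) / (u
    - z_i + 1), where z_i is the content of the box that follows row i. If Psi(W) is the product
    over the boxes in the formula for the F_k, then Q(W) = W Psi(W + al) / Psi(W). Thus the
    recursions of the Jack coefficients and of the column-distinct sums come from the partial
    fractions of the same function. *)

Section SwapInvariance.
Variables (T : eqType) (A : Type).
Implicit Types (f : seq T -> A) (s t l : seq T).

Definition swap_inv f := forall l a b s, f (l ++ a :: b :: s) = f (l ++ b :: a :: s).

Lemma swap_inv_front f l a s : swap_inv f -> f (l ++ a :: s) = f (a :: l ++ s).
Proof.
elim/last_ind: l s => [//|l b IH] s hperp_fuel.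
by rewrite -cats1 -catA /= hperp_fuel IH // -catA.
Qed.

Lemma swap_inv_cons f a : swap_inv f -> swap_inv (fun s => f (a :: s)).
Proof. by move=> hperp_fuel l b c s; apply: (hperp_fuel (a :: l)). Qed.

(** Adjacent swaps move any entry to the front. Symmetry is proved below in the weak form [swap_inv]
    and used in this strong one. *)
Lemma swap_inv_perm f s t : swap_inv f -> perm_eq s t -> f s = f t.
Proof.
elim: s t f => [|a s IH] t f hperp_fuel.
  by move=> /perm_size/esym/size0nil->.
move=> Hp; have Ha: a \in t by rewrite -(perm_mem Hp) inE eqxx.
case/splitPr: Ha Hp => t1 t2 Hp.
rewrite (swap_inv_front _ _ _ hperp_fuel).
have Hp' : perm_eq s (t1 ++ t2).
  by rewrite -(perm_cons a) (permPl Hp) -[a :: t2]cat1s perm_catCA.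
by apply: (IH _ (fun s => f (a :: s))) => //; apply: swap_inv_cons.
Qed.

End SwapInvariance.

(** * Linearity of maps given as plain functions *)

Section LinearCombinators.
Variables (F : fieldType).
Implicit Types V : lmodType F.

Lemma linD V (V' : lmodType F) (u v : V -> V') : linear u -> linear v -> linear (fun x => u x + v x).
Proof. by move=> hu hv a x y; rewrite hu hv scalerDr addrACA. Qed.

Lemma linZ V (V' : lmodType F) c (u : V -> V') : linear u -> linear (fun x => c *: u x).
Proof. by move=> hu a x y; rewrite hu scalerDr !scalerA mulrC. Qed.

Lemma linS V (V' : lmodType F) n (u : 'I_n -> V -> V') :
  (forall i, linear (u i)) -> linear (fun x => \sum_(i < n) u i x).
Proof.
move=> hu a x y; rewrite scaler_sumr -big_split; apply: eq_bigr => i _.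
exact: hu.
Qed.

Lemma linC V (V' V'' : lmodType F) (u : V' -> V'') (v : V -> V') :
  linear u -> linear v -> linear (fun x => u (v x)).
Proof. by move=> hu hv a x y; rewrite hv hu. Qed.

Lemma lin0 V (V' : lmodType F) : linear (fun _ : V => 0 : V').
Proof. by move=> a x y; rewrite scaler0 addr0. Qed.

Lemma lin_id V : linear (fun x : V => x).
Proof. by []. Qed.

Lemma linF T V (V' : lmodType F) (u : V -> T -> V') : (forall k, linear (u^~ k)) -> linear u.
Proof. by move=> hu a x y; apply/funext => k; apply: hu. Qed.

Lemma linE T (V' : lmodType F) k : linear (fun Ph : T -> V' => Ph k).
Proof. by []. Qed.

Lemma lin_add V (V' : lmodType F) (u : V -> V') x y : linear u -> u (x + y) = u x + u y.
Proof. by move=> hu; have := hu 1 x y; rewrite !scale1r. Qed.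

Lemma lin_zero V (V' : lmodType F) (u : V -> V') : linear u -> u 0 = 0.
Proof. by move=> hu; have := hu (-1) 0 0; rewrite scaler0 addr0 scaleN1r addNr. Qed.

Lemma lin_scale V (V' : lmodType F) (u : V -> V') a x : linear u -> u (a *: x) = a *: u x.
Proof. by move=> hu; have := hu a x 0; rewrite !addr0 (lin_zero hu) addr0. Qed.

Lemma lin_sum V (V' : lmodType F) (u : V -> V') n (G : 'I_n -> V) :
  linear u -> u (\sum_i G i) = \sum_i u (G i).
Proof.
move=> hu; apply: (big_morph u) => [x y|]; [exact: lin_add|exact: lin_zero].
Qed.

Lemma lin_comb V (V' : lmodType F) (u : V -> V') n (a : 'I_n -> F) (G : 'I_n -> V) :
  linear u -> u (\sum_i a i *: G i) = \sum_i a i *: u (G i).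
Proof. by move=> hu; rewrite (lin_sum _ hu); apply: eq_bigr => i _; rewrite (lin_scale _ _ hu). Qed.

Lemma sumfE (T : Type) (V : nmodType) n (G : 'I_n -> T -> V) k : (\sum_i G i) k = \sum_i G i k.
Proof. by rewrite fct_sumE. Qed.
End LinearCombinators.

Section Operators.
Variables (F : fieldType) (al : F).
Local Notation Lam := (seq nat -> F^o).
Implicit Types (f g : Lam) (Ph Ps : nat -> Lam).

(* [f : Lam] encodes a symmetric function by its Taylor coefficients in the
   power sums: [f [:: j1; ...; jr]] is the constant term of
   d/dp_(j1+1) ... d/dp_(jr+1) f, so that symmetry in the indices is [swap_inv f].
   Then [dpow j] is d/dp_(j+1), and [Uop Ph] is the sum of the p_(k+1) [Ph k]. *)
Definition dpow (j : nat) f : Lam := fun s => f (j :: s).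
Definition dd (j : nat) Ph : nat -> Lam := fun k => dpow j (Ph k).

Fixpoint Up (s : seq nat) (Ph : nat -> Lam) : F^o :=
  if s is j :: s' then Ph j s' + Up s' (dd j Ph) else 0.
Definition Uop Ph : Lam := fun s => Up s Ph.

(** The Leibniz rule for d/dp_(j+1) of sum_k p_(k+1) [Ph k]. The recursion of [Up] is this rule,
    which makes it hold by definition. *)
Lemma dU j Ph : dpow j (Uop Ph) = Ph j + Uop (dd j Ph).
Proof. by []. Qed.

Lemma dpow_linear j : linear (dpow j).
Proof. by []. Qed.

Lemma dd_linear j : linear (dd j).
Proof. by []. Qed.

Lemma Uop_linear : linear Uop.
Proof.
apply: linF; elim=> [|j s IH]; first exact: lin0.
apply: (@linD F _ F^o (fun Ph => Ph j s) (fun Ph => Uop (dd j Ph) s)) => //.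
exact: (@linC F (nat -> Lam) (nat -> Lam) F^o (fun Ph => Uop Ph s) (dd j)).
Qed.
End Operators.

Section Lax.
Variables (F : fieldType) (al : F).
Local Notation Lam := (seq nat -> F^o).
Implicit Types (f g : Lam) (Ph Ps : nat -> Lam).

(* A sequence [Ph] stands for the series sum_k w^k [Ph k]; [Wop] is multiplication
   by w. [Dop] is the Laplace-Beltrami operator, defined through its commutators
   [Cop j] with [dpow j], and [Lop] is the Nazarov-Sklyanin Lax operator. *)
Definition vac f : nat -> Lam := fun k => if k is 0 then f else 0.
Definition Wop Ph : nat -> Lam := fun k => if k is k'.+1 then Ph k' else 0.
Definition shift (m : nat) Ph : nat -> Lam := fun k => Ph (m + k)%N.
Definition wt (c : nat -> nat) Ph : nat -> Lam := fun k => (c k)%:R *: Ph k.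

Definition Csh j f : nat -> Lam := fun k => dpow (j + k).+1 f.
Definition Cop j f : Lam :=
  Uop (wt (fun k => (j + k).+2) (Csh j f))
  + (al / 2) *: (\sum_(i < j) (i.+1 * (j - i))%:R *: dpow i (dpow (j.-1 - i) f))
  + ((al - 1) * 'C(j.+1, 2)%:R) *: dpow j f.

(** With d_a = d/dp_a, the operator is (al/2) sum_(a,b) a b p_(a+b) d_a d_b + (1/2) sum_(a,b) (a+b)
    p_a p_b d_(a+b) + ((al-1)/2) sum_a a (a-1) p_a d_a, and [Cop j] is its commutator with d_(j+1).
    The recursion is d_(j+1) D = D d_(j+1) + C_j, with constant term 0. *)
Fixpoint Dp (s : seq nat) f : F^o :=
  if s is j :: s' then Dp s' (dpow j f) + Cop j f s' else 0.
Definition Dop f : Lam := fun s => Dp s f.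

Definition Bop f : nat -> Lam := fun k => (al * k.+1%:R) *: dpow k f.
Definition Top Ph : nat -> Lam :=
  fun k => \sum_(i < k) (k - i)%:R *: dpow (k.-1 - i) (Ph i).
Definition Lop Ph : nat -> Lam :=
  fun k => al *: Top Ph k + Uop (shift k.+1 Ph) + ((al - 1) * k%:R) *: Ph k.
(** [Dhat] and [Dtilde] extend D to series in w. They are made for the relations Dhat w = w Dtilde
    ([Dh_W]), D U = U Dtilde ([D_U]) and B D = Dtilde B ([B_D]). *)
Definition Dhat Ph : nat -> Lam := fun k =>
  Dop (Ph k) + ((al - 1) * 'C(k, 2)%:R) *: Ph k
  + al *: Top (wt id Ph) k + k%:R *: Uop (shift k.+1 Ph).
Definition Dtilde Ph : nat -> Lam := Dhat Ph + Lop Ph.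

Lemma vac_linear : linear vac.
Proof. by apply: linF; case=> [|k]; [apply: lin_id|apply: lin0]. Qed.

Lemma Wop_linear : linear Wop.
Proof. by apply: linF; case=> [|k]; [apply: lin0|apply: linE]. Qed.

Lemma wt_linear c : linear (wt c).
Proof. by apply: linF => k; apply: linZ; apply: linE. Qed.

Lemma Cop_linear j : linear (Cop j).
Proof.
apply: linD; first apply: linD.
- by apply: linC; [apply: Uop_linear | apply: linC; [apply: wt_linear|]].
- by apply: linZ; apply: linS => i; apply: linZ.
- exact: linZ.
Qed.

Lemma Dop_linear : linear Dop.
Proof.
apply: linF; elim=> [|j s IH]; first exact: lin0.
apply: (@linD F Lam F^o (fun f => Dop (dpow j f) s) (fun f => Cop j f s)).
  by apply: (@linC F Lam Lam F^o (Dop^~ s) (dpow j)).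
by apply: (@linC F Lam Lam F^o (fun g => g s) (Cop j)); last exact: Cop_linear.
Qed.

Lemma Bop_linear : linear Bop.
Proof. by apply: linF => k; apply: linZ. Qed.

Lemma Top_linear : linear Top.
Proof. by apply: linF => k; apply: linS => i; apply: linZ. Qed.

Lemma Lop_linear : linear Lop.
Proof.
apply: linF => k; apply: linD; last by apply: linZ; apply: linE.
apply: linD; first by apply: linZ; apply: (@linC F (nat -> Lam) (nat -> Lam) Lam (fun Ph => Ph k) Top); last exact: Top_linear.
by apply: linC; [apply: Uop_linear|].
Qed.

Lemma Dhat_linear : linear Dhat.
Proof.
apply: linF => k; apply: linD; first apply: linD; first apply: linD.
- by apply: (linC Dop_linear).
- by apply: linZ; apply: linE.
- apply: linZ.
  apply: (@linC F (nat -> Lam) (nat -> Lam) Lam (fun Ph => Ph k) (fun Ph => Top (wt id Ph))) => //.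
  by apply: (linC Top_linear); apply: wt_linear.
- by apply: linZ; apply: (linC (@Uop_linear F)).
Qed.

Lemma Dtilde_linear : linear Dtilde.
Proof. by apply: linD; [apply: Dhat_linear|apply: Lop_linear]. Qed.

End Lax.

(** * Commutation relations *)

Section LaxId.
Variables (F : fieldType) (al : F).
Hypothesis F2 : (2 : F) != 0.
Local Notation Lam := (seq nat -> F^o).
Implicit Types (f g : Lam) (Ph Ps : nat -> Lam).
Local Notation Cop := (Cop al).
Local Notation Dop := (Dop al).
Local Notation Bop := (Bop al).
Local Notation Lop := (Lop al).
Local Notation Dhat := (Dhat al).
Local Notation Dtilde := (Dtilde al).

Lemma U_exch (G : nat -> nat -> Lam) :
  Uop (fun k => Uop (G k)) = Uop (fun b => Uop (fun k => G k b)).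
Proof.
apply/funext => s; elim: s G => [//|j s IH] G.
change (Uop (G j) s + Uop (fun k => G k j + Uop (dd j (G k))) s =
  Uop (fun k => G k j) s + Uop (fun b => G j b + Uop (fun k => dpow j (G k b))) s).
have lin2 (A1 A2 : nat -> Lam) : Uop (fun k => A1 k + A2 k) = Uop A1 + Uop A2.
  exact: (lin_add A1 A2 (@Uop_linear F)).
rewrite !lin2.
change (Uop (G j) s + (Uop (fun k => G k j) s + Uop (fun k => Uop (dd j (G k))) s) =
  Uop (fun k => G k j) s + (Uop (G j) s + Uop (fun b => Uop (fun k => dpow j (G k b))) s)).
by rewrite IH addrCA.
Qed.

Lemma dC f i j : swap_inv f -> dpow i (dpow j f) = dpow j (dpow i f).
Proof. by move=> hperp_fuel; apply/funext => s; apply: (hperp_fuel [::]). Qed.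

Lemma swap_inv_d f j : swap_inv f -> swap_inv (dpow j f).
Proof. exact: swap_inv_cons. Qed.

Lemma swap_invD f g : swap_inv f -> swap_inv g -> swap_inv (f + g).
Proof.
move=> hf hg l a b s; change (f (l ++ [:: a, b & s]) + g (l ++ [:: a, b & s]) = f (l ++ [:: b, a & s]) + g (l ++ [:: b, a & s])).
by rewrite hf hg.
Qed.

Lemma swap_invZ (c : F) f : swap_inv f -> swap_inv (c *: f).
Proof.
move=> hf l a b s; change (c * f (l ++ [:: a, b & s]) = c * f (l ++ [:: b, a & s])).
by rewrite hf.
Qed.

Lemma swap_inv0 : swap_inv (0 : Lam).
Proof. by []. Qed.

Lemma swap_inv_sum n (f : 'I_n -> Lam) : (forall i, swap_inv (f i)) -> swap_inv (\sum_i f i).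
Proof.
move=> hf; elim/big_rec: _ => [|i g _ hg]; first exact: swap_inv0.
exact: swap_invD.
Qed.

Lemma swap_inv_U Ph : (forall k, swap_inv (Ph k)) -> swap_inv (Uop Ph).
Proof.
move=> hP l; elim: l Ph hP => [|j l IH] Ph hP a b s.
  change (Ph a (b :: s) + (Ph b (a :: s) + Uop (dd b (dd a Ph)) s) =
          Ph b (a :: s) + (Ph a (b :: s) + Uop (dd a (dd b Ph)) s)).
  have -> : dd b (dd a Ph) = dd a (dd b Ph) by apply/funext => k; apply: dC.
  by rewrite addrCA.
change (Ph j (l ++ [:: a, b & s]) + Uop (dd j Ph) (l ++ [:: a, b & s]) =
  Ph j (l ++ [:: b, a & s]) + Uop (dd j Ph) (l ++ [:: b, a & s])).
by rewrite hP IH // => k; apply: swap_inv_d.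
Qed.

Lemma DtE Ph k : Dtilde Ph k = Dop (Ph k) + ((al - 1) * 'C(k.+1, 2)%:R) *: Ph k
  + al *: Top (wt S Ph) k + k.+1%:R *: Uop (shift k.+1 Ph).
Proof.
change (Dtilde Ph k) with (Dop (Ph k) + ((al - 1) * 'C(k, 2)%:R) *: Ph k
  + al *: Top (wt id Ph) k + k%:R *: Uop (shift k.+1 Ph) +
  (al *: Top Ph k + Uop (shift k.+1 Ph) + ((al - 1) * k%:R) *: Ph k)).
have -> : Top (wt S Ph) k = Top (wt id Ph) k + Top Ph k.
  have -> : wt S Ph = wt id Ph + Ph.
    apply/funext => m; change (m.+1%:R *: Ph m = m%:R *: Ph m + Ph m).
    by rewrite -addn1 natrD scalerDl scale1r.
  by rewrite (lin_add _ _ (@Top_linear F)).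
rewrite binS bin1 natrD mulrDr scalerDl scalerDr -[k.+1]addn1 natrD scalerDl scale1r.
by rewrite -!addrA; do 2 congr (_ + _); rewrite addrA [RHS]addrC -!addrA; congr (_ + _);
  rewrite [LHS]addrCA; congr (_ + _); rewrite [in LHS]addrCA addrA [LHS]addrC.
Qed.


(** One half of [D_U], where derivatives of both sides are compared; the last term is the one that
    [d_Dt] produces on the other side. *)
Lemma C_U j Ph :
  Cop j (Uop Ph) + Dop (Ph j) = Dtilde Ph j + Uop (fun k => Cop j (Ph k)) + Uop (wt S (shift j.+1 Ph)).
Proof.
pose c k := (j + k).+2.
have UD (A1 A2 : nat -> Lam) : Uop (fun k => A1 k + A2 k) = Uop A1 + Uop A2.
  exact: (lin_add A1 A2 (@Uop_linear F)).
have UZ x (A : nat -> Lam) : Uop (fun k => x *: A k) = x *: Uop A.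
  exact: (lin_scale x A (@Uop_linear F)).
have E1 : Uop (wt c (Csh j (Uop Ph))) =
    Uop (wt c (shift j.+1 Ph)) + Uop (fun k => Uop (wt c (Csh j (Ph k)))).
  rewrite -[X in _ = _ + X]U_exch -UD; congr Uop; apply/funext => k.
  change ((c k)%:R *: (Ph (j + k).+1 + Uop (dd (j + k).+1 Ph)) =
    (c k)%:R *: Ph (j + k).+1 + Uop (fun k0 => (c k)%:R *: dd (j + k).+1 Ph k0)).
  by rewrite UZ scalerDr.

(* Either of the two derivatives can hit a variable p. Reversing the index i identifies the two
   contributions, and the resulting 2 cancels the one in the al / 2 of [Cop]. *)
have E2 : \sum_(i < j) (i.+1 * (j - i))%:R *: dpow i (dpow (j.-1 - i) (Uop Ph)) =
    2 *: Top (wt S Ph) j +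
    Uop (fun k => \sum_(i < j) (i.+1 * (j - i))%:R *: dpow i (dpow (j.-1 - i) (Ph k))).
  have -> : Uop (fun k => \sum_(i < j) (i.+1 * (j - i))%:R *: dpow i (dpow (j.-1 - i) (Ph k)))
    = \sum_(i < j) (i.+1 * (j - i))%:R *: Uop (dd i (dd (j.-1 - i) Ph)).
    transitivity (Uop (\sum_(i < j) (i.+1 * (j - i))%:R *: (dd i (dd (j.-1 - i) Ph)))).
      by congr Uop; apply/funext => k; rewrite sumfE.
    by rewrite (lin_comb _ _ (@Uop_linear F)).
  have -> : Top (wt S Ph) j = \sum_(i < j) (i.+1 * (j - i))%:R *: dpow (j.-1 - i) (Ph i).
    apply: eq_bigr => i _; rewrite mulnC natrM -scalerA; congr (_ *: _).
  rewrite -[2]/(1 + 1 : F) scalerDl scale1r.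
  rewrite [X in _ = X + _ + _](reindex_inj rev_ord_inj) /= -!big_split /=.
  apply: eq_bigr => i _.
  have hi := ltn_ord i.
  have -> : (j.-1 - (j - i.+1) = i)%N by lia.
  have -> : ((j - i.+1).+1 * (j - (j - i.+1)) = i.+1 * (j - i))%N by nia.
  rewrite -!scalerDr; congr (_ *: _).
  have -> : (j - i.+1 = j.-1 - i)%N by lia.
  by rewrite -addrA.
have E3 : dpow j (Uop Ph) = Ph j + Uop (dd j Ph) by [].
have E4 : Uop (wt c (shift j.+1 Ph)) =
    j.+1%:R *: Uop (shift j.+1 Ph) + Uop (wt S (shift j.+1 Ph)).
  rewrite -(lin_scale _ _ (@Uop_linear F)) -UD; congr Uop; apply/funext => k.
  change ((j + k).+2%:R *: Ph (j.+1 + k)%N = j.+1%:R *: Ph (j.+1 + k)%N + k.+1%:R *: Ph (j.+1 + k)%N).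
  by rewrite -scalerDl -natrD addSn addnS.
have E5 : Uop (fun k => Cop j (Ph k)) = Uop (fun k => Uop (wt c (Csh j (Ph k)))) +
   (al / 2) *: Uop (fun k => \sum_(i < j) (i.+1 * (j - i))%:R *: dpow i (dpow (j.-1 - i) (Ph k)))
   + ((al - 1) * 'C(j.+1, 2)%:R) *: Uop (dd j Ph).
  by rewrite -!UZ -!UD.
rewrite DtE E5 {1}/Cop -/c E1 E2 E3 E4 !scalerDr scalerA divfK //.
rewrite [LHS](AC (3*2*2*1) ((8*6*4*1)*(3*5*7)*2)) /=.
by [].
Qed.

Lemma d_Dt j Ph k : (forall k, swap_inv (Ph k)) ->
  dpow j (Dtilde Ph k) = Dtilde (dd j Ph) k + Cop j (Ph k) + k.+1%:R *: Ph (j + k).+1.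
Proof.
move=> hP; rewrite !DtE !(lin_add _ _ (@dpow_linear F j)) !(lin_scale _ _ (@dpow_linear F j)).
have -> : dpow j (Dop (Ph k)) = Dop (dd j Ph k) + Cop j (Ph k) by [].
have -> : dpow j (Top (wt S Ph) k) = Top (wt S (dd j Ph)) k.
  rewrite /Top (lin_comb _ _ (@dpow_linear F j)); apply: eq_bigr => i _.
  by rewrite dC //; apply: swap_invZ.
rewrite dU scalerDr.
have -> : shift k.+1 Ph j = Ph (j + k).+1 by rewrite /shift addSn addnC.
rewrite [LHS](AC (2*1*1*2) ((1*3*4*6)*2*5)); reflexivity.
Qed.

(** Neither side has a constant term, and by [C_U] and [d_Dt] the derivatives of the two sides
    agree, by induction on the Taylor index. *)
Lemma D_U Ph : (forall k, swap_inv (Ph k)) -> Dop (Uop Ph) = Uop (Dtilde Ph).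
Proof.
move=> hP; apply/funext => s; elim: s Ph hP => [//|j s IH] Ph hP.
change (Dop (dpow j (Uop Ph)) s + Cop j (Uop Ph) s = Dtilde Ph j s + Uop (dd j (Dtilde Ph)) s).
have -> : dd j (Dtilde Ph) = Dtilde (dd j Ph) + (fun k => Cop j (Ph k)) + wt S (shift j.+1 Ph).
  apply/funext => k.
  change (dpow j (Dtilde Ph k) = Dtilde (dd j Ph) k + Cop j (Ph k) + k.+1%:R *: Ph (j + k).+1).
  exact: d_Dt.
rewrite (lin_add _ (wt S _) (@Uop_linear F)) (lin_add (Dtilde _) _ (@Uop_linear F)) dU.
rewrite (lin_add _ _ (@Dop_linear F al)).
have := congr1 (fun f => f s) (C_U j Ph).
change (Cop j (Uop Ph) s + Dop (Ph j) s = Dtilde Ph j s + Uop (fun k => Cop j (Ph k)) s + Uop (wt S (shift j.+1 Ph)) s -> 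
  Dop (Ph j) s + Dop (Uop (dd j Ph)) s + Cop j (Uop Ph) s = Dtilde Ph j s + (Uop (Dtilde (dd j Ph)) s + Uop (fun k => Cop j (Ph k)) s + Uop (wt S (shift j.+1 Ph)) s)).
rewrite IH => [E|k]; last exact: swap_inv_d.
by rewrite [LHS]addrC addrA E [LHS](AC (3*1) (1*(4*2*3))).
Qed.

Lemma B_D f : swap_inv f -> Bop (Dop f) = Dtilde (Bop f).
Proof.
move=> hf; apply/funext => j; rewrite DtE.
change ((al * j.+1%:R) *: (Dop (dpow j f) + Cop j f) = Dop ((al * j.+1%:R) *: dpow j f)
  + ((al - 1) * 'C(j.+1, 2)%:R) *: ((al * j.+1%:R) *: dpow j f)
  + al *: Top (wt S (Bop f)) j + j.+1%:R *: Uop (shift j.+1 (Bop f))).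
rewrite (lin_scale _ _ (@Dop_linear F al)) !scalerDr.
have -> : j.+1%:R *: Uop (shift j.+1 (Bop f)) =
    (al * j.+1%:R) *: Uop (wt (fun k => (j + k).+2) (Csh j f)).
  have -> : shift j.+1 (Bop f) = al *: wt (fun k => (j + k).+2) (Csh j f).
    apply/funext => k.
    change ((al * (j.+1 + k).+1%:R) *: dpow (j.+1 + k) f = al *: ((j + k).+2%:R *: dpow (j + k).+1 f)).
    by rewrite scalerA !addSn.
  by rewrite (lin_scale _ _ (@Uop_linear F)) scalerA mulrC.
have -> : (al * j.+1%:R) *: ((al / 2) *: \sum_(i < j) (i.+1 * (j - i))%:R *: dpow i (dpow (j.-1 - i) f))
    = al *: Top (wt S (Bop f)) j.
  pose w i := (i.+1 * (j - i))%:R : F.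
  pose v i := dpow i (dpow (j.-1 - i) f).
  have E1 : Top (wt S (Bop f)) j = al *: \sum_(i < j) (w i * i.+1%:R) *: v i.
    rewrite scaler_sumr; apply: eq_bigr => i _.
    change ((j - i)%:R *: dpow (j.-1 - i) (i.+1%:R *: ((al * i.+1%:R) *: dpow i f)) =
      al *: ((w i * i.+1%:R) *: v i)).
    rewrite !(lin_scale _ _ (@dpow_linear F _)) !scalerA /v dC //; congr (_ *: _).
    rewrite /w natrM; ring.
  (* By the symmetry i -> j - 1 - i the weight i + 1 may be replaced by j - i, hence by the mean (j
     + 1) / 2. This matches the al / 2 of [Cop]. *)
  have E2 : \sum_(i < j) (w i * i.+1%:R) *: v i = \sum_(i < j) (w i * (j - i)%:R) *: v i.
    rewrite [LHS](reindex_inj rev_ord_inj); apply: eq_bigr => i _ /=.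
    have hi := ltn_ord i.
    have e1 : (j - i.+1 = j.-1 - i)%N by lia.
    have e2 : (j.-1 - (j.-1 - i) = i)%N by lia.
    have e3 : ((j.-1 - i).+1 = j - i)%N by lia.
    have e4 : (j - (j.-1 - i) = i.+1)%N by lia.
    by rewrite e1 /v e2 /w e3 e4 dC // mulnC.
  have E3 : 2 *: (\sum_(i < j) (w i * i.+1%:R) *: v i) = j.+1%:R *: \sum_(i < j) w i *: v i.
    rewrite -[2]/(1 + 1 : F) scalerDl scale1r {1}E2 -big_split scaler_sumr.
    apply: eq_bigr => i _ /=; rewrite -scalerDl scalerA -mulrDr -natrD mulrC.
    by congr (_%:R * _ *: _); have := ltn_ord i; lia.
  rewrite -/w E1 !scalerA; apply: (scalerI F2); rewrite !scalerA.
  have -> : 2 * (al * al) = (al * al) * 2 by rewrite mulrC.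
  rewrite -!scalerA E3 !scalerA; congr (_ *: _).
  by field.
have -> : ((al - 1) * 'C(j.+1, 2)%:R) *: ((al * j.+1%:R) *: dpow j f) =
    (al * j.+1%:R) *: (((al - 1) * 'C(j.+1, 2)%:R) *: dpow j f).
  by rewrite !scalerA mulrC.
by rewrite [RHS](AC (1*1*1*1) (1*((4*3)*2))).
Qed.

Lemma T_W Ph k : Top (Wop Ph) k.+1 = Top Ph k.
Proof.
rewrite /Top big_ord_recl /= (lin_zero (@dpow_linear F _)) scaler0 add0r.
apply: eq_bigr => i _ /=; rewrite /bump /= add1n subSS.
by have -> : (k - i.+1 = k.-1 - i)%N by lia.
Qed.

Lemma wt_W c Ph : wt c (Wop Ph) = Wop (wt (fun k => c k.+1) Ph).
Proof. by apply/funext; case=> [|k //]; rewrite -[LHS]/((c 0)%:R *: (0 : Lam)) scaler0. Qed.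

Lemma wt_vac c f : wt c (vac f) = (c 0)%:R *: vac f.
Proof. by apply/funext; case=> [//|k]; rewrite -[LHS]/((c k.+1)%:R *: (0 : Lam)) -[RHS]/((c 0)%:R *: (0 : Lam)) !scaler0. Qed.

Lemma T_vac f k : Top (vac f) k = (k%:R : F) *: dpow k.-1 f.
Proof.
case: k => [|k]; first by rewrite /Top big_ord0 scale0r.
rewrite /Top big_ord_recl /= !subn0 big1 ?addr0 // => i _ /=.
by rewrite (lin_zero (@dpow_linear F _)) scaler0.
Qed.

Lemma shiftS_vac k f : shift k.+1 (vac f) = 0.
Proof. by []. Qed.

Lemma L_vac f : Lop (vac f) = Wop (Bop f).
Proof.
apply/funext => k; rewrite /Lop shiftS_vac (lin_zero (@Uop_linear F)) addr0 T_vac scalerA.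
case: k => [|k] /=; first by rewrite !mulr0 !scale0r addr0.
by rewrite scaler0 addr0.
Qed.

Lemma Dh_vac f : Dhat (vac f) = vac (Dop f).
Proof.
apply/funext => k; rewrite /Dhat shiftS_vac (lin_zero (@Uop_linear F)) scaler0 addr0 wt_vac scale0r.
rewrite (lin_zero (@Top_linear F)) scaler0 addr0.
case: k => [|k] /=; first by rewrite mulr0 scale0r addr0.
by rewrite scaler0 addr0 (lin_zero (@Dop_linear F al)).
Qed.

Lemma Dh_W Ph : Dhat (Wop Ph) = Wop (Dtilde Ph).
Proof.
apply/funext; case=> [|k]; rewrite /Dhat.
  rewrite /= (lin_zero (@Dop_linear F al)) /Top big_ord0.
  by rewrite mulr0 !scale0r !scaler0 !addr0.
rewrite wt_W T_W; exact: esym (DtE Ph k).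
Qed.

Lemma L_W Ph : Lop (Wop Ph) = Wop (Lop Ph + (al - 1) *: Ph) + vac (Uop Ph).
Proof.
apply/funext; case=> [|k].
  change (al *: Top (Wop Ph) 0 + Uop Ph + ((al - 1) * 0) *: (0 : Lam) = 0 + Uop Ph).
  by rewrite /Top big_ord0 !scaler0 addr0.
change (al *: Top (Wop Ph) k.+1 + Uop (shift k.+1 Ph) + ((al - 1) * k.+1%:R) *: Ph k =
  al *: Top Ph k + Uop (shift k.+1 Ph) + ((al - 1) * k%:R) *: Ph k + (al - 1) *: Ph k + 0).
by rewrite T_W addr0 -!addrA -scalerDl -[k.+1]addn1 natrD mulrDr mulr1.
Qed.

Lemma dd_vac j f : dd j (vac f) = vac (dpow j f).
Proof. by apply/funext; case=> [|k]. Qed.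

Lemma dd_W j Ph : dd j (Wop Ph) = Wop (dd j Ph).
Proof. by apply/funext; case=> [|k]. Qed.

Lemma dd_B j f : swap_inv f -> dd j (Bop f) = Bop (dpow j f).
Proof.
move=> hf; apply/funext => k; rewrite /dd /Bop (lin_scale _ _ (@dpow_linear F _)).
by rewrite dC.
Qed.

Lemma C0E f : Cop 0 f = Uop (wt (fun k => k.+2) (Csh 0 f)).
Proof. by rewrite /Cop big_ord0 scaler0 addr0 bin_small // mulr0 scale0r addr0. Qed.

End LaxId.

(** * Partial fractions and Young diagrams *)

Section Lagrange.
Variable F : fieldType.

(** The two leading terms cancel: both products have coefficient 1 in degree n + 1 and n - sum_i z_i
    in degree n. This is what fixes the constant n in X + n. *)
Lemma size_prod_diff n (z : 'I_n -> F) :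
  (size (('X + n%:R) * \prod_i ('X - (z i)%:P) - 'X * \prod_i ('X + 1 - (z i)%:P))%R <= n)%N.
Proof.
elim: n z => [|n IH] z; first by rewrite !big_ord0 addr0 subrr size_poly0.
rewrite !big_ord_recl; set A := \prod_(i < n) _; set B := \prod_(i < n) _.
set a := z ord0.
have -> : ('X + n.+1%:R) * (('X - a%:P) * A) - 'X * (('X + 1 - a%:P) * B) =
  (('X + n%:R) * A - 'X * B) * ('X - a%:P) + ((A - B) * 'X - a%:P * A).
  by rewrite -natr1; ring.
have hA : A \is monic by apply: monic_prod => i _; apply: monicXsubC.
have sA : size A = n.+1.
  by rewrite /A size_prod_XsubC /= /index_enum -enumT size_enum_ord.
have eB : B = \prod_(i < n) ('X - (z (lift ord0 i) - 1)%:P).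
  by apply: eq_bigr => i _; rewrite polyCB opprB addrA addrAC.
have hB : B \is monic by rewrite eB; apply: monic_prod => i _; apply: monicXsubC.
have sB : size B = n.+1.
  by rewrite eB size_prod_XsubC /= /index_enum -enumT size_enum_ord.
have sAB : (size (A - B)%R <= n)%N.
  apply/leq_sizeP => j hj; rewrite coefB; move: hj; rewrite leq_eqVlt => /orP[/eqP<-|hj].
    by move: (monicP hA) (monicP hB); rewrite !lead_coefE sA sB /= => -> ->; rewrite subrr.
  by rewrite !nth_default ?subrr ?sA ?sB.
apply: leq_trans (size_polyD _ _) _; rewrite geq_max; apply/andP; split.
  apply: leq_trans (size_polyMleq _ _) _; rewrite size_XsubC addn2 /=.
  by rewrite ltnS; apply: IH.
apply: leq_trans (size_polyD _ _) _; rewrite geq_max; apply/andP; split.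
  by apply: leq_trans (size_polyMleq _ _) _; rewrite size_polyX addn2.
rewrite size_polyN; apply: leq_trans (size_polyMleq _ _) _; rewrite sA addnS /=.
by case: (a == 0) (size_polyC a) => -> /=; rewrite ?add0n ?add1n.
Qed.

(* Minus the residue at u = z_i - 1 of Q(u) = (u + n) prod_i (u - z_i) / (u + 1 - z_i). *)
Definition resid n (z : 'I_n -> F) i : F :=
  (z i + n%:R - 1) * \prod_(j | j != i) ((z i - z j - 1) / (z i - z j)).

(** The left side has degree less than n and vanishes at the n distinct points z_i - 1. *)
Lemma lagrange_poly n (z : 'I_n -> F) : injective z ->
  ('X + n%:R) * \prod_i ('X - (z i)%:P) - 'X * \prod_i ('X + 1 - (z i)%:P)
  + \sum_i (resid z i)%:P * \prod_(j | j != i) ('X + 1 - (z j)%:P) = 0.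
Proof.
move=> zI; set P := (X in X = _).
have sP : (size P <= n)%N.
  apply: leq_trans (size_polyD _ _) _; rewrite geq_max size_prod_diff /=.
  apply: leq_trans (size_sum _ _ _) _; apply/bigmax_leqP => i _.
  apply: leq_trans (size_polyMleq _ _) _.
  have h1 : (size (\prod_(j | j != i) ('X + 1 - (z j)%:P))%R <= n)%N.
    have -> : \prod_(j | j != i) ('X + 1 - (z j)%:P) = \prod_(j | j != i) ('X - (z j - 1)%:P).
      by apply: eq_bigr => j _; rewrite polyCB opprB addrA addrAC.
    apply: leq_trans (size_poly_prod_leq _ _) _.
    under eq_bigr do rewrite size_XsubC.
    by rewrite sum_nat_const cardC1 card_ord; have := ltn_ord i; lia.
  by rewrite -subn1 leq_subLR; apply: leq_add (size_polyC_leq1 _) h1.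
have rP i : root P (z i - 1).
  have hA k : ('X - (z k)%:P).[z i - 1] = z i - z k - 1 by rewrite !hornerE addrAC.
  have hB k : ('X + 1 - (z k)%:P).[z i - 1] = z i - z k by rewrite !hornerE addrNK.
  have hP Q (f : 'I_n -> {poly F}) :
    (\prod_(j | Q j) f j).[z i - 1] = \prod_(j | Q j) (f j).[z i - 1] := horner_prod _ _ _ _.
  rewrite /root /P 2!hornerD hornerN !hornerM !hP horner_sum.
  rewrite [X in _ - _ * X](bigD1 i) //= hB subrr mul0r mulr0 subr0.
  rewrite [X in _ + X](bigD1 i) //= [X in _ + (_ + X)]big1 ?addr0 => [|k hk]; last first.
    by rewrite hornerM hP (bigD1 i) 1?eq_sym //= hB subrr mul0r mulr0.
  rewrite hornerM hP hornerC (bigD1 i) //= (eq_bigr _ (fun k _ => hA k)).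
  rewrite (eq_bigr _ (fun k _ => hB k)) hA /resid prodf_div.
  have hne : \prod_(j | j != i) (z i - z j) != 0.
    by apply/prodf_neq0 => j hj; rewrite subr_eq0 (inj_eq zI) eq_sym.
  rewrite -mulrA divfK // hornerD hornerX -polyC_natr hornerC subrr /=.
  by apply/eqP; set x := \prod_(j | _) _; ring.
apply: contraTeq sP => Pn0; rewrite -ltnNge.
have -> : n = size [seq z i - 1 | i : 'I_n] by rewrite size_map size_enum_ord.
  apply: max_poly_roots => //.
    by apply/allP => x /mapP[i _ ->]; apply: rP.
  by rewrite map_inj_uniq ?enum_uniq // => i j /addIr/zI.
Qed.

(** The partial fraction expansion of Q, obtained by dividing [lagrange_poly] by the common
    denominator. *)
Lemma lagrange_id n (z : 'I_n -> F) (u : F) :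
  injective z -> (forall i, u - z i + 1 != 0) ->
  u - \sum_i resid z i / (u - z i + 1) =
  (u + n%:R) * \prod_i ((u - z i) / (u - z i + 1)).
Proof.
move=> zI hu.
have := congr1 (horner^~ u) (lagrange_poly zI); rewrite horner0.
have hB k : ('X + 1 - (z k)%:P).[u] = u - z k + 1 by rewrite !hornerE addrAC.
have hA k : ('X - (z k)%:P).[u] = u - z k by rewrite !hornerE.
have hP Q (f : 'I_n -> {poly F}) :
    (\prod_(j | Q j) f j).[u] = \prod_(j | Q j) (f j).[u] := horner_prod _ _ _ _.
rewrite 2!hornerD hornerN !hornerM !hP horner_sum (eq_bigr _ (fun k _ => hA k)).
rewrite (eq_bigr _ (fun k _ => hB k)) hornerX hornerD hornerX -polyC_natr hornerC => E.
have nz : \prod_i (u - z i + 1) != 0 by apply/prodf_neq0 => i _; apply: hu.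
rewrite prodf_div mulrA; apply: (canRL (mulfK nz)).
rewrite mulrBl; apply/esym/eqP; rewrite -subr_eq0; apply/eqP; rewrite -[RHS]E.
set p := \prod_i (u - z i + 1); set S1 := \sum_i (_ / _); set S2 := \sum_i _.[_].
have -> : S1 * p = S2.
  rewrite mulr_suml; apply: eq_bigr => i _.
  rewrite hornerM hornerC hP (eq_bigr _ (fun k _ => hB k)) /p (bigD1 i) //=.
  by rewrite mulrA divfK.
by ring.
Qed.

(** For u different from z_m, both sides are the divided difference (Q(u) - Q(z_m)) / (u - z_m),
    where Q(z_m) = 0. The factor X - z_m is cancelled between polynomials, so that u = z_m is
    allowed as well. *)
Lemma lagrange_two n (z : 'I_n -> F) (m : 'I_n) (u : F) : injective z ->
  (forall i, z m - z i + 1 != 0) -> (forall i, u - z i + 1 != 0) ->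
  1 + \sum_i resid z i / ((u - z i + 1) * (z m - z i + 1)) =
  (u + n%:R) / (u - z m + 1) * \prod_(i | i != m) ((u - z i) / (u - z i + 1)).
Proof.
move=> zI hm hu.
pose Q i := \prod_(j | j != i) ('X + 1 - (z j)%:P) : {poly F}.
pose Pi := \prod_j ('X + 1 - (z j)%:P) : {poly F}.
have EQ i : ('X + 1 - (z i)%:P) * Q i = Pi by rewrite /Pi (bigD1 i).
have E0 : \sum_i resid z i / (z m - z i + 1) = z m.
  have := lagrange_id zI hm; rewrite [X in _ = _ * X](bigD1 m) //= subrr !mul0r mulr0.
  by move/eqP; rewrite subr_eq0 => /eqP.
have E : Pi + \sum_i (resid z i / (z m - z i + 1))%:P * Q i =
    ('X + n%:R) * \prod_(i | i != m) ('X - (z i)%:P).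
  have nz : 'X - (z m)%:P != 0 by rewrite polyXsubC_eq0.
  apply: (mulfI nz); rewrite [RHS]mulrCA.
  have -> : ('X - (z m)%:P) * \prod_(i | i != m) ('X - (z i)%:P) = \prod_i ('X - (z i)%:P).
    by rewrite [RHS](bigD1 m).
  have := lagrange_poly zI; rewrite -/Pi.
  have -> : \sum_i (resid z i)%:P * \prod_(j | j != i) ('X + 1 - (z j)%:P) =
     (z m)%:P * Pi - ('X - (z m)%:P) * \sum_i (resid z i / (z m - z i + 1))%:P * Q i.
    rewrite -[X in X%:P * Pi]E0 rmorph_sum mulr_suml mulr_sumr -sumrB; apply: eq_bigr => i _ /=.
    rewrite -(EQ i) -/(Q i).
    have -> : ('X - (z m)%:P) = ('X + 1 - (z i)%:P) - (z m - z i + 1)%:P.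
      by rewrite !rmorphD !rmorphN /= rmorph1; ring.
    rewrite -[in LHS](divfK (hm i) (resid z i)) [in LHS]rmorphM /=; ring.
  set S := \sum_i _ => E.
  by apply/eqP; rewrite -subr_eq0 -oppr_eq0; apply/eqP; rewrite -[RHS]E; ring.
have := congr1 (horner^~ u) E.
have hB k : ('X + 1 - (z k)%:P).[u] = u - z k + 1 by rewrite !hornerE addrAC.
have hA k : ('X - (z k)%:P).[u] = u - z k by rewrite !hornerE.
have hP R (f : 'I_n -> {poly F}) :
    (\prod_(j | R j) f j).[u] = \prod_(j | R j) (f j).[u] := horner_prod _ _ _ _.
have nz : \prod_i (u - z i + 1) != 0 by apply/prodf_neq0 => i _; apply: hu.
rewrite hornerD hornerM !hP horner_sum (eq_bigr _ (fun k _ => hA k)) (eq_bigr _ (fun k _ => hB k)).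
rewrite hornerD hornerX -polyC_natr hornerC => E1.
apply: (mulIf nz).
rewrite mulrDl mul1r prodf_div.
have -> : (\sum_i resid z i / ((u - z i + 1) * (z m - z i + 1))) * \prod_i (u - z i + 1)
   = \sum_i ((resid z i / (z m - z i + 1))%:P * Q i).[u].
  rewrite mulr_suml; apply: eq_bigr => i _; rewrite hornerM hornerC hP (eq_bigr _ (fun k _ => hB k)).
  rewrite (bigD1 i) //=; field; rewrite hm hu //.
rewrite E1 [X in _ = _ * X](bigD1 m) //=.
have nz2 : \prod_(i | i != m) (u - z i + 1) != 0 by apply/prodf_neq0 => i _; apply: hu.
by field; rewrite nz2 hu.
Qed.
End Lagrange.

(** * Contents z_i = [zrow la i], c_i = [crow la i], and the coefficients a_i = [coe la i] *)

Section Rows.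
Variables (F : fieldType) (al : F).
(** Linear independence of 1 and al over the integers, the form in which the transcendence of al is
    used. It keeps differences of contents in denominators away from 0, and it implies
    characteristic 0. *)
Hypothesis Hal : forall m r : int, al * m%:~R + r%:~R = 0 -> m = 0 /\ r = 0.
Variable N : nat.
Implicit Types (la : nat -> nat) (i j m : nat).

Lemma al_neq0 : al != 0.
Proof.
by apply/eqP => h; case: (@Hal 1 0) => //; rewrite h mul0r add0r.
Qed.

Lemma natr_neq0 n : n.+1%:R != 0 :> F.
Proof.
by apply/eqP => h; case: (@Hal 0 n.+1%:Z) => //; rewrite mulr0 add0r.
Qed.

(* A Young diagram is given by its row lengths, rows being indexed from 0. *)
Definition rbox la i : nat -> nat := fun j => (la j - (j == i))%N.
Definition young la : Prop := (forall i, la i.+1 <= la i)%N /\ la N = 0%N.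
Definition removable la i := (i < N)%N && (la i.+1 < la i)%N.
Definition addable la m := (m < N)%N && ((m == 0%N) || (la m < la m.-1)%N).
Definition ysize la := (\sum_(i < N) la i)%N.

(* [zrow la i] is the content of the box that follows row [i], and [crow la i] the
   content of the last box of row [i]. *)
Definition zrow la i : F := al * (la i)%:R - i%:R.
Definition crow la i : F := zrow la i - al.

(* The coefficient of J_(la - e_i) in d/dp_1 J_la. *)
Definition coe la i : F :=
  al^-1 * ((zrow la i + N%:R - 1) *
    \prod_(j < N | (j : nat) != i) ((zrow la i - zrow la j - 1) / (zrow la i - zrow la j))).

Lemma coeE la (i : 'I_N) : coe la i = al^-1 * resid (fun j : 'I_N => zrow la j) i.
Proof. by []. Qed.

Lemma young_mono la i j : young la -> (i <= j)%N -> (la j <= la i)%N.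
Proof.
move=> [h _] /subnKC <-; elim: (j - i)%N => [|k IH]; first by rewrite addn0.
by rewrite addnS; apply: leq_trans (h _) IH.
Qed.

Lemma young_ge la i : young la -> (N <= i)%N -> la i = 0%N.
Proof. by move=> h /(young_mono h); case: h => _ -> ; rewrite leqn0 => /eqP. Qed.

(** A coincidence of contents splits into one of row lengths, from the coefficient of al, and one of
    row indices. Most denominators below are handled this way. *)
Lemma zrow_int_relation la mu i j (p q : int) :
  zrow la i - zrow mu j + al * p%:~R + q%:~R = 0 ->
  (la i)%:Z - (mu j)%:Z + p = 0 /\ (j%:Z - i%:Z + q = 0).
Proof.
move=> h; apply: Hal; apply: (etrans _ h) ; rewrite /zrow !rmorphD !rmorphN /= !pmulrn.
ring.
Qed.

Lemma zrow_inj la i j : zrow la i = zrow la j -> i = j.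
Proof.
move=> h; have := @zrow_int_relation la la i j 0 0; rewrite h subrr mulr0 !addr0 => /(_ erefl) [_].
lia.
Qed.

Lemma zrow_neq la i j : i != j -> zrow la i - zrow la j != 0.
Proof. by apply: contra; rewrite subr_eq0 => /eqP/zrow_inj->. Qed.

Lemma rbox_at la i : rbox la i i = (la i).-1.
Proof. by rewrite /rbox eqxx subn1. Qed.
Lemma rbox_ne la i j : j != i -> rbox la i j = la j.
Proof. by rewrite /rbox => /negbTE->; rewrite subn0. Qed.

Lemma young_rem la i : young la -> removable la i -> young (rbox la i).
Proof.
move=> [h h0] /andP[hi hr]; split => [j|]; last by rewrite /rbox h0.
rewrite /rbox; have := h j; case: (eqVneq j i) => [->|_].
  by rewrite (_ : i.+1 == i = false) ?subn0 //; [lia|apply/negbTE; lia].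
by case: (j.+1 == i) => /=; lia.
Qed.

Lemma ysize_rem la i : removable la i -> ysize la = (ysize (rbox la i)).+1.
Proof.
move=> /andP[hi hr]; rewrite /ysize (bigD1 (Ordinal hi)) //= [X in _ = X.+1](bigD1 (Ordinal hi)) //=.
rewrite rbox_at -addSn prednK; last by lia.
by congr (_ + _)%N; apply: eq_bigr => j hj; rewrite rbox_ne.
Qed.

Lemma addable_rem la i : young la -> removable la i -> addable (rbox la i) i.
Proof.
move=> hp /andP[hi hr]; rewrite /addable hi /=; case: i hi hr => [//|i] hi hr /=.
rewrite rbox_at rbox_ne; last by lia.
by have := young_mono hp (leqnSn i); lia.
Qed.

Lemma zrow_rem_at la i : removable la i -> zrow (rbox la i) i = crow la i.
Proof.
move=> /andP[hi hr] ; rewrite /zrow /crow /zrow rbox_at -subn1 natrB; last by lia.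
ring.
Qed.

Lemma zrow_rem_ne la i j : j != i -> zrow (rbox la i) j = zrow la j.
Proof. by move=> h ; rewrite /zrow rbox_ne. Qed.

Lemma crow_rem_ne la i j : j != i -> crow (rbox la i) j = crow la j.
Proof. by move=> h; rewrite /crow zrow_rem_ne. Qed.

Lemma crow_rem_at la i : removable la i -> crow (rbox la i) i = crow la i - al.
Proof. by move=> h; rewrite {1}/crow zrow_rem_at. Qed.

Lemma rbox_comm la i j : rbox (rbox la i) j = rbox (rbox la j) i.
Proof. by apply/funext => k; rewrite /rbox subnAC. Qed.

Lemma removable_rem la i j : young la -> removable la i -> removable la j -> i != j -> removable (rbox la i) j.
Proof.
move=> hp /andP[hi hri] /andP[hj hrj] hij; rewrite /removable hj (@rbox_ne la i j) 1?eq_sym //=.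
by apply: leq_ltn_trans hrj; rewrite /rbox leq_subr.
Qed.

(** If rows i and i + 1 have the same length, then z_(i+1) = z_i - 1 and a factor vanishes; for an
    empty last row it is z_i + N - 1. Hence sums over the removable rows can be written over all
    rows. *)
Lemma coe_not_removable la i : young la -> (i < N)%N -> ~~ removable la i -> coe la i = 0.
Proof.
move=> hp hi; rewrite /removable hi /= -leqNgt => hr.
have e : la i.+1 = la i by apply/eqP; rewrite eqn_leq hr young_mono.
rewrite /coe; case: (ltnP i.+1 N) => hN.
  rewrite (bigD1 (Ordinal hN)) //=; last by lia.
  by rewrite /zrow e [X in X / _](_ : _ = 0) ?mul0r ?mulr0 // -natr1; ring.
have eN : N = i.+1 by lia.
have l0 : la i = 0%N by rewrite -e young_ge // eN.
by rewrite [X in _ * (X * _)](_ : _ = 0) ?mul0r ?mulr0 // /zrow l0 eN -natr1; ring.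
Qed.

Lemma coe_neq0_removable la i : young la -> (i < N)%N -> coe la i != 0 -> removable la i.
Proof. by move=> hp hi; apply: contraNT => /(coe_not_removable hp hi) ->. Qed.

Lemma coe_neq0 la i : young la -> removable la i -> coe la i != 0.
Proof.
move=> hp /andP[hi hr]; rewrite /coe mulf_neq0 ?invr_eq0 ?al_neq0 // mulf_neq0 //.
  apply/eqP => h.
  have [] := @Hal (la i)%:Z (N%:Z - i%:Z - 1); last by lia.
  by apply: (etrans _ h) ; rewrite /zrow !rmorphB /= !pmulrn; ring.
apply/prodf_neq0 => j hj; rewrite mulf_neq0 ?invr_eq0 ?zrow_neq 1?eq_sym //.
apply/eqP => h; have [] := @zrow_int_relation la la i j 0 (-1).
  by apply: (etrans _ (esym h)); rewrite rmorphN /=; ring.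
move=> h1 h2; have e : nat_of_ord j = i.+1 by lia.
by move: h1; rewrite e; lia.
Qed.

Lemma zrow_inj_ord la : injective (fun j : 'I_N => zrow la j).
Proof. by move=> i j /zrow_inj/ord_inj. Qed.

Lemma coe_genfun la (u : F) : (forall i : 'I_N, u - zrow la i + 1 != 0) ->
  u - \sum_(i < N) al * coe la i / (u - zrow la i + 1) =
  (u + N%:R) * \prod_(i < N) ((u - zrow la i) / (u - zrow la i + 1)).
Proof.
move=> h; rewrite -(lagrange_id (@zrow_inj_ord la) h); congr (_ - _).
by apply: eq_bigr => i _; rewrite coeE mulrA divff ?mul1r ?al_neq0.
Qed.

(** A row with z_i = z_m + 1 would be row m - 1 with the same length as row m, which addability
    excludes. *)
Lemma addable_zrow_neq la m : young la -> addable la m -> forall i : 'I_N, zrow la m - zrow la i + 1 != 0.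
Proof.
move=> hp /andP[hm ha] i; apply/eqP => h.
have [] := @zrow_int_relation la la m i 0 1; first by apply: (etrans _ h); ring.
move=> h1 h2; have e : m = i.+1 by lia.
by move: ha h1; rewrite e /=; lia.
Qed.

Lemma zrow_add_al_neq la m i : zrow la m - zrow la i + al != 0.
Proof.
apply/eqP => h.
have [] := @zrow_int_relation la la m i 1 0; first by apply: (etrans _ h); ring.
move=> h1 h2; have e : m = i by lia.
by move: h1; rewrite e; lia.
Qed.

(** [coe_genfun] at u = z_m, a zero of Q. *)
Lemma sum_coe_addable la m : young la -> addable la m ->
  \sum_(i < N) al * coe la i / (zrow la m - zrow la i + 1) = zrow la m.
Proof.
move=> hp ha; have hm : (m < N)%N by case/andP: ha.
have := coe_genfun (addable_zrow_neq hp ha); rewrite (bigD1 (Ordinal hm) (F := fun i : 'I_N => (zrow la m - zrow la i) / (zrow la m - zrow la i + 1))) //=.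
by rewrite subrr mul0r mul0r mulr0 => /eqP; rewrite subr_eq0 => /eqP/esym.
Qed.


(** The ratio of a_i before and after a box of content c is removed from another row, at x = c - c_i
    ([coe_rbox]). Since Bf(al) = 0, formulas over the other rows extend to all rows. *)
Definition Bf (x : F) : F := (x - al) * (x + 1) / (x * (x + 1 - al)).

Lemma coe_rbox la m i : young la -> removable la m -> (i < N)%N -> i != m ->
  coe la i = coe (rbox la m) i * Bf (crow la m - crow la i).
Proof.
move=> hp hm hi him.
have hN : (m < N)%N by case/andP: hm.
have hp' := young_rem hp hm; have ha := addable_rem hp hm.
rewrite /coe (bigD1 (Ordinal hN)) //=; last by rewrite eq_sym.
rewrite [in RHS](bigD1 (Ordinal hN)) //=; last by rewrite eq_sym.
rewrite zrow_rem_ne //.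
have -> : \prod_(j < N | (nat_of_ord j != i) && (j != Ordinal hN))
    ((zrow la i - zrow (rbox la m) j - 1) / (zrow la i - zrow (rbox la m) j)) =
  \prod_(j < N | (nat_of_ord j != i) && (j != Ordinal hN))
    ((zrow la i - zrow la j - 1) / (zrow la i - zrow la j)).
  by apply: eq_bigr => j /andP[_ hj]; rewrite zrow_rem_ne.
set p := \prod_(j < N | _) _.
rewrite zrow_rem_at // /Bf.
have n1 : zrow la m - zrow la i != 0 by rewrite zrow_neq // eq_sym.
have n2 := addable_zrow_neq hp' ha (Ordinal hi); rewrite /= zrow_rem_at // zrow_rem_ne // in n2.
have n3 : crow la m - zrow la i != 0.
  by have := @zrow_neq (rbox la m) m i; rewrite zrow_rem_at // zrow_rem_ne // eq_sym => ->.
rewrite /crow in n2 n3 *; set x := zrow la m in n1 n2 n3 *; set y := zrow la i in n1 n2 n3 *.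
field.
have -> : x - al - (y - al) = x - y by ring.
have -> : x - y + 1 - al = x - al - y + 1 by ring.
have -> : y - (x - al) = - (x - al - y) by ring.
by rewrite -(opprB x y) !oppr_eq0 n1 n2 n3 al_neq0.
Qed.

Lemma al1_neq0 : al - 1 != 0.
Proof.
apply/eqP => h; case: (@Hal 1 (-1)) => //.
by apply: (etrans _ h); rewrite rmorphN /= mulr1.
Qed.

Lemma crow_rem_sub la m i : removable la m -> crow la m - crow (rbox la m) i = zrow (rbox la m) m - zrow (rbox la m) i + al.
Proof. by move=> hm; rewrite -zrow_rem_at // /crow; ring. Qed.

Lemma crow_gaps_neq0 la m : young la -> removable la m -> forall i : 'I_N,
  (crow la m - crow (rbox la m) i != 0) && (crow la m - crow (rbox la m) i + 1 - al != 0).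
Proof.
move=> hp hm i; rewrite crow_rem_sub // zrow_add_al_neq /=.
have := addable_zrow_neq (young_rem hp hm) (addable_rem hp hm) i.
set x := zrow _ m; set y := zrow _ i.
by have -> : x - y + al + 1 - al = x - y + 1 by ring.
Qed.

(** Q of the smaller diagram is evaluated at its z_m, where it vanishes, and at z_m + al - 1, where
    its product becomes the one in a_m. The sum is the difference of the two partial fraction
    expansions, divided by al - 1. *)
Lemma coe_rbox_self la m : young la -> removable la m ->
  coe la m = 1 + \sum_(i < N) coe (rbox la m) i *
    (al / ((crow la m - crow (rbox la m) i + 1 - al) * (crow la m - crow (rbox la m) i))).
Proof.
move=> hp hm; have hp' := young_rem hp hm; have ha := addable_rem hp hm.
have hN : (m < N)%N by case/andP: hm.
set nu := rbox la m in hp' ha *.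
pose u2 := zrow nu m + al - 1.
have h2 (i : 'I_N) : u2 - zrow nu i + 1 != 0.
  have := zrow_add_al_neq nu m i; rewrite /u2; set x := zrow nu m; set y := zrow nu i.
  by have -> : x + al - 1 - y + 1 = x - y + al by ring.
have E2 := coe_genfun h2; have E1 := sum_coe_addable hp' ha.
have -> : \sum_(i < N) coe nu i * (al / ((crow la m - crow nu i + 1 - al) * (crow la m - crow nu i))) =
   (\sum_(i < N) al * coe nu i / (zrow nu m - zrow nu i + 1) - \sum_(i < N) al * coe nu i / (u2 - zrow nu i + 1)) / (al - 1).
  rewrite -sumrB mulr_suml; apply: eq_bigr => i _.
  rewrite crow_rem_sub // -/nu /u2; move: (addable_zrow_neq hp' ha i) (h2 i); rewrite /u2.
  set x := zrow nu m; set y := zrow nu i => n1 n2.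
  have n3 : x - y + al != 0 by exact: zrow_add_al_neq.
  field.
  by rewrite al1_neq0 n1 n2.
rewrite E1; have -> : \sum_(i < N) al * coe nu i / (u2 - zrow nu i + 1) =
    u2 - (u2 + N%:R) * \prod_(i < N) ((u2 - zrow nu i) / (u2 - zrow nu i + 1)).
  by rewrite -E2; ring.
rewrite (bigD1 (Ordinal hN)) //= /coe.
have -> : \prod_(i < N | i != Ordinal hN) ((u2 - zrow nu i) / (u2 - zrow nu i + 1)) =
   \prod_(j < N | nat_of_ord j != m) ((zrow la m - zrow la j - 1) / (zrow la m - zrow la j)).
  apply: eq_big => [j|j hj]; first by rewrite -val_eqE.
  rewrite /u2 zrow_rem_at // zrow_rem_ne // /crow.
  by congr (_ / _); ring.
set p := \prod_(j < N | _) _.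
rewrite /u2 zrow_rem_at // /crow.
field.
have -> : zrow la m - al + al - 1 - (zrow la m - al) + 1 = al by ring.
by rewrite !(al_neq0, al1_neq0).
Qed.

Lemma Bf_sum x : x != 0 -> x + 1 - al != 0 -> al / ((x + 1 - al) * x) + Bf x = 1.
Proof. by move=> h1 h2; rewrite /Bf; field; rewrite h1 h2. Qed.

Lemma Bf_al : Bf al = 0.
Proof. by rewrite /Bf subrr !mul0r. Qed.

Definition plen la := find (fun i => la i == 0%N) (iota 0 N).

Lemma plen_le la : (plen la <= N)%N.
Proof. by have := find_size (fun i => la i == 0%N) (iota 0 N); rewrite size_iota. Qed.

Lemma plenP la i : young la -> (0 < la i)%N = (i < plen la)%N.
Proof.
move=> hp; have hz : la (plen la) = 0%N.
  have := plen_le la; rewrite leq_eqVlt => /orP[/eqP->|h]; first by case: hp.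
  have hh : has (fun i => la i == 0%N) (iota 0 N) by rewrite has_find size_iota.
  by have := nth_find 0%N hh; rewrite nth_iota // add0n => /eqP.
case: (ltnP i (plen la)) => hi.
  have := before_find 0%N hi; rewrite nth_iota; last exact: leq_trans hi (plen_le la).
  by rewrite add0n lt0n => ->.
by have := young_mono hp hi; rewrite hz leqn0 => /eqP->.
Qed.

Lemma removable_last la : young la -> (0 < ysize la)%N -> removable la (plen la).-1.
Proof.
move=> hp; rewrite lt0n /ysize sum_nat_eq0 negb_forall => /existsP[i /= hi].
have h0 : (i < plen la)%N by rewrite -(plenP i hp) lt0n.
have h1 : (0 < la (plen la).-1)%N by rewrite (plenP _ hp); lia.
have h2 : la (plen la) = 0%N by have := plenP (plen la) hp; rewrite ltnn; lia.
by rewrite /removable; have := plen_le la; move: h1 h2; case: (plen la) h0 => [//|k] /= _ h1 -> ->; rewrite h1.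
Qed.

(** Compared with the diagram without box m, the other coefficients carry a factor Bf(x), while a_m
    is 1 plus the same coefficients with weight 1 - Bf(x) ([Bf_sum]). So the sum grows by exactly 1
    with each box. *)
Lemma sum_coe la : young la -> \sum_(i < N) coe la i = (ysize la)%:R.
Proof.
move: {2}(ysize la) (erefl (ysize la)) => n; elim: n la => [|n IH] la En hp.
  rewrite En big1 // => i _; apply: coe_not_removable => //.
  by move: En => /eqP; rewrite /ysize sum_nat_eq0 => /forallP /(_ i) /= /eqP h; rewrite /removable h ltn0 andbF.
have [m hm] : exists m, removable la m.
  by exists (plen la).-1; apply: removable_last; rewrite // En.
have hN : (m < N)%N by case/andP: hm.
have hp' := young_rem hp hm; have ha := addable_rem hp hm.
have En' : ysize (rbox la m) = n by move: En; rewrite (ysize_rem hm) => -[].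
rewrite (bigD1 (Ordinal hN)) //= coe_rbox_self //.
have -> : \sum_(i < N | i != Ordinal hN) coe la i =
  \sum_(i < N) coe (rbox la m) i * Bf (crow la m - crow (rbox la m) i).
  rewrite [RHS](bigD1 (Ordinal hN)) //= crow_rem_at // subKr Bf_al mulr0 add0r.
  apply: eq_bigr => i hi; rewrite (coe_rbox hp hm) // crow_rem_ne //.
rewrite -addrA -big_split /= (eq_bigr (fun i : 'I_N => coe (rbox la m) i)); last first.
  move=> i _; have /andP[h1 h2] := crow_gaps_neq0 hp hm i.
  by rewrite -mulrDr Bf_sum // mulr1.
by rewrite IH // En' En -nat1r.
Qed.

End Rows.

(** * Jack functions *)

Section Jack.
Variables (F : fieldType) (al : F).
Hypothesis Hal : forall m r : int, al * m%:~R + r%:~R = 0 -> m = 0 /\ r = 0.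
Variable N : nat.
Local Notation Lam := (seq nat -> F^o).
Implicit Types (f g : Lam) (Ph Ps : nat -> Lam) (la : nat -> nat).
Local Notation Cop := (Cop al).
Local Notation Dop := (Dop al).
Local Notation Bop := (Bop al).
Local Notation Lop := (Lop al).
Local Notation Dhat := (Dhat al).
Local Notation Dtilde := (Dtilde al).
Local Notation zrow := (zrow al).
Local Notation crow := (crow al).
Local Notation coe := (coe al N).
Local Notation Bf := (Bf al).
Local Notation removable := (removable N).
Local Notation addable := (addable N).
Local Notation young := (young N).
Local Notation ysize := (ysize N).
Local Notation plen := (plen N).

Let F2 : (2 : F) != 0. Proof. exact: (natr_neq0 Hal 1). Qed.

(** C_0 f = sum_k (k + 2) p_(k+1) d_(k+2) f. When d_(k+1) f = 0, applying d_(k+1) leaves (k + 2)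
    d_(k+2) f, so all first derivatives vanish in turn. *)
Lemma vanish_d f : swap_inv f -> f [::] = 0 -> dpow 0 f = 0 -> Cop 0 f = 0 -> f = 0.
Proof.
move=> hf h0 hd hC.
suff hk k : dpow k f = 0.
  by apply/funext => -[//|k s]; rewrite -[LHS]/(dpow k f s) hk.
elim: k => [//|k IH].
have := congr1 (dpow k) hC; rewrite C0E dU (lin_zero (@dpow_linear F k)).
have -> : dd k (wt (fun k => k.+2) (Csh 0 f)) = 0.
  apply/funext => m; rewrite /dd /wt (lin_scale _ _ (@dpow_linear F k)) /Csh dC // IH.
  by rewrite (lin_zero (@dpow_linear F _)) scaler0.
rewrite (lin_zero (@Uop_linear F)) addr0 /wt => /eqP; rewrite scaler_eq0.
by rewrite (negbTE (natr_neq0 Hal _)) => /eqP.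
Qed.

(** By [d_Dt], applying d_1 to the eigenvalue equation leaves C_0 ([Ph k]) + (k + 1) [Ph k.+1] = 0,
    so each coefficient forces the next one to vanish. *)
Lemma vanish_Dt e Ph : (forall k, swap_inv (Ph k)) -> Ph 0%N = 0 -> dd 0 Ph = 0 ->
  Dtilde Ph = e *: Ph -> Ph = 0.
Proof.
move=> hP h0 hd hD; apply/funext; elim=> [//|k IH].
have := d_Dt al 0 k hP; rewrite hD hd.
have -> : dpow 0 ((e *: Ph) k) = 0.
  by rewrite -[(e *: Ph) k]/(e *: Ph k) IH scaler0 (lin_zero (@dpow_linear F 0)).
rewrite (lin_zero (@Dtilde_linear F al)) IH (lin_zero (@Cop_linear F al 0)) !add0r => /esym/eqP.
by rewrite scaler_eq0 (negbTE (natr_neq0 Hal _)) => /eqP.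
Qed.

Definition one : Lam := fun s => (s == [::])%:R.

(* For an addable row [m], [Phi n la (zrow la m)] is the eigenvector of [Lop] with
   eigenvalue [zrow la m] whose w^0-term is J_la. Any removable row could replace
   the last one in the first summand (lemma [step_indep]). *)
Fixpoint Phi n la u : nat -> Lam :=
  if n is n'.+1 then
    vac (Uop (Phi n' (rbox la (plen la).-1) (crow la (plen la).-1)))
    + \sum_(i < N) (al * coe la i / (u - crow la i + 1 - al)) *: Wop (Phi n' (rbox la i) (crow la i))
  else vac one.

(** The eigenvalue 0 is a placeholder: the w^0-term does not depend on it ([Phi_at0]). *)
Definition jackF n la : Lam := Phi n la 0 0%N.
Definition Phi_rem n la i := Phi n.-1 (rbox la i) (crow la i).

Lemma ysize0_coe la i : young la -> ysize la = 0%N -> (i < N)%N -> coe la i = 0.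
Proof.
move=> hp h0 hi; apply: coe_not_removable => //; apply/negP => /ysize_rem; by rewrite h0.
Qed.

Lemma PhiE n la u : young la -> ysize la = n ->
  Phi n la u = vac (jackF n la) + \sum_(i < N) (al * coe la i / (u - crow la i + 1 - al)) *: Wop (Phi_rem n la i).
Proof.
case: n => [|n] hp hn.
  rewrite big1 ?addr0 // => i _; by rewrite ysize0_coe // mulr0 mul0r scale0r.
rewrite {1}/Phi -/Phi; congr (_ + _); congr vac.
rewrite /jackF /Phi -/Phi.
set X := Uop _; change (X = X + (\sum_(i < N) (al * coe la i / (0 - crow la i + 1 - al)) *: Wop (Phi_rem n.+1 la i)) 0%N).
rewrite sumfE big1 ?addr0 // => i _.
exact: scaler0.
Qed.

Lemma Phi_at0 n la u : young la -> ysize la = n -> Phi n la u 0%N = jackF n la.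
Proof.
move=> hp hn; rewrite PhiE //.
change (jackF n la + (\sum_(i < N) (al * coe la i / (u - crow la i + 1 - al)) *: Wop (Phi_rem n la i)) 0%N = jackF n la).
rewrite sumfE big1 ?addr0 // => i _.
exact: scaler0.
Qed.

(** The sum of the contents al j - i of all boxes (i, j). *)
Definition eig la : F := \sum_(i < N) (al * 'C(la i, 2)%:R - (la i * i)%:R).

Lemma eig_rem la i : removable la i -> eig la = eig (rbox la i) + crow la i.
Proof.
move=> /andP[hi hr]; rewrite /eig (bigD1 (Ordinal hi)) //= [X in _ = X + _](bigD1 (Ordinal hi)) //=.
have -> : \sum_(j < N | j != Ordinal hi) (al * 'C(rbox la i j, 2)%:R - (rbox la i j * j)%:R) =
  \sum_(j < N | j != Ordinal hi) (al * 'C(la j, 2)%:R - (la j * j)%:R).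
  by apply: eq_bigr => j hj; rewrite rbox_ne.
rewrite [RHS]addrAC; congr (_ + _); rewrite rbox_at /crow /zrow.
case: (la i) hr => [//|p] _ /=.
rewrite binS bin1 mulSn !natrD -natr1; ring.
Qed.

(** A simultaneous induction: [jk_L] and [jk_Dh] at size n give [jk_D] at size n + 1; [jk_d] and
    [jk_U] give the d/dp_1 rule and the independence of the removed row; with [jk_B] these give
    [jk_B] at size n + 1, on which [jk_L] rests. The two coefficients in [jk_d] add up to 1
    ([Bf_sum]). *)
Record jack_ok n la : Prop := JackOk {
  jk_sym : forall u k, swap_inv (Phi n la u k);
  jk_D : Dop (jackF n la) = eig la *: jackF n la;
  jk_B : Bop (jackF n la) = \sum_(i < N) (al * coe la i) *: Phi_rem n la i;
  jk_U : forall i, removable la i -> jackF n la = Uop (Phi_rem n la i);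
  jk_Dh : forall u, Dhat (Phi n la u) = eig la *: Phi n la u;
  jk_L : forall m, addable la m -> Lop (Phi n la (zrow la m)) = zrow la m *: Phi n la (zrow la m);
  jk_d : forall m, addable la m -> dd 0 (Phi n la (zrow la m)) =
    \sum_(i < N) coe la i *:
      ((al / ((zrow la m - crow la i + 1 - al) * (zrow la m - crow la i))) *: Phi_rem n la i
       + Bf (zrow la m - crow la i) *: Phi n.-1 (rbox la i) (zrow la m)) }.

Lemma d_one j : dpow j one = 0.
Proof. by apply/funext. Qed.

Lemma C_one j : Cop j one = 0.
Proof.
rewrite /Cop d_one scaler0 addr0 big1 => [|i _]; last first.
  by rewrite d_one (lin_zero (@dpow_linear F _)) scaler0.
rewrite scaler0 addr0 (_ : wt _ _ = 0) ?(lin_zero (@Uop_linear F)) //.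
by apply/funext => k; rewrite /wt /Csh d_one scaler0.
Qed.

Lemma D_one : Dop one = 0.
Proof.
apply/funext; case=> [//|j s].
change (Dop (dpow j one) s + Cop j one s = 0).
by rewrite d_one C_one (lin_zero (@Dop_linear F al)) addr0.
Qed.

Lemma B_one : Bop one = 0.
Proof. by apply/funext => k; rewrite /Bop d_one scaler0. Qed.

Lemma swap_inv_one : swap_inv one.
Proof. by move=> l a b s; rewrite /one -!size_eq0 !size_cat. Qed.

Lemma ysize0_at la i : young la -> ysize la = 0%N -> la i = 0%N.
Proof.
move=> hp h0; apply/eqP; rewrite -leqn0; apply: leq_trans (young_mono hp (leq0n i)) _.
case: (posnP N) => [e|hN]; first by case: hp => _; rewrite e => ->.
have h : (la 0%N <= ysize la)%N by rewrite /ysize (bigD1 (Ordinal hN)) //= leq_addr.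
by rewrite h0 in h.
Qed.

Lemma jack_ok0 la : young la -> ysize la = 0%N -> jack_ok 0 la.
Proof.
move=> hp h0; have hz i := ysize0_at i hp h0.
have he : eig la = 0 by rewrite /eig big1 // => i _; rewrite hz mulr0 mul0n subr0.
have hs (V : lmodType F) (G : 'I_N -> V) x : \sum_(i < N) (x * coe la i) *: G i = 0.
  by rewrite big1 // => i _; rewrite ysize0_coe // mulr0 scale0r.
have hnr i : ~~ removable la i by rewrite /removable !hz ltnn andbF.
have hm m : addable la m -> zrow la m = 0.
  by rewrite /addable !hz orbF => /andP[_ /eqP->]; rewrite /zrow hz mulr0 subr0.
split.
- by move=> u [|k]; [exact: swap_inv_one|exact: swap_inv0].
- by rewrite he scale0r /jackF /= D_one.
- by rewrite hs /jackF /= B_one.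
- by move=> i; rewrite (negbTE (hnr i)).
- by move=> u; rewrite he scale0r /= Dh_vac D_one (lin_zero (@vac_linear F)).
- by move=> m /hm ->; rewrite scale0r /= L_vac B_one (lin_zero (@Wop_linear F)).
- move=> m /hm _; rewrite /= dd_vac d_one (lin_zero (@vac_linear F)) big1 // => i _.
  by rewrite ysize0_coe // scale0r.
Qed.

Lemma lin_comb2 (V V' : lmodType F) (u : V -> V') (a x y : F) A A' : linear u ->
  a *: u (x *: A + y *: A') = (a * x) *: u A + (a * y) *: u A'.
Proof.
by move=> hu; rewrite (lin_add _ _ hu) !(lin_scale _ _ hu) scalerDr !scalerA.
Qed.

Lemma lin_comb3 (V : lmodType F) (u v b : F) (P P' : V) :
  u *: ((al * v) *: P) - (al * u) *: (v *: ((1 - b) *: P + b *: P')) = (al * u * v * b) *: (P - P').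
Proof.
rewrite scalerDr !scalerA scalerDr !scalerA opprD addrA -scalerBl scalerBr.
by congr (_ *: _ - _ *: _); ring.
Qed.

Section Step.
Variable n : nat.
Hypothesis IH : forall la, young la -> ysize la = n -> jack_ok n la.
Variable la : nat -> nat.
Hypothesis hp : young la.
Hypothesis hn : ysize la = n.+1.

Let IHr i (hi : removable la i) : jack_ok n (rbox la i).
Proof. by apply: IH; [exact: young_rem|move: hn; rewrite (ysize_rem hi) => -[]]. Qed.

Let szr i (hi : removable la i) : ysize (rbox la i) = n.
Proof. by move: hn; rewrite (ysize_rem hi) => -[]. Qed.

Let X t := Uop (Phi_rem n.+1 la t).

(** Under the weight a_i, row i may be assumed removable. *)
Lemma coeP (V : lmodType F) (mu : nat -> nat) (i : 'I_N) (v w : V) : young mu ->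
  (removable mu i -> v = w) -> coe mu i *: v = coe mu i *: w.
Proof.
move=> hmu h; case: (boolP (removable mu i)) => [/h ->//|hr].
by rewrite (coe_not_removable al hmu _ hr) ?scale0r.
Qed.

(** The eigenvalues of [Dhat] and [Lop] add up: the content sum of the smaller diagram plus the
    content of the removed box. *)
Lemma Phi_rem_Dtilde t : removable la t -> Dtilde (Phi_rem n.+1 la t) = eig la *: Phi_rem n.+1 la t.
Proof.
move=> ht; have ok := IHr ht; have ha := addable_rem hp ht.
rewrite /Phi_rem /=; change (Dtilde ?P) with (Dhat P + Lop P).
by rewrite (jk_Dh ok) -(zrow_rem_at al ht) (jk_L ok ha) -scalerDl (eig_rem ht) (zrow_rem_at al ht).
Qed.

Lemma Phi_rem_sym t : removable la t -> forall k, swap_inv (Phi_rem n.+1 la t k).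
Proof. by move=> ht k; apply: (jk_sym (IHr ht)). Qed.

Lemma step_D t : removable la t -> Dop (X t) = eig la *: X t.
Proof.
move=> ht; rewrite /X (D_U al F2) ?Phi_rem_Dtilde //; last exact: Phi_rem_sym.
by rewrite (lin_scale _ _ (@Uop_linear F)).
Qed.

Lemma step_sym t : removable la t -> swap_inv (X t).
Proof. by move=> ht; apply: swap_inv_U; apply: Phi_rem_sym. Qed.

(** The w^0-term of the eigenvector and the first part of [jk_d] combine to the summand of t by
    [coe_rbox_self]; the second part gives the other summands by [coe_rbox]. The result does not
    depend on t, as [step_indep] needs. *)
Lemma step_d t : removable la t -> dpow 0 (X t) = \sum_(i < N) coe la i *: jackF n (rbox la i).
Proof.
move=> ht; have ok := IHr ht; have ha := addable_rem hp ht; have sz := szr ht.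
have hp' := young_rem hp ht; have hN : (t < N)%N by case/andP: ht.
rewrite /X dU {1}/Phi_rem Phi_at0 //.
rewrite {1}/Phi_rem /= -(zrow_rem_at al ht) (jk_d ok ha) (lin_comb _ _ (@Uop_linear F)) (zrow_rem_at al ht).
rewrite (eq_bigr _ (fun i _ => lin_comb2 _ _ _ _ _ (@Uop_linear F))).
rewrite big_split /= addrA.
have -> : jackF n (rbox la t) + \sum_(i < N) (coe (rbox la t) i *
   (al / ((crow la t - crow (rbox la t) i + 1 - al) * (crow la t - crow (rbox la t) i)))) *: Uop (Phi_rem n (rbox la t) i)
   = coe la t *: jackF n (rbox la t).
  rewrite (coe_rbox_self Hal hp ht) scalerDl scale1r scaler_suml; congr (_ + _).
  apply: eq_bigr => i _; rewrite mulrC -[LHS]scalerA -[RHS]scalerA; congr (_ *: _).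
  by apply: coeP => // hi; rewrite (jk_U ok hi).
rewrite [RHS](bigD1 (Ordinal hN)) //=; congr (_ + _).
rewrite (bigD1 (Ordinal hN)) //= (crow_rem_at al ht) subKr Bf_al mulr0 scale0r add0r.
apply: eq_bigr => i hi; rewrite crow_rem_ne // -(coe_rbox Hal hp ht) //.
apply: coeP => // hri.
rewrite (jk_U (IHr hri) (i := t)); last by apply: removable_rem => //.
by rewrite /Phi_rem rbox_comm crow_rem_ne // eq_sym.
Qed.

Lemma C0_D f : Cop 0 f = dpow 0 (Dop f) - Dop (dpow 0 f).
Proof. by rewrite -[dpow 0 (Dop f)]/(Dop (dpow 0 f) + Cop 0 f) addrC addrA addNr add0r. Qed.

(** The difference is killed by d_1 because of [step_d], and by C_0 = [d_1, D] because both
    functions have the same eigenvalue under D; [vanish_d] applies. *)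
Lemma step_indep t t' : removable la t -> removable la t' -> X t = X t'.
Proof.
move=> ht ht'; apply/eqP; rewrite -subr_eq0; apply/eqP.
have subE (u : Lam -> Lam) : linear u -> u (X t - X t') = u (X t) - u (X t').
  move=> hu; rewrite (lin_add _ _ hu); congr (_ + _).
  by rewrite -scaleN1r (lin_scale _ _ hu) scaleN1r.
apply: vanish_d.
- by apply: swap_invD; [|rewrite -scaleN1r; apply: swap_invZ]; apply: step_sym.
- by rewrite -[LHS]/(0 - 0 : F) subrr.
- by rewrite subE ?step_d ?subrr //; apply: dpow_linear.
- rewrite subE; last exact: Cop_linear.
  by rewrite !C0_D !step_D // !(lin_scale _ _ (@dpow_linear F 0)) !step_d // subrr.
Qed.

Lemma step_J t : removable la t -> jackF n.+1 la = X t.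
Proof.
move=> ht; rewrite -(step_indep (removable_last hp _) ht) ?hn //.
rewrite /jackF /= -[LHS]/(_ + (_ : nat -> Lam) 0%N).
rewrite sumfE big1 ?addr0 // => i _.
exact: scaler0.
Qed.

Let hlast : removable la (plen la).-1.
Proof. by apply: removable_last; rewrite // hn. Qed.

Lemma step_symJ : swap_inv (jackF n.+1 la).
Proof. by rewrite (step_J hlast); apply: step_sym. Qed.

Lemma step_dJ : dpow 0 (jackF n.+1 la) = \sum_(i < N) coe la i *: jackF n (rbox la i).
Proof. by rewrite (step_J hlast) (step_d hlast). Qed.

Lemma step_DJ : Dop (jackF n.+1 la) = eig la *: jackF n.+1 la.
Proof. by rewrite (step_J hlast) (step_D hlast). Qed.

(** The weight of removing a box from row i and then from row k, in a form symmetric in i and k. The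
    value 0 at k = i agrees with [wgtE] because Bf(al) = 0. *)
Let wgt (i k : nat) : F := if k == i then 0 else al * coe la i * coe la k.

Lemma wgtE (i k : 'I_N) : removable la i ->
  wgt i k = al * coe la i * coe (rbox la i) k * Bf (crow la i - crow (rbox la i) k).
Proof.
move=> hi; rewrite /wgt; case: eqVneq => [->|hk].
  by rewrite (crow_rem_at al hi) subKr Bf_al mulr0.
by rewrite (coe_rbox Hal hp hi (ltn_ord k)) // (@crow_rem_ne _ al la i k) // !mulrA.
Qed.

(** The weight is symmetric and the difference antisymmetric under the exchange of i and k. *)
Lemma step_antisym :
  \sum_(i < N) \sum_(k < N) wgt i k *: (Phi n.-1 (rbox (rbox la i) k) (crow la k) -
     Phi n.-1 (rbox (rbox la i) k) (crow la i)) = 0.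
Proof.
under eq_bigr => i _ do under eq_bigr => k _ do rewrite scalerBr.
under eq_bigr => i _ do rewrite sumrB.
rewrite sumrB exchange_big /=; apply/eqP; rewrite subr_eq0; apply/eqP.
apply: eq_bigr => k _; apply: eq_bigr => i _; rewrite rbox_comm; congr (_ *: _).
by rewrite /wgt eq_sym; case: ifP => // _; rewrite mulrAC.
Qed.

Lemma step_dB :
  dd 0 (Bop (jackF n.+1 la) - \sum_(i < N) (al * coe la i) *: Phi_rem n.+1 la i) = 0.
Proof.
rewrite -scaleN1r (lin_add _ _ (@dd_linear F 0)) (lin_scale _ _ (@dd_linear F 0)) scaleN1r.
rewrite dd_B ?step_dJ; last exact: step_symJ.
rewrite (lin_comb _ _ (@Bop_linear F al)) (lin_comb _ _ (@dd_linear F 0)).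
rewrite -sumrB -[RHS]step_antisym; apply: eq_bigr => i _.
case: (boolP (removable la i)) => [hi|hi]; last first.
  rewrite (coe_not_removable al hp _ hi) // mulr0 !scale0r subrr big1 // => k _.
  by rewrite /wgt (coe_not_removable al hp _ hi) // mulr0 mul0r if_same scale0r.
have ok := IHr hi; have ha := addable_rem hp hi.
rewrite (jk_B ok) {2}/Phi_rem /= -(zrow_rem_at al hi) (jk_d ok ha) (zrow_rem_at al hi).
rewrite !scaler_sumr -sumrB; apply: eq_bigr => k _.
set P' := Phi n.-1 _ (crow la i).
have -> : wgt i k *: (Phi n.-1 (rbox (rbox la i) k) (crow la k) - P') = wgt i k *: (Phi_rem n (rbox la i) k - P').
  rewrite /wgt; case: eqVneq => [->|hk]; first by rewrite !scale0r.
  by rewrite /Phi_rem crow_rem_ne.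
rewrite wgtE //; set x := crow la i - crow (rbox la i) k.
have /andP[h1 h2] := crow_gaps_neq0 Hal hp hi k.
rewrite -[al / _](addrK (Bf x)) Bf_sum //.
exact: lin_comb3.
Qed.

(** The difference of the two sides is an eigenvector of [Dtilde] by [B_D], is killed by d_1
    ([step_dB]), and has w^0-term 0 by the d/dp_1 rule; [vanish_Dt] applies. *)
Lemma step_B : Bop (jackF n.+1 la) = \sum_(i < N) (al * coe la i) *: Phi_rem n.+1 la i.
Proof.
apply/eqP; rewrite -subr_eq0; apply/eqP; apply: (@vanish_Dt (eig la)).
- move=> k; rewrite -scaleN1r.
  change (swap_inv (Bop (jackF n.+1 la) k + (-1) *: (\sum_(i < N) (al * coe la i) *: Phi_rem n.+1 la i) k)).
  apply: swap_invD; first by apply: swap_invZ; apply: swap_inv_d; exact: step_symJ.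
  apply: swap_invZ; rewrite sumfE; apply: swap_inv_sum => i.
  change (swap_inv ((al * coe la i) *: Phi_rem n.+1 la i k)).
  case: (boolP (removable la i)) => [hi|hi]; first by apply: swap_invZ; apply: Phi_rem_sym.
  by rewrite (coe_not_removable al hp _ hi) // mulr0 scale0r.
- change ((al * 1) *: dpow 0 (jackF n.+1 la) - (\sum_(i < N) (al * coe la i) *: Phi_rem n.+1 la i) 0%N = 0).
  rewrite mulr1 step_dJ sumfE scaler_sumr -sumrB big1 // => i _.
  change (al *: (coe la i *: jackF n (rbox la i)) - (al * coe la i) *: Phi_rem n.+1 la i 0%N = 0).
  rewrite -scalerA -scalerBr.
  have -> : coe la i *: Phi_rem n.+1 la i 0%N = coe la i *: jackF n (rbox la i).
    by apply: coeP => // hi; rewrite /Phi_rem Phi_at0 //; [exact: young_rem|exact: szr].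
  by rewrite subrr scaler0.
- exact: step_dB.
- rewrite -scaleN1r (lin_add _ _ (@Dtilde_linear F al)) (lin_scale _ _ (@Dtilde_linear F al)).
  rewrite -(B_D al F2) ?step_DJ; last exact: step_symJ.
  rewrite (lin_scale _ _ (@Bop_linear F al)) [RHS]scalerDr; congr (_ + _).
  rewrite (lin_comb _ _ (@Dtilde_linear F al)) scalerA mulrC -scalerA; congr (_ *: _).
  rewrite scaler_sumr; apply: eq_bigr => i _.
  have -> : (al * coe la i) *: Dtilde (Phi_rem n.+1 la i) = (al * coe la i) *: (eig la *: Phi_rem n.+1 la i).
    rewrite -[LHS]scalerA -[RHS]scalerA; congr (_ *: _); apply: coeP => // hi.
    exact: Phi_rem_Dtilde.
  by rewrite [LHS]scalerA [RHS]scalerA [in RHS]mulrC.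
Qed.

Lemma step_symPhi u k : swap_inv (Phi n.+1 la u k).
Proof.
rewrite PhiE //.
change (swap_inv (vac (jackF n.+1 la) k + (\sum_(i < N) (al * coe la i / (u - crow la i + 1 - al)) *: Wop (Phi_rem n.+1 la i)) k)).
apply: swap_invD; first by case: k => [|k]; [exact: step_symJ|exact: swap_inv0].
rewrite sumfE; apply: swap_inv_sum => i.
case: (boolP (removable la i)) => [hi|hi].
  by apply: swap_invZ; case: k => [|k]; [exact: swap_inv0|exact: Phi_rem_sym].
by rewrite (coe_not_removable al hp _ hi) // mulr0 mul0r scale0r.
Qed.

Lemma step_Dh u : Dhat (Phi n.+1 la u) = eig la *: Phi n.+1 la u.
Proof.
rewrite PhiE // (lin_add _ _ (@Dhat_linear F al)) Dh_vac step_DJ (lin_scale _ _ (@vac_linear F)).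
rewrite [RHS]scalerDr; congr (_ + _); rewrite (lin_comb _ _ (@Dhat_linear F al)) scaler_sumr.
apply: eq_bigr => i _.
case: (boolP (removable la i)) => [hi|hi]; last by rewrite (coe_not_removable al hp _ hi) // mulr0 mul0r !scale0r scaler0.
rewrite (Dh_W al F2) Phi_rem_Dtilde // (lin_scale _ _ (@Wop_linear F)) [LHS]scalerA [RHS]scalerA.
by rewrite [in RHS]mulrC.
Qed.

Lemma addable_neq m i : addable la m ->
  (i < N)%N -> (zrow la m - crow la i != 0) && (zrow la m - crow la i + 1 - al != 0).
Proof.
move=> hm hi; have := addable_zrow_neq Hal hp hm (Ordinal hi); have := zrow_add_al_neq Hal la m i; rewrite /crow /=.
set x := zrow la m; set y := zrow la i => h1 h2.
have -> : x - (y - al) + 1 - al = x - y + 1 by ring.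
by rewrite h2 andbT (_ : x - (y - al) = x - y + al) //; ring.
Qed.

Lemma addable_neq_gap m i k : addable la m -> removable la i -> removable (rbox la i) k ->
  zrow la m - crow (rbox la i) k + 1 - al != 0.
Proof.
move=> hm hi hk; have hkN : (k < N)%N by case/andP: hk.
case: (eqVneq k i) => [e|hki]; last first.
  by rewrite crow_rem_ne //; case/andP: (addable_neq hm hkN).
rewrite e (crow_rem_at al hi) /crow; apply/eqP => h.
have [] := @zrow_int_relation _ _ Hal la la m i 1 1.
  by apply: (etrans _ h); rewrite mulr1; ring.
move=> h1 h2; have e' : m = i.+1 by lia.
move: hk; rewrite e /removable rbox_at => /andP[_]; rewrite rbox_ne //; last by lia.
by move: h1; rewrite e'; lia.
Qed.

(** Let x_i = al a_i / (u - c_i + 1 - al). The w^0-terms agree since sum_i x_i = u, that is Q(u) =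
    0, which holds at u = z_m. The other terms agree since x_i (u - c_i + 1 - al) = al a_i, which
    explains the coefficients in [Phi]. *)
Lemma step_L m : addable la m -> Lop (Phi n.+1 la (zrow la m)) = zrow la m *: Phi n.+1 la (zrow la m).
Proof.
move=> hm; set u := zrow la m; rewrite PhiE //.
pose x (i : nat) := al * coe la i / (u - crow la i + 1 - al); rewrite -/x.
rewrite (lin_add _ _ (@Lop_linear F al)) L_vac (lin_comb _ _ (@Lop_linear F al)) step_B.
rewrite [RHS]scalerDr scaler_sumr (lin_comb _ _ (@Wop_linear F)).
have sx : \sum_(i < N) x i = u.
  rewrite /u -[RHS](sum_coe_addable Hal hp hm); apply: eq_bigr => i _; rewrite /x /crow; congr (_ / _).
  by rewrite /u; ring.
have -> : u *: vac (jackF n.+1 la) = \sum_(i < N) x i *: vac (jackF n.+1 la).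
  by rewrite -scaler_suml sx.
rewrite -!big_split /=; apply: eq_bigr => i _.
case: (boolP (removable la i)) => [hi|hi]; last first.
  by rewrite /x (coe_not_removable al hp _ hi) // mulr0 mul0r !scale0r scaler0 addr0.
have ok := IHr hi; have ha := addable_rem hp hi.
rewrite (L_W al F2).
have -> : Lop (Phi_rem n.+1 la i) = crow la i *: Phi_rem n.+1 la i.
  by rewrite /Phi_rem /= -(zrow_rem_at al hi) (jk_L ok ha).
rewrite -scalerDl (lin_scale _ _ (@Wop_linear F)) -[Uop (Phi_rem _ _ _)]/(X i) -(step_J hi).
rewrite [X in _ + X]scalerDr addrA [LHS]addrC; congr (_ + _).
rewrite [X in _ + X = _]scalerA -scalerDl [RHS]scalerA; congr (_ *: _).
have /andP[_ h2] := addable_neq hm (ltn_ord i).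
rewrite /x; field; exact: h2.
Qed.

(** Used with x = u - c_i and y the difference of the contents of two successively removed boxes, to
    match coefficients in [step_ddPhi]. *)
Lemma scal_id x y : x != 0 -> x + 1 - al != 0 -> y != 0 -> y + 1 - al != 0 -> x + y + 1 - al != 0 ->
  al / (x + 1 - al) * (al / ((y + 1 - al) * y)) + al * Bf y / (x + y + 1 - al) =
  al / ((x + 1 - al) * x) * (al / (y + 1 - al)) + Bf x * (al / (x + y + 1 - al)).
Proof. by move=> h1 h2 h3 h4 h5; rewrite /Bf; field; rewrite h1 h2 h3 h4 h5. Qed.

Lemma step_swap (x : nat -> F) :
  \sum_(i < N) \sum_(k < N) (wgt i k * x i) *: Wop (Phi n.-1 (rbox (rbox la i) k) (crow la i)) =
  \sum_(i < N) \sum_(k < N) (wgt i k * x k) *: Wop (Phi_rem n (rbox la i) k).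
Proof.
rewrite exchange_big /=; apply: eq_bigr => i _; apply: eq_bigr => k _.
rewrite rbox_comm /Phi_rem /wgt eq_sym.
case: eqVneq => [->|hk]; first by rewrite !mul0r !scale0r.
by rewrite crow_rem_ne // mulrAC; congr (_ *: _); ring.
Qed.

(** Both sides are expanded over pairs of removed boxes. On the left, [step_swap] turns the
    eigenvectors that carry the content of the first box into those that carry the content of the
    second; then [scal_id] compares the coefficients. *)
Lemma step_ddPhi m : addable la m -> dd 0 (Phi n.+1 la (zrow la m)) =
    \sum_(i < N) coe la i *:
      ((al / ((zrow la m - crow la i + 1 - al) * (zrow la m - crow la i))) *: Phi_rem n.+1 la i
       + Bf (zrow la m - crow la i) *: Phi n (rbox la i) (zrow la m)).
Proof.
move=> hm; have huA := addable_neq hm; have huB i k := @addable_neq_gap m i k hm.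
move: (zrow la m) huA huB => u huA huB; rewrite PhiE //.
rewrite (lin_add _ _ (@dd_linear F 0)) dd_vac step_dJ (lin_comb _ _ (@vac_linear F)).
rewrite (lin_comb _ _ (@dd_linear F 0)).
pose x (i : nat) := (u - crow la i + 1 - al)^-1.
have E (i : 'I_N) : (al * coe la i / (u - crow la i + 1 - al)) *: dd 0 (Wop (Phi_rem n.+1 la i)) =
  \sum_(k < N) (al * coe la i * x i * coe (rbox la i) k *
     (al / ((crow la i - crow (rbox la i) k + 1 - al) * (crow la i - crow (rbox la i) k)))) *: Wop (Phi_rem n (rbox la i) k)
  + \sum_(k < N) (wgt i k * x i) *: Wop (Phi n.-1 (rbox (rbox la i) k) (crow la i)).
  case: (boolP (removable la i)) => [hi|hi]; last first.
    rewrite (coe_not_removable al hp _ hi) // mulr0 !mul0r scale0r !big1 ?addr0 // => k _.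
      by rewrite /wgt (coe_not_removable al hp _ hi) // mulr0 mul0r if_same mul0r scale0r.
    by rewrite !mul0r scale0r.
  have ok := IHr hi; have ha := addable_rem hp hi.
  rewrite dd_W.
  have -> : dd 0 (Phi_rem n.+1 la i) = dd 0 (Phi n (rbox la i) (zrow (rbox la i) i)) by rewrite (zrow_rem_at al hi).
  rewrite (jk_d ok ha) (zrow_rem_at al hi) (lin_comb _ _ (@Wop_linear F)) scaler_sumr -big_split /=.
  apply: eq_bigr => k _.
  rewrite (lin_comb2 _ _ _ _ _ (@Wop_linear F)) [LHS]scalerDr [X in X + _ = _]scalerA [X in _ + X = _]scalerA.
  by rewrite wgtE // /x !mulrA; congr (_ *: _ + _ *: _); ring.
rewrite (eq_bigr _ (fun i _ => E i)) big_split /= step_swap -!big_split /=.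
apply: eq_bigr => i _ {E}.
case: (boolP (removable la i)) => [hi|hi]; last first.
  rewrite (coe_not_removable al hp _ hi) // !scale0r !big1 ?addr0 // => k _.
    by rewrite /wgt (coe_not_removable al hp _ hi) // mulr0 mul0r if_same mul0r scale0r.
  by rewrite mulr0 !mul0r scale0r.
have hpi := young_rem hp hi; have szi := szr hi.
rewrite {3}/Phi_rem /= (PhiE (crow la i) hpi szi) (PhiE u hpi szi).
have /andP[n1 n2] := huA i (ltn_ord i).
set xi := u - crow la i in n1 n2 *.
rewrite -[al / _ in RHS](addrK (Bf xi)) Bf_sum //.
have R0 (V : lmodType F) (a b w : F) (v S1 S2 : V) :
   w *: ((1 - b) *: (v + S1) + b *: (v + S2)) = w *: v + ((w * (1 - b)) *: S1 + (w * b) *: S2).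
  rewrite !scalerDr !scalerA addrACA -scalerDl; congr (_ *: _ + _); ring.
rewrite R0 //; congr (_ + _).
rewrite !scaler_sumr -!big_split /=; apply: eq_bigr => k _.
rewrite !scalerA -!scalerDl; congr (_ *: _).
case: (boolP (removable (rbox la i) k)) => [hk|hk]; last first.
  rewrite wgtE // (coe_not_removable al hpi _ hk) //; ring.
have /andP[n3 n4] := crow_gaps_neq0 Hal hp hi k.
set y := crow la i - crow (rbox la i) k in n3 n4 *.
have n5 : xi + y + 1 - al != 0.
  by have := huB i k hi hk; rewrite (_ : xi + y = u - crow (rbox la i) k) // /xi /y; ring.
have -> : wgt i k * x k = al * coe la i * coe (rbox la i) k * Bf y / (xi + y + 1 - al).
  rewrite wgtE // -/y /x; case: (eqVneq (k : nat) i) => [e|hki].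
    by rewrite {1 2}/y e (crow_rem_at al hi) subKr Bf_al !mulr0 !mul0r.
  by congr (_ / (_ + _ - _)); rewrite /xi /y crow_rem_ne //; ring.
have := scal_id n1 n2 n3 n4 n5 => /(congr1 (fun t => coe la i * coe (rbox la i) k * t)).
rewrite -[al / (_ * xi)](addrK (Bf xi)) Bf_sum // => Es.
have -> : u - crow (rbox la i) k + 1 - al = xi + y + 1 - al by rewrite /xi /y; ring.
rewrite /x -/xi => {huA huB n1 n2 n3 n4 n5}.
set b1 := Bf xi in Es *; set b2 := Bf y in Es *; set u1 := coe la i in Es *; set u2 := coe _ k in Es *.
have -> : u1 * (1 - b1) * (al * u2 / (y + 1 - al)) + u1 * b1 * (al * u2 / (xi + y + 1 - al)) =
  u1 * u2 * ((1 - b1) * (al / (y + 1 - al)) + b1 * (al / (xi + y + 1 - al))) by ring.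
by rewrite -Es; ring.
Qed.

Lemma step_ok : jack_ok n.+1 la.
Proof.
split.
- exact: step_symPhi.
- exact: step_DJ.
- exact: step_B.
- exact: step_J.
- exact: step_Dh.
- exact: step_L.
- exact: step_ddPhi.
Qed.

End Step.

Lemma jack_okP n la : young la -> ysize la = n -> jack_ok n la.
Proof.
elim: n la => [|n IH] la hp hn; first exact: jack_ok0.
exact: step_ok.
Qed.

Lemma jack_d0 n la : young la -> ysize la = n.+1 ->
  dpow 0 (jackF n.+1 la) = \sum_(i < N) coe la i *: jackF n (rbox la i).
Proof. by move=> hp hn; apply: step_dJ => // mu hmu; apply: jack_okP. Qed.

(** C_0 = [d_1, D], and the eigenvalues of D at la and la - e_i differ by the content c_i. *)
Lemma jack_C0 n la : young la -> ysize la = n.+1 ->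
  Cop 0 (jackF n.+1 la) = \sum_(i < N) (coe la i * crow la i) *: jackF n (rbox la i).
Proof.
move=> hp hn; rewrite C0_D (jk_D (jack_okP hp hn)) (lin_scale _ _ (@dpow_linear F 0)) jack_d0 //.
rewrite (lin_comb _ _ (@Dop_linear F al)) scaler_sumr -sumrB; apply: eq_bigr => i _.
rewrite -[RHS]scalerA [LHS](_ : _ = coe la i *: (eig la *: jackF n (rbox la i) - Dop (jackF n (rbox la i)))); last first.
  by rewrite [RHS]scalerBr; congr (_ - _); rewrite [LHS]scalerA [RHS]scalerA mulrC.
apply: coeP => // hi.
have hs : ysize (rbox la i) = n by move: hn; rewrite (ysize_rem hi) => -[].
rewrite (jk_D (jack_okP (young_rem hp hi) hs)) -scalerBl (eig_rem hi).
by rewrite addrC addKr.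
Qed.

End Jack.

(** * The alpha-inner product *)

Section Partitions.
Implicit Types (r : seq nat) (n : nat).

Lemma parts_auxS f m n : (0 < n)%N -> parts_aux f.+1 m n =
  [seq i :: p | i <- iota 1 (minn m n), p <- parts_aux f i (n - i)].
Proof. by case: n. Qed.

Lemma mem_parts_aux f m n r : (n <= f)%N ->
  (r \in parts_aux f m n) = [&& sorted geq r, 0%N \notin r, all (leq^~ m) r & sumn r == n].
Proof.
elim: f m n r => [|f IH] m n r.
  rewrite leqn0 => /eqP->; rewrite /= inE.
  by case: r => [|x r] //=; case: x => [|x]; rewrite ?inE //= ?andbF // addSn andbF.
case: (posnP n) => [->|n0] hn.
  by rewrite /= inE; case: r => [|x r] //=; case: x => [|x]; rewrite ?inE //= ?andbF // addSn andbF.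
rewrite parts_auxS //; apply/allpairsPdep/idP => [[i [p [hi hp ->]]]|].
  move: hi; rewrite mem_iota add1n ltnS => /andP[i1 i2].
  have hni : (n - i <= f)%N by lia.
  move: hp; rewrite (IH _ _ _ hni) => /and4P[h1 h2 h3 /eqP h4].
  rewrite /= inE negb_or [0%N == _]eq_sym -lt0n i1 h2 h4 (path_sortedE (rev_trans leq_trans)) h1.
  rewrite andbT /=; apply/and3P; split.
  - by rewrite h3.
  - apply/andP; split; first by lia.
    by apply: sub_all h3 => x hx; lia.
  - by apply/eqP; lia.
case: r => [|i p]; first by move/and4P => [_ _ _ /eqP /= h]; move: n0; rewrite -h.
rewrite /= inE negb_or [0%N == _]eq_sym -lt0n (path_sortedE (rev_trans leq_trans)).
move=> /and4P[/andP[h1 h2] /andP[h3 h4] /andP[h5 h6] /eqP h7].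
exists i, p; split=> //; first by rewrite mem_iota; lia.
by rewrite IH ?h2 ?h4 /=; [apply/andP; split; [|apply/eqP; lia]|lia].
Qed.

Lemma mem_partitions n r : (r \in partitions n) = is_part r && (sumn r == n).
Proof.
rewrite /partitions mem_parts_aux // /is_part -andbA; congr (_ && (_ && _)).
apply: andb_idl => /eqP <-; apply/allP => x.
elim: r => [//|y r IH]; rewrite inE => /orP[/eqP->|/IH] /=; first exact: leq_addr.
by move/leq_trans; apply; apply: leq_addl.
Qed.

Lemma uniq_parts_aux f m n : uniq (parts_aux f m n).
Proof.
elim: f m n => [|f IH] m n; first by rewrite /=; case: (n == 0%N).
case: (posnP n) => [->//|n0]; rewrite parts_auxS //.
apply: allpairs_uniq_dep => [|i _|]; [exact: iota_uniq|exact: IH|].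
by move=> [i p] [j q] _ _ /= [-> ->].
Qed.

Lemma uniq_partitions n : uniq (partitions n).
Proof. exact: uniq_parts_aux. Qed.

Definition mult_fact r : nat := (\prod_(i <- undup r) (count_mem i r)`!)%N.

Lemma mult_fact_gt0 r : (0 < mult_fact r)%N.
Proof. by rewrite prodn_gt0 // => i; apply: fact_gt0. Qed.

Lemma mult_fact_rem r p : p \in r -> (mult_fact r = count_mem p r * mult_fact (seq.rem p r))%N.
Proof.
move=> hp; pose s := seq.rem p r.
have hc i : count_mem i r = ((p == i) + count_mem i s)%N.
  by rewrite (seq.permP (perm_to_rem hp)).
have sub : {subset s <= r} by apply: mem_rem.
have -> : mult_fact s = (\prod_(i <- undup r) (count_mem i s)`!)%N.
  rewrite (bigID (mem s)) /= [X in (_ * X)%N]big1 ?muln1 => [|i hi]; last first.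
    by rewrite (count_memPn hi).
  rewrite -big_filter /mult_fact; apply: perm_big; apply: uniq_perm; rewrite ?filter_uniq ?undup_uniq //.
  move=> i; rewrite mem_filter !mem_undup /=.
  by case: (boolP (i \in s)) => //= /sub.
have hpu : p \in undup r by rewrite mem_undup.
rewrite /mult_fact (bigD1_seq p) ?undup_uniq //= [in RHS](bigD1_seq p) ?undup_uniq //=.
rewrite hc eqxx add1n factS -mulnA; congr (_ * (_ * _))%N.
by apply: eq_bigr => i /negbTE hi; rewrite hc eq_sym hi.
Qed.

Lemma geq_antisym : antisymmetric geq.
Proof. by move=> x y; rewrite andbC => /anti_leq. Qed.

Lemma rem_partitions n p : (0 < p <= n)%N ->
  perm_eq [seq seq.rem p r | r <- partitions n & p \in r] (partitions (n - p)).
Proof.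
move=> hp; have gtr := rev_trans leq_trans.
have srt r : sorted geq r -> sorted geq (seq.rem p r).
  by move=> h; apply: (subseq_sorted gtr (rem_subseq p r) h).
apply: uniq_perm; [|exact: uniq_partitions|].
  rewrite map_inj_in_uniq ?filter_uniq ?uniq_partitions // => r1 r2.
  rewrite !mem_filter !mem_partitions => /andP[m1 /andP[/andP[s1 _] _]] /andP[m2 /andP[/andP[s2 _] _]] e.
  apply: (sorted_eq gtr geq_antisym) => //.
  by rewrite (permPl (perm_to_rem m1)) e perm_sym perm_to_rem.
move=> r; apply/mapP/idP => [[r1]|].
  rewrite mem_filter !mem_partitions => /andP[m1 /andP[/andP[s1 n1] /eqP e1]] ->.
  rewrite /is_part srt //=; apply/andP; split; first by apply: contra n1; apply: mem_rem.
  have := perm_sumn (perm_to_rem m1); rewrite e1 /=; lia.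
rewrite mem_partitions => /andP[/andP[s1 n1] /eqP e1].
pose r2 := sort geq (p :: r).
have pr : perm_eq r2 (p :: r) by apply/permPl/perm_sort.
have m2 : p \in r2 by rewrite (perm_mem pr) inE eqxx.
have s2 : sorted geq r2 by apply: sort_sorted => x y; apply: leq_total.
exists r2.
  rewrite mem_filter m2 mem_partitions /is_part s2 (perm_mem pr) inE negb_or n1 (perm_sumn pr) /= e1.
  by lia.
apply: (sorted_eq gtr geq_antisym) => //; first exact: srt.
by rewrite -(perm_cons p) perm_sym -(permPl (perm_to_rem m2)).
Qed.

Lemma sum_count_parts n r : all (fun x => 0 < x <= n)%N r ->
  (\sum_(k < n) k.+1 * count_mem k.+1 r)%N = sumn r.
Proof.
elim: r => [|x r IH] /=; first by rewrite big1 // => k _; rewrite muln0.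
move=> /andP[/andP[x0 xn] /IH <-].
under eq_bigr => k _ do rewrite mulnDr.
rewrite big_split /=; congr (_ + _)%N.
have hx : (x.-1 < n)%N by lia.
rewrite (bigD1 (Ordinal hx)) //= prednK // eqxx muln1 big1 ?addn0 // => k.
rewrite -val_eqE /= => hk; rewrite (_ : x == k.+1 = false) ?muln0 //.
by apply/negbTE; lia.
Qed.

Variable F : fieldType.
Hypothesis Fc : forall n, n.+1%:R != 0 :> F.
Implicit Types G : seq nat -> F.

Lemma Fcn n : (0 < n)%N -> n%:R != 0 :> F. Proof. by case: n => // n _; apply: Fc. Qed.

Definition sum_parts n G : F := \sum_(r <- partitions n) G r / (mult_fact r)%:R.

(** Each partition is weighted by its size sum_k k m_k; deleting a part k turns m_k / prod_i m_i!
    into the reciprocal factorials of the smaller partition. This plays the role of Euler's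
    identity. *)
Lemma sum_parts_rec n G : swap_inv G ->
  n%:R * sum_parts n G = \sum_(k < n) k.+1%:R * sum_parts (n - k.+1) (fun r => G (k.+1 :: r)).
Proof.
move=> hG; symmetry.
transitivity (\sum_(k < n) \sum_(r <- partitions n)
    (k.+1 * count_mem k.+1 r)%:R * (G r / (mult_fact r)%:R)).
  apply: eq_bigr => k _; have hk := ltn_ord k.
  rewrite /sum_parts -(perm_big _ (@rem_partitions n k.+1 _)) //= big_map big_filter.
  rewrite mulr_sumr [RHS](bigID (fun r => k.+1 \in r)) /= [X in _ = _ + X]big1 ?addr0 => [|r hr]; last first.
    by rewrite (count_memPn hr) muln0 mul0r.
  apply: eq_bigr => r hr; rewrite natrM -mulrA; congr (_ * _).
  have hc : (0 < count_mem k.+1 r)%N by rewrite -has_count has_pred1.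
  rewrite (mult_fact_rem hr) natrM -(swap_inv_perm hG (perm_to_rem hr)).
  by field; rewrite !Fcn // mult_fact_gt0.
rewrite exchange_big /= /sum_parts mulr_sumr; apply: eq_big_seq => r.
rewrite mem_partitions => /andP[/andP[_ h0] /eqP hs].
rewrite -mulr_suml -natr_sum; congr (_%:R * _).
rewrite -[RHS]hs; apply: sum_count_parts; apply/allP => x hx.
have x0 : x != 0%N by apply: contraNneq h0 => <-.
rewrite lt0n x0 /= -hs (perm_sumn (perm_to_rem hx)); exact: leq_addr.
Qed.

Lemma eq_sum_parts n G G' : (forall r, r \in partitions n -> G r = G' r) -> sum_parts n G = sum_parts n G'.
Proof. by move=> h; apply: eq_big_seq => r hr; rewrite h. Qed.

Lemma sum_parts0 G : sum_parts 0 G = G [::].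
Proof. by rewrite /sum_parts big_seq1 /mult_fact big_nil divr1. Qed.

Section Pairing.
Variable al : F.
Local Notation Lam := (seq nat -> F^o).
Implicit Types (f g h : Lam) (Ph Ps : nat -> Lam).

Definition alpha_wt r : F := \prod_(i <- r) (al * i%:R).
(** The alpha-inner product in Taylor coefficients: the coefficient of p_r in f is f(r - 1) / prod_i
    m_i!, parts being lowered because index j stands for p_(j+1), and z_r is the product of the
    parts times prod_i m_i!. *)
Definition jpair n f g : F := sum_parts n (fun r => alpha_wt r * f (map predn r) * g (map predn r)).

Lemma swap_inv_map f : swap_inv f -> swap_inv (fun r : seq nat => f (map predn r)).
Proof. by move=> hf l a b s; rewrite !map_cat /= hf. Qed.

Lemma swap_inv_alpha_wt : swap_inv alpha_wt.
Proof. by move=> l a b s; rewrite /alpha_wt !big_cat !big_cons /=; ring. Qed.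

Lemma pair_rec n f g : swap_inv f -> swap_inv g ->
  n%:R * jpair n f g = \sum_(k < n) k.+1%:R * (al * k.+1%:R) * jpair (n - k.+1) (dpow k f) (dpow k g).
Proof.
move=> hf hg; rewrite /jpair sum_parts_rec; last first.
  by move=> l a b s; rewrite swap_inv_alpha_wt (swap_inv_map hf) (swap_inv_map hg).
apply: eq_bigr => k _; rewrite -mulrA; congr (_ * _).
rewrite /sum_parts mulr_sumr; apply: eq_bigr => r _ /=.
by rewrite /alpha_wt big_cons /dpow !mulrA.
Qed.

Lemma pair0 f g : jpair 0 f g = f [::] * g [::].
Proof. by rewrite /jpair sum_parts0 /alpha_wt big_nil mul1r. Qed.

Lemma pair_comm n f g : jpair n f g = jpair n g f.
Proof. by apply: eq_sum_parts => r _; rewrite mulrAC. Qed.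

Lemma pair_linr n f : linear (jpair n f : Lam -> F^o).
Proof.
move=> a g h; rewrite /jpair /sum_parts scaler_sumr -big_split; apply: eq_bigr => r _ /=.
change (alpha_wt r * f (map predn r) * (a * g (map predn r) + h (map predn r)) / (mult_fact r)%:R =
 a * (alpha_wt r * f (map predn r) * g (map predn r) / (mult_fact r)%:R) + alpha_wt r * f (map predn r) * h (map predn r) / (mult_fact r)%:R).
ring.
Qed.

(** Multiplication by p_k is adjoint to al k d_k. After multiplication by n = (k + 1) + (n - k - 1),
    [pair_rec] and the Leibniz rule supply the first summand, and the induction hypothesis the
    second. *)
Lemma pair_U n f Ph : swap_inv f -> (forall k, swap_inv (Ph k)) ->
  jpair n f (Uop Ph) = \sum_(k < n) (al * k.+1%:R) * jpair (n - k.+1) (dpow k f) (Ph k).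
Proof.
have [m] := ubnP n; elim: m n f Ph => [//|m IH] n f Ph hm hf hP.
case: (posnP n) => [->|n0]; first by rewrite pair0 mulr0 big_ord0.
have hs := swap_inv_U hP.
apply: (mulfI (Fcn n0)); rewrite pair_rec //.
under eq_bigr => k _ do rewrite dU (lin_add _ _ (pair_linr _ _)) mulrDr.
rewrite big_split /=.
have E1 : \sum_(k < n) k.+1%:R * (al * k.+1%:R) * jpair (n - k.+1) (dpow k f) (Uop (dd k Ph)) =
  \sum_(k < n) \sum_(i < n) (if (k + i.+2 <= n)%N then
     k.+1%:R * (al * k.+1%:R) * (al * i.+1%:R) * jpair (n - (k + i.+2)) (dpow i (dpow k f)) (dpow k (Ph i)) else 0).
  apply: eq_bigr => k _; have hk := ltn_ord k.
  rewrite IH; [|lia|exact: swap_inv_d|by move=> i; apply: swap_inv_d].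
  rewrite mulr_sumr (big_ord_widen_cond n xpredT (fun i => k.+1%:R * (al * k.+1%:R) * ((al * i.+1%:R) * jpair (n - k.+1 - i.+1) (dpow i (dpow k f)) (dd k Ph i)))); last by lia.
  rewrite [LHS]big_mkcond /=; apply: eq_bigr => i _.
  have -> : (i < n - k.+1)%N = (k + i.+2 <= n)%N by lia.
  by case: ifP => // _; rewrite !mulrA; congr (_ * jpair _ _ _); lia.
have E2 : \sum_(i < n) (n - i.+1)%:R * ((al * i.+1%:R) * jpair (n - i.+1) (dpow i f) (Ph i)) =
  \sum_(i < n) \sum_(k < n) (if (k + i.+2 <= n)%N then
     k.+1%:R * (al * k.+1%:R) * (al * i.+1%:R) * jpair (n - (k + i.+2)) (dpow i (dpow k f)) (dpow k (Ph i)) else 0).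
  apply: eq_bigr => i _; have hi := ltn_ord i.
  rewrite mulrCA pair_rec; [|exact: swap_inv_d|exact: hP].
  rewrite mulr_sumr (big_ord_widen_cond n xpredT (fun k => (al * i.+1%:R) * (k.+1%:R * (al * k.+1%:R) * jpair (n - i.+1 - k.+1) (dpow k (dpow i f)) (dpow k (Ph i))))); last by lia.
  rewrite [LHS]big_mkcond /=; apply: eq_bigr => k _.
  have -> : (k < n - i.+1)%N = (k + i.+2 <= n)%N by lia.
  case: ifP => // _; rewrite (dC i k hf).
  have -> : (n - i.+1 - k.+1 = n - (k + i.+2))%N by lia.
  ring.
rewrite E1 exchange_big /= -E2 -big_split mulr_sumr; apply: eq_bigr => k _ /=.
rewrite natrB; last exact: ltn_ord.
ring.
Qed.
End Pairing.
End Partitions.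

(** * Orthogonality of the Jack functions *)

Section Orth.
Variables (F : fieldType) (al : F).
Hypothesis Hal : forall m r : int, al * m%:~R + r%:~R = 0 -> m = 0 /\ r = 0.
Variable N : nat.
Local Notation Lam := (seq nat -> F^o).
Implicit Types (f g : Lam) (Ph Ps : nat -> Lam) (la mu nu : nat -> nat).
Local Notation Bop := (Bop al).
Local Notation zrow := (zrow al).
Local Notation crow := (crow al).
Local Notation coe := (coe al N).
Local Notation removable := (removable N).
Local Notation addable := (addable N).
Local Notation young := (young N).
Local Notation ysize := (ysize N).
Local Notation plen := (plen N).
Local Notation jackF := (jackF al N).
Local Notation Phi := (Phi al N).
Local Notation Phi_rem := (Phi_rem al N).
Local Notation jpair := (jpair al).

Let Fc n : n.+1%:R != 0 :> F. Proof. exact: natr_neq0 Hal n. Qed.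

(** The powers of w are orthonormal and w has degree 1. With this, U is adjoint to B up to a shift
    of the degree ([pair_UW]). *)
Definition lax_pair n Ph Ps : F := \sum_(k < n.+1) jpair (n - k) (Ph k) (Ps k).

Lemma lax_pair_comm n Ph Ps : lax_pair n Ph Ps = lax_pair n Ps Ph.
Proof. by apply: eq_bigr => k _; rewrite pair_comm. Qed.

Lemma lax_pair_linr n Ph : linear (lax_pair n Ph : (nat -> Lam) -> F^o).
Proof.
move=> a P Q; rewrite /lax_pair scaler_sumr -big_split; apply: eq_bigr => k _.
exact: pair_linr.
Qed.

Lemma lax_pair_sumr n Ph m (x : 'I_m -> F) (Q : 'I_m -> nat -> Lam) :
  lax_pair n Ph (\sum_i x i *: Q i) = \sum_i x i * lax_pair n Ph (Q i).
Proof. exact: (lin_comb x Q (lax_pair_linr n Ph)). Qed.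

Lemma lax_pair_addr n Ph P Q : lax_pair n Ph (P + Q) = lax_pair n Ph P + lax_pair n Ph Q.
Proof. exact: (lin_add P Q (lax_pair_linr n Ph)). Qed.

Lemma pair_f0 n f : jpair n f 0 = 0.
Proof. exact: (lin_zero (pair_linr al n f)). Qed.

Lemma lax_pair_WW n Ph Ps : lax_pair n.+1 (Wop Ph) (Wop Ps) = lax_pair n Ph Ps.
Proof. by rewrite /lax_pair big_ord_recl /= pair_f0 add0r. Qed.

Lemma lax_pair_vacW n f Ps : lax_pair n (vac f) (Wop Ps) = 0.
Proof.
rewrite /lax_pair big1 // => -[[|k] hk] _ /=; first exact: pair_f0.
by rewrite pair_comm pair_f0.
Qed.

Lemma lax_pair_vac n f g : lax_pair n (vac f) (vac g) = jpair n f g.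
Proof. by rewrite /lax_pair big_ord_recl /= subn0 big1 ?addr0 // => i _; rewrite pair_f0. Qed.

Lemma pair_UW n f Ph : swap_inv f -> (forall k, swap_inv (Ph k)) ->
  jpair n.+1 f (Uop Ph) = lax_pair n (Bop f) Ph.
Proof.
move=> hf hP; rewrite (pair_U Fc) //; apply: eq_bigr => k _.
rewrite subSS pair_comm [RHS]pair_comm; symmetry.
exact: (lin_scale (al * k.+1%:R) (dpow k f) (pair_linr al (n - k) (Ph k))).
Qed.

Lemma rbox_inj la mu i : removable la i -> removable mu i -> rbox la i = rbox mu i -> la = mu.
Proof.
move=> /andP[_ hi] /andP[_ hj] e; apply/funext => j; have := congr1 (fun v : nat -> nat => v j) e.
rewrite /rbox; case: eqVneq => [->|_] /=; lia.
Qed.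

Definition orth_ok n : Prop :=
  [/\ forall la mu, young la -> young mu -> ysize la = n -> ysize mu = n -> la <> mu ->
        jpair n (jackF n la) (jackF n mu) = 0,
      forall la, young la -> ysize la = n -> jpair n (jackF n la) (jackF n la) != 0,
      forall la mu s t, young la -> young mu -> ysize la = n -> ysize mu = n ->
        addable la s -> addable mu t -> la <> mu \/ s <> t ->
        lax_pair n (Phi n la (zrow la s)) (Phi n mu (zrow mu t)) = 0 &
      forall la s, young la -> ysize la = n -> addable la s ->
        lax_pair n (Phi n la (zrow la s)) (Phi n la (zrow la s)) != 0].

(** By [lagrange_two] the expression is the divided difference of Q at its zeros z_s and z_t: it
    vanishes for s <> t, and for s = t it is the derivative of Q at a simple zero. *)
Lemma norm_formula la s t (hs : addable la s) (ht : addable la t) : young la ->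
  (s <> t -> 1 + \sum_(i < N) al * coe la i / ((zrow la s - zrow la i + 1) * (zrow la t - zrow la i + 1)) = 0)
  /\ (s = t -> 1 + \sum_(i < N) al * coe la i / ((zrow la s - zrow la i + 1) * (zrow la t - zrow la i + 1)) != 0).
Proof.
move=> hp; have hsN : (s < N)%N by case/andP: hs.
have htN : (t < N)%N by case/andP: ht.
have := @lagrange_two F N (fun j : 'I_N => zrow la j) (Ordinal htN) (zrow la s) (@zrow_inj_ord _ _ Hal N la)
  (addable_zrow_neq Hal hp ht) (addable_zrow_neq Hal hp hs).
rewrite /=.
have -> : \sum_(i < N) resid (fun j : 'I_N => zrow la j) i / ((zrow la s - zrow la i + 1) * (zrow la t - zrow la i + 1)) =
   \sum_(i < N) al * coe la i / ((zrow la s - zrow la i + 1) * (zrow la t - zrow la i + 1)).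
  by apply: eq_bigr => i _; rewrite coeE mulrA divff ?mul1r ?al_neq0.
move=> ->; split=> [hst|est].
  rewrite (bigD1 (Ordinal hsN)) //=; last by apply/eqP => -[].
  by rewrite subrr !mul0r mulr0.
rewrite mulf_neq0 //.
  rewrite mulf_neq0 ?invr_eq0 //; last exact: (addable_zrow_neq Hal hp hs (Ordinal htN)).
  apply/eqP => h; case: (@Hal (la s)%:Z (N%:Z - s%:Z)); last by lia.
  by rewrite -[RHS]h /zrow !rmorphB /= !pmulrn; ring.
apply/prodf_neq0 => j; rewrite -val_eqE /= => hj; rewrite mulf_neq0 ?invr_eq0 //.
  by rewrite est; apply: zrow_neq => //; rewrite eq_sym.
exact: (addable_zrow_neq Hal hp hs j).
Qed.

(** As J_mu is U of an eigenvector and U is adjoint to B, [jk_B] reduces the pairing of J_la and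
    J_mu to eigenvectors of size n. Conversely [PhiE] reduces pairings of eigenvectors of size n + 1
    to that pairing and to size n; for equal diagrams the outcome is [norm_formula]. *)
Lemma jack_orthogonality n : orth_ok n.
Proof.
elim: n => [|n [O1 O1n O2 O2n]].
  have J0 la : jackF 0 la = one F by [].
  have h1 : jpair 0 (one F) (one F) != 0 by rewrite pair0 /= mulr1 oner_eq0.
  have eq0 la : young la -> ysize la = 0%N -> la = fun=> 0%N.
    by move=> hp h0; apply/funext => i; apply: ysize0_at h0.
  have W0 : lax_pair 0 (vac (one F)) (vac (one F)) != 0 by rewrite lax_pair_vac.
  split.
  - by move=> la mu h1' h2 /(eq0 _ h1') -> /(eq0 _ h2) ->.
  - by move=> la _ _; rewrite J0.
  - move=> la mu s t h1' h2 /(eq0 _ h1') -> /(eq0 _ h2) ->.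
    by rewrite /addable ltnn !orbF => /andP[_ /eqP->] /andP[_ /eqP->] [].
  - by move=> la s hp h0 _ /=.
have key la mu t : young la -> young mu -> ysize la = n.+1 -> ysize mu = n.+1 -> removable mu t ->
    jpair n.+1 (jackF n.+1 la) (jackF n.+1 mu) =
    \sum_(i < N) al * coe la i * lax_pair n (Phi_rem n.+1 la i) (Phi_rem n.+1 mu t).
  move=> hp hq hn hm ht.
  rewrite (jk_U (jack_okP Hal hq hm) ht) pair_UW; first last.
  - by move=> k; apply: (jk_sym (jack_okP Hal (young_rem hq ht) _)); move: hm; rewrite (ysize_rem ht) => -[].
  - by rewrite -(Phi_at0 al 0 hp hn); apply: (jk_sym (jack_okP Hal hp hn)).
  rewrite (jk_B (jack_okP Hal hp hn)) lax_pair_comm lax_pair_sumr.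
  by apply: eq_bigr => i _; rewrite lax_pair_comm.
have sz la i : ysize la = n.+1 -> removable la i -> ysize (rbox la i) = n.
  by move=> h hi; move: h; rewrite (ysize_rem hi) => -[].
have PW la mu i k : young la -> young mu -> ysize la = n.+1 -> ysize mu = n.+1 -> removable la i -> removable mu k ->
    la <> mu \/ i <> k -> lax_pair n (Phi_rem n.+1 la i) (Phi_rem n.+1 mu k) = 0.
  move=> hp hq hn hm hi hk hne; rewrite /Phi_rem /= -(zrow_rem_at al hi) -(zrow_rem_at al hk).
  apply: O2; try by [exact: young_rem|exact: sz|exact: addable_rem].
  case: (eqVneq i k) hne hk => [<- [hne|//] hk|/eqP hne _ _]; last by right.
  by left => e; apply: hne; apply: rbox_inj e.
have norm la i : young la -> ysize la = n.+1 -> removable la i ->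
    jpair n.+1 (jackF n.+1 la) (jackF n.+1 la) = al * coe la i * lax_pair n (Phi_rem n.+1 la i) (Phi_rem n.+1 la i).
  move=> hp hn hi; have hiN : (i < N)%N by case/andP: hi.
  rewrite (key la la i) // (bigD1 (Ordinal hiN)) //= big1 ?addr0 // => k hk.
  case: (boolP (removable la k)) => [hrk|hrk]; last by rewrite (coe_not_removable al hp _ hrk) // mulr0 mul0r.
  by rewrite PW ?mulr0 //; right => e; move: hk; rewrite -val_eqE /= e eqxx.
have O1' la mu : young la -> young mu -> ysize la = n.+1 -> ysize mu = n.+1 -> la <> mu ->
        jpair n.+1 (jackF n.+1 la) (jackF n.+1 mu) = 0.
  move=> hp hq hn hm hne; have ht : removable mu (plen mu).-1 by apply: removable_last; rewrite // hm.
  rewrite (key _ _ _ hp hq hn hm ht) big1 // => i _.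
  case: (boolP (removable la i)) => [hi|hi]; last by rewrite (coe_not_removable al hp _ hi) // mulr0 mul0r.
  by rewrite PW ?mulr0 //; left.
have O1n' la : young la -> ysize la = n.+1 -> jpair n.+1 (jackF n.+1 la) (jackF n.+1 la) != 0.
  move=> hp hn; have ht : removable la (plen la).-1 by apply: removable_last; rewrite // hn.
  rewrite (norm _ _ hp hn ht) mulf_neq0 //; first by rewrite mulf_neq0 ?(al_neq0 Hal) ?(coe_neq0 Hal).
  rewrite /Phi_rem /= -(zrow_rem_at al ht); apply: O2n; [exact: young_rem|exact: sz|exact: addable_rem].
have expand la mu u v : young la -> young mu -> ysize la = n.+1 -> ysize mu = n.+1 ->
    lax_pair n.+1 (Phi n.+1 la u) (Phi n.+1 mu v) = jpair n.+1 (jackF n.+1 la) (jackF n.+1 mu)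
      + \sum_(i < N) \sum_(k < N) (al * coe la i / (u - crow la i + 1 - al)) *
          ((al * coe mu k / (v - crow mu k + 1 - al)) * lax_pair n (Phi_rem n.+1 la i) (Phi_rem n.+1 mu k)).
  move=> hp hq hn hm; rewrite (PhiE al u hp hn) (PhiE al v hq hm) lax_pair_addr lax_pair_sumr.
  rewrite lax_pair_comm lax_pair_addr lax_pair_vac pair_comm lax_pair_sumr big1 ?addr0 => [|i _]; last first.
    by rewrite lax_pair_vacW mulr0.
  congr (_ + _).
  rewrite exchange_big /=; apply: eq_bigr => k _.
  rewrite lax_pair_comm lax_pair_addr [lax_pair _ _ (vac _)]lax_pair_comm lax_pair_vacW add0r lax_pair_sumr mulr_sumr.
  apply: eq_bigr => i _; rewrite lax_pair_WW mulrCA; congr (_ * (_ * _)).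
  exact: lax_pair_comm.
have same la s t : young la -> ysize la = n.+1 -> addable la s -> addable la t ->
    lax_pair n.+1 (Phi n.+1 la (zrow la s)) (Phi n.+1 la (zrow la t)) = jpair n.+1 (jackF n.+1 la) (jackF n.+1 la) *
    (1 + \sum_(i < N) al * coe la i / ((zrow la s - zrow la i + 1) * (zrow la t - zrow la i + 1))).
  move=> hp hn hs ht; rewrite expand // mulrDr mulr1; congr (_ + _); rewrite mulr_sumr.
  apply: eq_bigr => i _; rewrite (bigD1 i) //= big1 ?addr0 => [|k hk]; last first.
    case: (boolP (removable la i)) => [hi|hi]; last by rewrite (coe_not_removable al hp _ hi) // mulr0 mul0r mul0r.
    case: (boolP (removable la k)) => [hrk|hrk]; last by rewrite (coe_not_removable al hp _ hrk) // mulr0 !mul0r mulr0.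
    by rewrite PW ?mulr0 //; right => e; move: hk; rewrite -val_eqE /= e eqxx.
  case: (boolP (removable la i)) => [hi|hi]; last by rewrite (coe_not_removable al hp _ hi) // !(mulr0, mul0r).
  rewrite (norm _ _ hp hn hi).
  have := addable_zrow_neq Hal hp hs i; have := addable_zrow_neq Hal hp ht i; rewrite /crow.
  set x := zrow la s; set y := zrow la t; set w := zrow la i => h1 h2.
  have -> : x - (w - al) + 1 - al = x - w + 1 by ring.
  have -> : y - (w - al) + 1 - al = y - w + 1 by ring.
  by field; rewrite h1 h2.
split=> //.
  move=> la mu s t hp hq hn hm hs ht hne.
  case: (pselect (la = mu)) => [e|e].
    move: hne; subst mu => -[//|hst]; rewrite same //.
    by have [h _] := norm_formula hs ht hp; rewrite (h hst) mulr0.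
  rewrite expand // O1' // add0r big1 // => i _; rewrite big1 // => k _.
  case: (boolP (removable la i)) => [hi|hi]; last by rewrite (coe_not_removable al hp _ hi) // mulr0 mul0r mul0r.
  case: (boolP (removable mu k)) => [hrk|hrk]; last by rewrite (coe_not_removable al hq _ hrk) // mulr0 !mul0r mulr0.
  by rewrite PW ?mulr0 //; left.
move=> la s hp hn hs; rewrite same // mulf_neq0 ?O1n' //.
by have [_ h] := norm_formula hs hs hp; apply: h.
Qed.

End Orth.

(** * Monomial coefficients *)

Section Hops.
Variables (F : fieldType) (al : F).
Hypothesis Fc : forall n, n.+1%:R != 0 :> F.
Local Notation Lam := (seq nat -> F^o).
Implicit Types (f g : Lam) (Ph Ps : nat -> Lam).

(* The adjoint of multiplication by h_m, obtained from m h_m = sum_k p_k h_(m-k);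
   hence [mono_coef mu f] below is the coefficient of m_mu in f. *)
Fixpoint hperp_fuel p m f : Lam :=
  if m is m'.+1 then
    if p is p'.+1 then
      (m%:R)^-1 *: (\sum_(k < m) k.+1%:R *: dpow k (hperp_fuel p' (m - k.+1)%N f))
    else 0
  else f.
Definition hperp m f := hperp_fuel m m f.

Lemma Hf_fuel2 p q m f : (m <= p)%N -> (m <= q)%N -> hperp_fuel p m f = hperp_fuel q m f.
Proof.
elim: p q m => [|p IH] [|q] [|m] //= hp hq; congr (_ *: _); apply: eq_bigr => k _.
by rewrite (IH q) //; lia.
Qed.

Lemma hperp_rec m f : m%:R *: hperp m f = \sum_(k < m) k.+1%:R *: dpow k (hperp (m - k.+1) f).
Proof.
case: m => [|m]; first by rewrite scale0r big_ord0.
rewrite /hperp /= scalerA divff ?Fc // scale1r; apply: eq_bigr => k _.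
by rewrite (@Hf_fuel2 m (m.+1 - k.+1)) //; lia.
Qed.

Lemma natr_scale_inj m (x y : Lam) : (0 < m)%N -> m%:R *: x = m%:R *: y -> x = y.
Proof. by case: m => // m _; apply: scalerI; apply: Fc. Qed.

Lemma hperp_linear m : linear (hperp m).
Proof.
have [n] := ubnP m; elim: n m => [//|n IH] m hm a f g.
case: (posnP m) => [->//|m0]; apply: (natr_scale_inj m0).
rewrite hperp_rec [RHS]scalerDr [X in _ = X + _]scalerA [_ * a]mulrC -[X in _ = X + _]scalerA !hperp_rec.
rewrite scaler_sumr -big_split; apply: eq_bigr => k _ /=.
rewrite IH; last by lia.
by rewrite (dpow_linear k) scalerDr [X in X + _ = _]scalerA mulrC -[X in X + _ = _]scalerA.
Qed.

Lemma swap_inv_hperp m f : swap_inv f -> swap_inv (hperp m f).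
Proof.
move=> hf; have [n] := ubnP m; elim: n m => [//|n IH] m hm.
case: (posnP m) => [->//|m0].
have -> : hperp m f = m%:R^-1 *: (m%:R *: hperp m f).
  by rewrite scalerA mulVf ?scale1r // Fcn.
rewrite hperp_rec; apply: swap_invZ; apply: swap_inv_sum => k; apply: swap_invZ.
by apply: swap_inv_d; apply: IH; lia.
Qed.

Lemma dpow_hperp j m f : swap_inv f -> dpow j (hperp m f) = hperp m (dpow j f).
Proof.
move=> hf; have [n] := ubnP m; elim: n m => [//|n IH] m hm.
case: (posnP m) => [->//|m0]; apply: (natr_scale_inj m0).
rewrite -(lin_scale _ _ (@dpow_linear F j)) !hperp_rec (lin_comb _ _ (@dpow_linear F j)).
apply: eq_bigr => k _; rewrite dC; last exact: swap_inv_hperp.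
by rewrite IH //; lia.
Qed.

Lemma hperp_comm a b f : swap_inv f -> hperp a (hperp b f) = hperp b (hperp a f).
Proof.
move=> hf; have [n] := ubnP a; elim: n a => [//|n IH] m hm.
case: (posnP m) => [->//|m0]; apply: (natr_scale_inj m0).
rewrite -(lin_scale _ _ (hperp_linear b)) !hperp_rec (lin_comb _ _ (hperp_linear b)).
apply: eq_bigr => k _; rewrite IH; last by lia.
by rewrite dpow_hperp //; apply: swap_inv_hperp.
Qed.

Lemma hperp1 f : hperp 1 f = dpow 0 f.
Proof. by rewrite /hperp /= big_ord_recl big_ord0 addr0 /= invr1 !scale1r. Qed.

(** The commutator of the adjoint of h_m with p_(k+1) is the adjoint of h_(m-k-1). In the induction,
    [E1] and [E2] meet in one double sum over [G], summed in its two orders. *)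
Lemma hperp_Uop m Ph : (forall k, swap_inv (Ph k)) ->
  hperp m (Uop Ph) = Uop (fun k => hperp m (Ph k)) + \sum_(k < m) hperp (m - k.+1) (Ph k).
Proof.
have [n] := ubnP m; elim: n m Ph => [//|n IH] m Ph hm hP.
case: (posnP m) => [->|m0]; first by rewrite big_ord0 addr0.
apply: (natr_scale_inj m0); rewrite hperp_rec [RHS]scalerDr.
have -> : m%:R *: Uop (fun k => hperp m (Ph k)) =
    \sum_(k < m) k.+1%:R *: Uop (fun i => dpow k (hperp (m - k.+1) (Ph i))).
  rewrite -(lin_scale _ _ (@Uop_linear F)) -(lin_comb _ _ (@Uop_linear F)); congr Uop.
  apply/funext => i; rewrite sumfE -[LHS]/(m%:R *: hperp m (Ph i)) hperp_rec.
  by apply: eq_bigr.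
pose G (k i : nat) := if (k + i.+2 <= m)%N then k.+1%:R *: hperp (m - (k + i.+2)) (dpow k (Ph i)) else 0.
have E1 (k : 'I_m) : k.+1%:R *: dpow k (hperp (m - k.+1) (Uop Ph)) =
   k.+1%:R *: Uop (fun i => dpow k (hperp (m - k.+1) (Ph i))) +
   (k.+1%:R *: hperp (m - k.+1) (Ph k) + \sum_(i < m) G k i).
  have hk := ltn_ord k.
  rewrite dpow_hperp ?dU; last exact: swap_inv_U.
  rewrite (lin_add _ _ (hperp_linear _)) IH; [|lia|by move=> i; apply: swap_inv_d].
  rewrite !scalerDr addrCA; congr (_ + (_ + _)).
    by congr (_ *: Uop _); apply/funext => i; rewrite dpow_hperp.
  rewrite scaler_sumr (big_ord_widen_cond m xpredT (fun i => k.+1%:R *: hperp (m - k.+1 - i.+1) (dd k Ph i))); last by lia.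
  rewrite [LHS]big_mkcond /=; apply: eq_bigr => i _; rewrite /G.
  have -> : (i < m - k.+1)%N = (k + i.+2 <= m)%N by lia.
  by case: ifP => // _; rewrite (_ : (m - k.+1 - i.+1 = m - (k + i.+2))%N) //; lia.
have E2 (i : 'I_m) : (m - i.+1)%:R *: hperp (m - i.+1) (Ph i) = \sum_(k < m) G k i.
  have hi := ltn_ord i.
  rewrite hperp_rec (big_ord_widen_cond m xpredT (fun k => k.+1%:R *: dpow k (hperp (m - i.+1 - k.+1) (Ph i)))); last by lia.
  rewrite [LHS]big_mkcond /=; apply: eq_bigr => k _; rewrite /G.
  have -> : (k < m - i.+1)%N = (k + i.+2 <= m)%N by lia.
  by case: ifP => // _; rewrite dpow_hperp // (_ : (m - i.+1 - k.+1 = m - (k + i.+2))%N) //; lia.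
rewrite (eq_bigr _ (fun k _ => E1 k)) !big_split /=; congr (_ + _).
rewrite exchange_big /= -(eq_bigr _ (fun i _ => E2 i)) -big_split scaler_sumr.
apply: eq_bigr => k _ /=; rewrite -scalerDl -natrD subnKC //; exact: ltn_ord.
Qed.

Local Notation Cop := (Cop al).
(** As C_0 = sum_k (k + 2) p_(k+1) d_(k+2), its commutator with the adjoint of h_m gives all terms
    of [hperp_rec] for m + 1 except the one with d_1. So m is raised by means of C_0 and d_1, whose
    action on J_la is known. *)
Lemma hperp_Cop m f : swap_inv f ->
  m.+1%:R *: hperp m.+1 f = hperp m (Cop 0 f) - Cop 0 (hperp m f) + hperp m (dpow 0 f).
Proof.
move=> hf.
rewrite !C0E hperp_Uop; last by move=> k; apply: swap_invZ; apply: swap_inv_d.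
have -> : (fun k => hperp m (wt (fun k => k.+2) (Csh 0 f) k)) = wt (fun k => k.+2) (Csh 0 (hperp m f)).
  by apply/funext => k; rewrite /wt /Csh (lin_scale _ _ (hperp_linear m)) dpow_hperp.
rewrite [X in _ = X + _]addrAC subrr add0r hperp_rec big_ord_recl /= subn1 /= scale1r dpow_hperp // addrC.
congr (_ + _); apply: eq_bigr => k _.
by rewrite /wt /Csh (lin_scale _ _ (hperp_linear _)) dpow_hperp.
Qed.

Fixpoint mono_coef (mu : seq nat) f : F := if mu is m :: mu' then mono_coef mu' (hperp m f) else f [::].

Lemma mono_coef_linear mu : linear (mono_coef mu : Lam -> F^o).
Proof. by elim: mu => [//|m mu IH] a f g; rewrite /= (hperp_linear m) IH. Qed.

Lemma mono_coef_cat mu nu f : mono_coef (mu ++ nu) f = mono_coef nu (foldl (fun g m => hperp m g) f mu).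
Proof. by elim: mu f => [//|m mu IH] f /=. Qed.

Lemma mono_coef_swap f : swap_inv f -> swap_inv (fun mu => mono_coef mu f).
Proof.
move=> hf l a b s; rewrite !mono_coef_cat /= hperp_comm //.
by elim: l f hf => [//|m l IH] f hf /=; apply: IH; apply: swap_inv_hperp.
Qed.

Lemma mono_coef_perm f mu nu : swap_inv f -> perm_eq mu nu -> mono_coef mu f = mono_coef nu f.
Proof. by move=> hf; apply: (swap_inv_perm (mono_coef_swap hf)). Qed.

(** C_0 is commuted past the adjoints of the parts one after the other; each passage raises one part
    and contributes one d_1. *)
Lemma mono_coef_incr mu f : swap_inv f ->
  \sum_(j < size mu) (nth 0%N mu j).+1%:R * mono_coef (incr_nth mu j) f =
  mono_coef mu (Cop 0 f) + (size mu)%:R * mono_coef mu (dpow 0 f).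
Proof.
elim: mu f => [|m mu IH] f hf /=.
  by rewrite big_ord0 mul0r addr0 C0E.
rewrite big_ord_recl /= mulrC.
have -> : mono_coef mu (hperp m.+1 f) * m.+1%:R = mono_coef mu (hperp m (Cop 0 f)) - mono_coef mu (Cop 0 (hperp m f)) + mono_coef mu (hperp m (dpow 0 f)).
  have <- : mono_coef mu (m.+1%:R *: hperp m.+1 f) = mono_coef mu (hperp m.+1 f) * m.+1%:R.
    by rewrite (lin_scale _ _ (mono_coef_linear mu)) mulrC.
  rewrite hperp_Cop // (lin_add _ _ (mono_coef_linear mu)) (lin_add _ _ (mono_coef_linear mu)).
  by rewrite -scaleN1r (lin_scale _ _ (mono_coef_linear mu)) scaleN1r.
rewrite (IH (hperp m f)); last exact: swap_inv_hperp.
rewrite dpow_hperp // -natr1; ring.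
Qed.

(** In this form the recursion can be compared with [fibers_cons]: a variable p_(k+1) is absorbed by
    the part mu_j. *)
Lemma mono_coef_rec mu f : swap_inv f ->
  (sumn mu)%:R * mono_coef mu f = \sum_(j < size mu) \sum_(k < nth 0%N mu j)
    k.+1%:R * mono_coef (set_nth 0%N mu j (nth 0%N mu j - k.+1)%N) (dpow k f).
Proof.
elim: mu f => [|m mu IH] f hf /=; first by rewrite big_ord0 mul0r.
rewrite big_ord_recl /= natrD mulrDl; congr (_ + _).
  have <- : mono_coef mu (m%:R *: hperp m f) = m%:R * mono_coef mu (hperp m f).
    by rewrite (lin_scale _ _ (mono_coef_linear mu)).
  rewrite hperp_rec (lin_comb _ _ (mono_coef_linear mu)); apply: eq_bigr => k _.
  by rewrite dpow_hperp.
rewrite IH; last exact: swap_inv_hperp.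
by apply: eq_bigr => j _; apply: eq_bigr => k _; rewrite dpow_hperp.
Qed.

Lemma mono_coef_all0 mu f : sumn mu = 0%N -> mono_coef mu f = f [::].
Proof. by elim: mu f => [//|[|m] mu IH] f //= h; rewrite IH. Qed.

End Hops.

(** * From power sums to monomials *)

Section Rpm.

(** [Rpm] with the target as a function on m positions, so that parts can be subtracted from it and
    zero entries kept. *)
Definition fibers m (rho : seq nat) (nu : nat -> nat) : nat :=
  #|[pred f : {ffun 'I_(size rho) -> 'I_m} |
      [forall j : 'I_m, (\sum_(i | f i == j) nth 0%N rho i)%N == nu j]]|.

Lemma RpmE rho mu : Rpm rho mu = fibers (size mu) rho (nth 0%N mu).
Proof. by []. Qed.

Lemma fibers_nil m nu : fibers m [::] nu = [forall j : 'I_m, nu j == 0%N].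
Proof.
rewrite /fibers -sum1_card big_mkcond /=.
pose f0 : {ffun 'I_0 -> 'I_m} := [ffun i : 'I_0 => match i with Ordinal _ h => False_rect _ (Bool.diff_false_true h) end].
rewrite (bigD1 f0) //= big1 ?addn0 => [|f hf]; last first.
  by case/eqP: hf; apply/ffunP => -[].
rewrite inE; congr nat_of_bool; apply: eq_forallb => j.
by rewrite big_ord0 eq_sym.
Qed.

Lemma fibers_cons m p rho nu :
  fibers m (p :: rho) nu = (\sum_(j < m)
     (if p <= nu j then fibers m rho (fun i => nu i - (if i == j :> nat then p else 0)) else 0))%N.
Proof.
pose h (x : 'I_m * {ffun 'I_(size rho) -> 'I_m}) : {ffun 'I_(size rho).+1 -> 'I_m} :=
  [ffun i => if unlift ord0 i is Some i' then x.2 i' else x.1].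
pose h' (f : {ffun 'I_(size rho).+1 -> 'I_m}) : 'I_m * {ffun 'I_(size rho) -> 'I_m} :=
  (f ord0, [ffun i => f (lift ord0 i)]).
rewrite {1}/fibers -sum1_card (reindex h) /=; last first.
  apply: onW_bij; exists h'.
    move=> [j g]; rewrite /h /h' /=; congr (_, _); first by rewrite ffunE unlift_none.
    by apply/ffunP => i; rewrite !ffunE liftK.
  move=> f; apply/ffunP => i; rewrite /h /h' ffunE /=.
  by case: unliftP => [i'|] ->; rewrite ?ffunE.
rewrite big_mkcond /=.
rewrite (eq_bigr (fun x : 'I_m * {ffun 'I_(size rho) -> 'I_m} =>
  (fun j g => if h (j, g) \in [pred f : {ffun 'I_(size rho).+1 -> 'I_m} |
      [forall j : 'I_m, (\sum_(i | f i == j) nth 0%N (p :: rho) i)%N == nu j]] then 1%N else 0%N) x.1 x.2)); last by case.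
rewrite -(pair_bigA _ (fun j g => if h (j, g) \in [pred f : {ffun 'I_(size rho).+1 -> 'I_m} |
      [forall j : 'I_m, (\sum_(i | f i == j) nth 0%N (p :: rho) i)%N == nu j]] then 1%N else 0%N)) /=.
apply: eq_bigr => j _.
have E g i : (\sum_(k | h (j, g) k == i) nth 0 (p :: rho) k)%N =
   ((if i == j :> nat then p else 0) + \sum_(k | g k == i) nth 0 rho k)%N.
  rewrite big_mkcond big_ord_recl /= {1}/h ffunE unlift_none /= eq_sym -val_eqE /=.
  congr (_ + _)%N; rewrite [RHS]big_mkcond /=; apply: eq_bigr => k _.
  by rewrite /h ffunE liftK.
case: ifP => hp; last first.
  rewrite big1 // => g _; rewrite inE; case: ifP => // /forallP/(_ j).
  by rewrite E eqxx => /eqP e; rewrite -e leq_addr in hp.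
rewrite -big_mkcond /= /fibers -sum1_card; apply: eq_bigl => g; rewrite !inE.
apply: eq_forallb => i; rewrite E; case: (eqVneq (i : nat) j) => [e|_]; last by rewrite add0n subn0.
have : (p <= nu i)%N by rewrite e.
set s := (\sum_(k | _) _)%N; lia.
Qed.
End Rpm.

Section Link.

Lemma eq_fibers m rho nu nu' : (forall i, (i < m)%N -> nu i = nu' i) -> fibers m rho nu = fibers m rho nu'.
Proof.
move=> h; apply: eq_card => f; rewrite !inE; apply: eq_forallb => j.
by rewrite h.
Qed.

Lemma fibers_swap m nu : swap_inv (fun rho => fibers m rho nu).
Proof.
move=> l; elim: l nu => [|p l IH] nu a b s /=; last first.
  by rewrite !fibers_cons; apply: eq_bigr => j _; rewrite IH.
rewrite !fibers_cons.
under eq_bigr => j _ do rewrite fibers_cons.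
under [RHS]eq_bigr => j _ do rewrite fibers_cons.
have E x y : (\sum_(j < m) (if x <= nu j then \sum_(i < m)
     (if y <= nu i - (if i == j :> nat then x else 0) then
        fibers m s (fun k => nu k - (if k == j then x else 0) - (if k == i then y else 0)) else 0) else 0))%N
  = (\sum_(j < m) \sum_(i < m) (if (x <= nu j) && (y <= nu i - (if i == j :> nat then x else 0))
     then fibers m s (fun k => nu k - (if k == j then x else 0) - (if k == i then y else 0)) else 0))%N.
  apply: eq_bigr => j _; case: ifP => _ //=.
  by rewrite big1.
rewrite !E exchange_big; apply: eq_bigr => j _; apply: eq_bigr => i _.
have -> : ((a <= nu i) && (b <= nu j - (if j == i :> nat then a else 0)) =
          (b <= nu j) && (a <= nu i - (if i == j :> nat then b else 0)))%N.
  by rewrite [j == i :> nat]eq_sym; case: (eqVneq (i : nat) j) => [->|_]; lia.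
by case: ifP => // _; apply: eq_fibers => k _; rewrite subnAC.
Qed.

Variable F : fieldType.
Hypothesis Fc : forall n, n.+1%:R != 0 :> F.
Local Notation Lam := (seq nat -> F^o).
Implicit Types (f : Lam).

Lemma sumn_set_nth_sub mu j p : (j < size mu)%N -> (p <= nth 0 mu j)%N ->
  sumn (set_nth 0 mu j (nth 0 mu j - p))%N = (sumn mu - p)%N.
Proof.
elim: mu j => [//|x mu IH] [|j] /= hj hp; first by rewrite addnBAC.
rewrite IH // addnBA //; apply: leq_trans hp _.
elim: mu j hj {IH} => [//|y mu IH] [|j] /= hj; first exact: leq_addr.
by apply: leq_trans (leq_addl _ _); apply: IH.
Qed.

Lemma leq_nth_sumn mu j : (nth 0 mu j <= sumn mu)%N.
Proof.
elim: mu j => [|y mu IH] [|j] //=; first exact: leq_addr.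
by apply: leq_trans (leq_addl _ _).
Qed.

(** Both sides obey the same recursion in |mu|: a part k + 1 is deleted from the index of the power
    sum and subtracted from some mu_j. This identifies [mono_coef] with [mcoef]. *)
Lemma sum_parts_mono_coef mu f : swap_inv f ->
  sum_parts (sumn mu) (fun r => f (map predn r) * (Rpm r mu)%:R) = mono_coef mu f.
Proof.
move: {2}(sumn mu) (leqnn (sumn mu)) => n; elim: n mu f => [|n IH] mu f hn hf.
  have h0 : sumn mu = 0%N by lia.
  rewrite h0 sum_parts0 /= mono_coef_all0 // RpmE fibers_nil.
  suff -> : [forall j : 'I_(size mu), nth 0%N mu j == 0%N] by rewrite mulr1.
  by apply/forallP => j; have := leq_nth_sumn mu j; rewrite h0 leqn0.
case: (posnP (sumn mu)) => [h0|n0]; first by apply: IH; rewrite // h0.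
have hG : swap_inv (fun r => f (map predn r) * (Rpm r mu)%:R).
  by move=> l a b s; rewrite (swap_inv_map hf) RpmE (@fibers_swap (size mu)).
apply: (mulfI (Fcn Fc n0)); rewrite (sum_parts_rec Fc) // (mono_coef_rec Fc) //.
have E (j : 'I_(size mu)) : \sum_(k < nth 0%N mu j)
    k.+1%:R * mono_coef (set_nth 0%N mu j (nth 0%N mu j - k.+1)%N) (dpow k f) =
  \sum_(k < sumn mu) (if (k < nth 0%N mu j)%N then
    k.+1%:R * mono_coef (set_nth 0%N mu j (nth 0%N mu j - k.+1)%N) (dpow k f) else 0).
  by rewrite -big_mkcond (big_ord_widen_cond (sumn mu) xpredT (fun k => k.+1%:R * mono_coef (set_nth 0%N mu j (nth 0%N mu j - k.+1)%N) (dpow k f))) // leq_nth_sumn.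
rewrite (eq_bigr _ (fun j _ => E j)) exchange_big /=; apply: eq_bigr => k _.
transitivity (k.+1%:R * \sum_(j < size mu) (if (k < nth 0%N mu j)%N then
    mono_coef (set_nth 0%N mu j (nth 0%N mu j - k.+1)%N) (dpow k f) else 0)); last first.
  by rewrite mulr_sumr; apply: eq_bigr => j _; case: ifP; rewrite ?mulr0.
congr (_ * _).
transitivity (\sum_(j < size mu) (if (k < nth 0%N mu j)%N then
    sum_parts (sumn mu - k.+1) (fun r => dpow k f (map predn r) * (Rpm r (set_nth 0%N mu j (nth 0%N mu j - k.+1)%N))%:R) else 0)).
  transitivity (\sum_(r <- partitions (sumn mu - k.+1)) \sum_(j < size mu) (if (k < nth 0%N mu j)%N then
    dpow k f (map predn r) * (Rpm r (set_nth 0%N mu j (nth 0%N mu j - k.+1)%N))%:R / (mult_fact r)%:R else 0)); last first.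
    by rewrite exchange_big; apply: eq_bigr => j _; case: ifP => _ //; rewrite big1.
  apply: eq_bigr => r _.
  rewrite RpmE fibers_cons natr_sum mulr_sumr mulr_suml; apply: eq_bigr => j _.
  case: ifP => hk; last by rewrite mulr0 mul0r.
  congr (_ * _%:R / _); rewrite RpmE size_set_nth (maxn_idPr (ltn_ord j)); apply: eq_fibers => i hi.
  by rewrite nth_set_nth /=; case: eqP => [->|_]; rewrite ?subn0.
apply: eq_bigr => j _; case: ifP => // hk.
rewrite -(@sumn_set_nth_sub mu j k.+1) // IH //; last exact: swap_inv_d.
rewrite sumn_set_nth_sub //; lia.
Qed.

End Link.

(** * Triangularity and normalization *)

Section Tri.
Variables (F : fieldType) (al : F).
Hypothesis Hal : forall m r : int, al * m%:~R + r%:~R = 0 -> m = 0 /\ r = 0.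
Variable N : nat.
Local Notation Lam := (seq nat -> F^o).
Implicit Types (la : nat -> nat) (mu : seq nat).
Local Notation zrow := (zrow al).
Local Notation crow := (crow al).
Local Notation coe := (coe al N).
Local Notation removable := (removable N).
Local Notation young := (young N).
Local Notation ysize := (ysize N).
Local Notation plen := (plen N).
Local Notation jackF := (jackF al N).

Let Fc n : n.+1%:R != 0 :> F. Proof. exact: natr_neq0 Hal n. Qed.

(* mu is dominated by la iff sum_j (mu_j - t)^+ <= sum_j (la_j - t)^+ for all t. *)
Definition excess mu t := (\sum_(x <- mu) (x - t))%N.
Definition yexcess la t := (\sum_(i < N) (la i - t))%N.

Lemma yexcess_rem la i t : removable la i -> yexcess la t = (yexcess (rbox la i) t + (t < la i))%N.
Proof.
move=> /andP[hi hr]; rewrite /yexcess (bigD1 (Ordinal hi)) //= [in RHS](bigD1 (Ordinal hi)) //=.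
rewrite (eq_bigr (fun j : 'I_N => rbox la i j - t)%N) => [|j hj]; last by rewrite rbox_ne.
by rewrite rbox_at; case: (ltnP t (la i)); lia.
Qed.

Lemma sum_ltn p : (p <= N)%N -> (\sum_(i < N) (i < p))%N = p.
Proof.
move=> hp; rewrite -[RHS]card_ord -sum1_card (big_ord_widen N (fun _ => 1%N) hp) [RHS]big_mkcond.
by apply: eq_bigr => i _; case: ltnP.
Qed.

Lemma yexcess_plen la t : young la -> (ysize la <= yexcess la t + t * plen la)%N.
Proof.
move=> hp; rewrite -[X in (_ * X)%N](sum_ltn (plen_le N la)) big_distrr -big_split leq_sum // => i _ /=.
by rewrite -(plenP i hp); case: (la i) => [|x]; lia.
Qed.

Lemma yexcess1 la : young la -> ysize la = (yexcess la 1 + plen la)%N.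
Proof.
move=> hp; rewrite -[X in (_ + X)%N](sum_ltn (plen_le N la)) -big_split; apply: eq_bigr => i _ /=.
by rewrite -(plenP i hp); case: (la i) => [|x]; lia.
Qed.

Lemma sum_excess_ge mu t : all (leq t) mu -> sumn mu = (excess mu t + size mu * t)%N.
Proof.
rewrite /excess; elim: mu => [|x mu IH] /=; first by rewrite big_nil.
by move=> /andP[h /IH ->]; rewrite big_cons; lia.
Qed.

Lemma excess_perm mu nu t : perm_eq mu nu -> excess mu t = excess nu t.
Proof. by move=> h; apply: perm_big. Qed.

Lemma excess_cons x mu t : excess (x :: mu) t = (x - t + excess mu t)%N.
Proof. by rewrite /excess big_cons. Qed.

Lemma excess_incr mu j t : (j < size mu)%N ->
  excess (incr_nth mu j) t = (excess mu t + (t <= nth 0 mu j))%N.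
Proof.
elim: mu j => [//|x mu IH] [|j] hj /=; rewrite !excess_cons.
  by case: leqP; lia.
by rewrite IH // addnA.
Qed.

Lemma sumn_incr mu j : (j < size mu)%N -> sumn (incr_nth mu j) = (sumn mu).+1.
Proof. by elim: mu j => [//|x mu IH] [|j] hj //=; rewrite IH // addnS. Qed.

Lemma all_incr mu j v : all (leq v) mu -> (j < size mu)%N -> all (leq v) (incr_nth mu j).
Proof.
elim: mu j => [//|x mu IH] [|j] /= /andP[h1 h2] hj; first by rewrite h2 (leq_trans h1).
by rewrite h1 IH.
Qed.

Lemma size_incr mu j : (j < size mu)%N -> size (incr_nth mu j) = size mu.
Proof. by move=> h; rewrite size_incr_nth h. Qed.

Lemma min_head mu : mu != [::] ->
  exists v rest, perm_eq mu (v :: rest) /\ all (leq v) rest.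
Proof.
case: (sort leq mu) (sort_sorted leq_total mu) (perm_sort leq mu mu) (perm_sort leq mu) => [|v r] hs _ hp.
  by have := perm_size (permEl hp) => /esym/size0nil ->.
move=> _; exists v, r; split; first by rewrite perm_sym; apply: permEl hp.
by have := order_path_min leq_trans hs.
Qed.

Lemma jackF_sym n la : young la -> ysize la = n -> swap_inv (jackF n la).
Proof. by move=> hp hn; rewrite -(Phi_at0 al 0 hp hn); apply: (jk_sym (jack_okP Hal hp hn)). Qed.

(** In the factor c_i + size mu, the content comes from C_0 and the number of parts from d_1. It
    vanishes for a row of length 1 with index size mu. *)
Lemma mono_coef_jackF_incr n la mu : young la -> ysize la = n.+1 ->
  \sum_(j < size mu) (nth 0%N mu j).+1%:R * mono_coef (incr_nth mu j) (jackF n.+1 la) =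
  \sum_(i < N) coe la i * (crow la i + (size mu)%:R) * mono_coef mu (jackF n (rbox la i)).
Proof.
move=> hp hn; rewrite (mono_coef_incr al Fc) ?jack_C0 ?jack_d0 //; last exact: jackF_sym.
rewrite !(lin_comb _ _ (mono_coef_linear Fc mu)) mulr_sumr -big_split; apply: eq_bigr => i _ /=.
change (coe la i * crow la i * mono_coef mu (jackF n (rbox la i)) + (size mu)%:R * (coe la i * mono_coef mu (jackF n (rbox la i)))
  = coe la i * (crow la i + (size mu)%:R) * mono_coef mu (jackF n (rbox la i))).
ring.
Qed.

(** Induction on the size, on the number of parts and on the smallest part, which is written first.
    [mono_coef_jackF_incr] at (v, rest) expresses the coefficient at (v + 1, rest) by those at (v,
    rest + e_j), which are larger in dominance order, and by those of smaller Jack functions at (v,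
    rest). *)
Lemma mono_coef_jackF_dominated n la mu : young la -> ysize la = n -> sumn mu = n -> mono_coef mu (jackF n la) != 0 ->
  forall t, (excess mu t <= yexcess la t)%N.
Proof.
elim: n la mu => [|n IHn] la mu hp hn.
  move=> h0 _ t; suff -> : excess mu t = 0%N by [].
  elim: mu h0 => [|x mu IH]; first by rewrite /excess big_nil.
  by rewrite excess_cons -[sumn _]/(x + sumn mu)%N => /eqP; rewrite addn_eq0 => /andP[/eqP-> /eqP/IH->].
have hJ := jackF_sym hp hn.
have [M] := ubnP (size mu); elim: M mu => [//|M IHM] mu hM hmu hcf.
have mu0 : mu != [::] by apply: contra_eqN hmu => /eqP->.
have [v [rest [hperm hall]]] := min_head mu0.
move: hcf hmu hM; rewrite (mono_coef_perm Fc hJ hperm) (perm_sumn hperm) (perm_size hperm) /= ltnS => hcf hmu hM t.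
rewrite (excess_perm t hperm) {mu mu0 hperm}.
move: t; elim: v rest hall hcf hmu hM => [|v IHv] rest hall hcf hmu hM t.
  by rewrite excess_cons sub0n add0n; apply: IHM.
have := @mono_coef_jackF_incr n la (v :: rest) hp hn; rewrite big_ord_recl /= => E.
case: (boolP [exists j : 'I_(size rest), mono_coef (v :: incr_nth rest j) (jackF n.+1 la) != 0]).
  move=> /existsP[j hj].
  have hx : (v < nth 0 rest j)%N by apply: (allP hall); apply: mem_nth.
  have hall' : all (leq v) rest by apply: sub_all hall => x; apply: ltnW.
  have := IHv (incr_nth rest j) (all_incr hall' (ltn_ord j)) hj _ _ t.
  rewrite sumn_incr // size_incr // !excess_cons excess_incr // addnS -addSn => /(_ hmu hM).
  by apply: leq_trans; case: (leqP t (nth 0%N rest j)); lia.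
rewrite negb_exists => /forallP hz; move: E; rewrite [X in _ + X]big1 ?addr0; last first.
  by move=> j _; have := hz j; rewrite negbK => /eqP h; apply: etrans (congr1 _ h) (mulr0 _).
move=> E.
case: (boolP [exists i : 'I_N, coe la i * (crow la i + (size rest).+1%:R) * mono_coef (v :: rest) (jackF n (rbox la i)) != 0]); last first.
  rewrite negb_exists => /forallP hz'; move: E; rewrite [X in _ = X]big1.
    by move=> /eqP; rewrite mulf_eq0 (negbTE (Fc _)) (negbTE hcf).
  by move=> i _; have := hz' i; rewrite negbK => /eqP.
move=> /existsP[i]; rewrite mulf_eq0 negb_or => /andP[h12 h3].
move: h12; rewrite mulf_eq0 negb_or => /andP[h1 h2].
have hi := coe_neq0_removable hp (ltn_ord i) h1.
have hs : ysize (rbox la i) = n by move: hn; rewrite (ysize_rem hi) => -[].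
have hpi := young_rem hp hi.
have IH t' : (excess (v :: rest) t' <= yexcess (rbox la i) t')%N.
  by apply: IHn => //=; move: hmu; rewrite addSn => -[].
have := IH t; rewrite !excess_cons (yexcess_rem t hi).
(* The critical case is la_i <= t <= v: the added unit of mu counts at t and the removed box of la
   does not. Then all parts of mu are at least t, and it suffices that la has at most as many rows
   as mu has parts. *)
case: (ltnP t (la i)) => [|hti]; first by move=> *; lia.
case: (ltnP v t) => [|htv]; first by move=> *; lia.
rewrite addn0 => _.
have hli : (0 < la i)%N by case/andP: hi => _; apply: leq_ltn_trans.
have h4 : (plen (rbox la i) <= (size rest).+1)%N.
  have hv1 : all (leq 1) (v :: rest).
    by rewrite /= (leq_trans _ htv) ?(leq_trans hli) //=; apply: sub_all hall => x; apply: leq_trans.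
  have := IH 1%N; have := yexcess1 hpi; have := sum_excess_ge hv1; rewrite hs /=.
  move: hmu; rewrite addSn => -[->]; lia.
(* Otherwise the removed box is a whole last row of index i = size rest + 1, its content is -i, and
   the factor c_i + size rest + 1 is 0, contrary to [h2]. *)
have h5 : (plen la <= (size rest).+1)%N.
  case: (leqP (plen la) (size rest).+1) => // hlt.
  have e1 : plen la = (plen (rbox la i)).+1 /\ la i = 1%N.
    case: (eqVneq (la i) 1%N) => [e|ne].
      have := yexcess1 hp; have := yexcess1 hpi; rewrite hn hs (yexcess_rem 1 hi) e; lia.
    have := yexcess1 hp; have := yexcess1 hpi; rewrite hn hs (yexcess_rem 1 hi).
    have -> : (1 < la i)%N by lia.
    lia.
  have e2 : plen la = i.+1.
    case: e1 => _ e; have a1 := plenP i hp; have a2 := plenP i.+1 hp.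
    have : la i.+1 = 0%N by case/andP: hi => _; rewrite e ltnS leqn0 => /eqP.
    move=> a3; rewrite a3 in a2; rewrite e in a1; lia.
  case: e1 => e1 e3; case/eqP: h2; rewrite /crow /zrow e3.
  have -> : (size rest).+1 = i by lia.
  by rewrite mulr1; ring.
have hvt : all (leq t) (v.+1 :: rest).
  by rewrite /= leqW //=; apply: sub_all hall => x hx; lia.
have := sum_excess_ge hvt; rewrite excess_cons /= hmu => e6.
have := yexcess_plen t hp; rewrite (yexcess_rem t hi) ltnNge hti addn0 hn.
have h6 : (t * plen la <= (size rest).+1 * t)%N by rewrite mulnC leq_mul2r h5 orbT.
move: h6 e6; set p1 := (t * _)%N; set p2 := (_ * t)%N; lia.
Qed.


Lemma mono_coef_nseq0 mu k (f : Lam) : mono_coef (mu ++ nseq k 0%N) f = mono_coef mu f.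
Proof.
rewrite mono_coef_cat -{2}[mu]cats0 mono_coef_cat /=; set g := foldl _ _ _.
by elim: k g => [|k IH] g /=.
Qed.

Lemma mkseq_plen la k (f : Lam) : young la -> (plen la <= k)%N ->
  mono_coef (mkseq la k) f = mono_coef (mkseq la (plen la)) f.
Proof.
move=> hp hk; rewrite -(mono_coef_nseq0 (mkseq la (plen la)) (k - plen la)); congr mono_coef.
apply: (@eq_from_nth _ 0%N) => [|i]; first by rewrite size_cat !size_mkseq size_nseq subnKC.
rewrite size_mkseq => hi; rewrite nth_mkseq // nth_cat size_mkseq.
case: ltnP => h; first by rewrite nth_mkseq.
rewrite nth_nseq if_same; have := plenP i hp; lia.
Qed.

Lemma excess_mkseq la k t : excess (mkseq la k) t = (\sum_(i < k) (la i - t))%N.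
Proof. by rewrite /excess big_map -(big_mkord xpredT (fun i => la i - t)%N) /index_iota subn0. Qed.

Lemma sumn_mkseq la k : sumn (mkseq la k) = (\sum_(i < k) la i)%N.
Proof. by rewrite sumnE big_map -(big_mkord xpredT la) /index_iota subn0. Qed.

Lemma sum_support la l : (forall i, (l < i)%N -> la i = 0%N) -> (l < N)%N ->
  (\sum_(i < N) la i)%N = (\sum_(i < l) la i + la l)%N.
Proof.
move=> h hl; rewrite -(big_ord_recr l la) (big_ord_widen N la hl) [RHS]big_mkcond.
by apply: eq_bigr => i _; case: ltnP => // hi; rewrite h.
Qed.

(** [mono_coef_jackF_incr] at la with its last box taken away. By dominance only the term that
    restores this box survives on the left, and only i = l on the right. *)
Lemma norm_rec n la l : young la -> ysize la = n.+1 -> plen la = l.+1 ->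
  (la l)%:R * mono_coef (mkseq la N) (jackF n.+1 la) =
  coe la l * (crow la l + l.+1%:R) * mono_coef (mkseq (rbox la l) N) (jackF n (rbox la l)).
Proof.
move=> hp hn hl; have hlN : (l < N)%N by rewrite -hl; apply: plen_le.
have hil : removable la l by have := removable_last hp; rewrite hn hl => ->.
have hJ := jackF_sym hp hn; have hpi := young_rem hp hil.
have hs i : removable la i -> ysize (rbox la i) = n by move=> hi; move: hn; rewrite (ysize_rem hi) => -[].
set rest := mkseq la l.
have hv : (0 < la l)%N by rewrite (plenP _ hp) hl.
have la0 i : (l < i)%N -> la i = 0%N by move=> h; have := plenP i hp; rewrite hl; lia.
have E1 : mono_coef (mkseq la N) (jackF n.+1 la) = mono_coef ((la l) :: rest) (jackF n.+1 la).
  rewrite mkseq_plen ?plen_le // hl; apply: mono_coef_perm => //.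
  by rewrite mkseqS perm_rcons.
have hpl : (plen (rbox la l) <= l.+1)%N.
  have h := plenP l.+1 hpi; rewrite rbox_ne in h; last by lia.
  by rewrite la0 // in h; lia.
have E2 : mono_coef (mkseq (rbox la l) N) (jackF n (rbox la l)) = mono_coef ((la l).-1 :: rest) (jackF n (rbox la l)).
  rewrite mkseq_plen ?plen_le // -(mkseq_plen _ hpi hpl); apply: mono_coef_perm => //.
    by apply: jackF_sym => //; apply: hs.
  rewrite mkseqS rbox_at perm_rcons perm_cons.
  suff -> : mkseq (rbox la l) l = rest by [].
  by apply/eq_in_map => i; rewrite mem_iota => hi; rewrite rbox_ne //; lia.
rewrite E1 E2 {E1 E2}.
have := @mono_coef_jackF_incr n la ((la l).-1 :: rest) hp hn; rewrite big_ord_recl /= prednK // size_mkseq.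
have sumrest : (la l + sumn rest)%N = n.+1.
  by rewrite -hn sumn_mkseq /ysize (@sum_support la l la0 hlN) 1?addnC.
have DmE t : (excess rest t + (la l - t) = yexcess la t)%N.
  rewrite excess_mkseq /yexcess (@sum_support (fun i => la i - t)%N l _ hlN) // => i hi.
  by rewrite la0.
rewrite [X in _ + X = _]big1 ?addr0; last first.
  move=> j _; apply: etrans (mulr0 _); congr (_ * _); apply/eqP.
  apply: contraT => h; have hj : (j < l)%N by rewrite -[l](size_mkseq la); exact: ltn_ord j.
  (* At the threshold la_j the raised row gives one unit of excess too many. For the right side
     below, the threshold is la_i - 1, where the box removed from row i is missing. *)
  have := @mono_coef_jackF_dominated n.+1 la ((la l).-1 :: incr_nth rest j) hp hn _ h (la j).
  rewrite excess_cons excess_incr ?size_mkseq // (nth_mkseq _ _ hj) leqnn -DmE /= sumn_incr ?size_mkseq //.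
  have := young_mono hp (ltnW hj); move: sumrest; lia.
move=> ->; rewrite (bigD1 (Ordinal hlN)) //= [X in _ + X = _]big1 ?addr0 // => i hi.
have hil' : (i : nat) != l by rewrite -val_eqE in hi.
case: (boolP (removable la i)) => [hri|hri]; last by rewrite (coe_not_removable al hp _ hri) // !mul0r.
apply: etrans (mulr0 _); congr (_ * _); apply/eqP; apply: contraT => h.
have hlt : (i < l)%N.
  have h1 : (0 < la i)%N by case/andP: hri => _; apply: leq_ltn_trans.
  by move: h1; rewrite (plenP _ hp) hl ltnS leq_eqVlt (negbTE hil').
have hgt : (la l < la i)%N.
  by case/andP: hri => _; apply: leq_ltn_trans; apply: (young_mono hp).
have := @mono_coef_jackF_dominated n (rbox la i) ((la l).-1 :: rest) (young_rem hp hri) (hs _ hri) _ h (la i).-1.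
have := DmE (la i).-1; rewrite (yexcess_rem _ hri) excess_cons /=.
have -> : ((la i).-1 < la i)%N by lia.
move: sumrest; lia.
Qed.

End Tri.

(** * The leading coefficient as a hook product *)

Section Hook.
Variables (F : fieldType) (al : F).
Hypothesis Hal : forall m r : int, al * m%:~R + r%:~R = 0 -> m = 0 /\ r = 0.
Variable N : nat.
Implicit Types (la : nat -> nat).
Local Notation zrow := (zrow al).
Local Notation crow := (crow al).
Local Notation coe := (coe al N).
Local Notation removable := (removable N).
Local Notation young := (young N).
Local Notation ysize := (ysize N).
Local Notation plen := (plen N).
Local Notation jackF := (jackF al N).

Definition col_len la j := (\sum_(k < N) (j < la k))%N.
Definition hook_factor la i j : F := al * (la i - j - 1)%:R + (col_len la j - i - 1)%:R + 1.
Definition yhook la : F := \prod_(i < N) \prod_(j < la i) hook_factor la i j.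

Lemma al_nat_neq0 (p q : nat) : al * p%:R + q%:R + 1 != 0.
Proof.
apply/eqP => h; case: (@Hal p%:Z q.+1%:Z) => //.
by rewrite -[RHS]h !pmulrn intS rmorphD /=; ring.
Qed.

Lemma yhook_neq0 la : yhook la != 0.
Proof. by apply/prodf_neq0 => i _; apply/prodf_neq0 => j _; apply: al_nat_neq0. Qed.

(** With x = z_l for the last nonempty row l: the empty rows have z_j = -j, so their factors in a_l
    telescope. *)
Lemma telescope_coe (x : F) l k : (forall j : nat, (l < j)%N -> x + j%:R != 0) ->
  (x + (l.+1 + k)%:R - 1) * \prod_(j < k) ((x + (l.+1 + j)%:R - 1) / (x + (l.+1 + j)%:R)) = x + l%:R.
Proof.
move=> h; elim: k => [|k IH]; first by rewrite big_ord0 mulr1 addn0 -natr1; ring.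
rewrite big_ord_recr /= mulrCA -[RHS]IH [RHS]mulrC; congr (_ * _).
have h1 := h (l.+1 + k)%N (leq_addr _ _).
rewrite addnS -natr1; move: h1; set w := (_ + k)%:R => h1.
by rewrite addrA addrK mulrC divfK.
Qed.

Lemma coe_last la l : young la -> plen la = l.+1 ->
  coe la l = (la l)%:R * \prod_(j < l) ((zrow la j - zrow la l + 1) / (zrow la j - zrow la l)).
Proof.
move=> hp hl; have hlN : (l.+1 <= N)%N by rewrite -hl; apply: plen_le.
have la0 i : (l < i)%N -> la i = 0%N by move=> h; have := plenP i hp; rewrite hl; lia.
rewrite /coe; have -> : \prod_(j < N | (j : nat) != l) ((zrow la l - zrow la j - 1) / (zrow la l - zrow la j)) =
  \prod_(j < l) ((zrow la j - zrow la l + 1) / (zrow la j - zrow la l)) *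
  \prod_(j < N - l.+1) ((zrow la l + (l.+1 + j)%:R - 1) / (zrow la l + (l.+1 + j)%:R)).
  pose g j := (zrow la l - zrow la j - 1) / (zrow la l - zrow la j).
  pose G j := if j != l then g j else 1.
  rewrite big_mkcond -(big_mkord xpredT G) (big_cat_nat (n := l.+1)) //=; congr (_ * _).
    rewrite big_nat_recr //= /G eqxx mulr1 big_mkord; apply: eq_bigr => j _.
    have hj := ltn_ord j; rewrite (_ : (j : nat) != l) ?ltn_eqF // /g.
    have n1 : zrow la j - zrow la l != 0 by apply: zrow_neq => //; rewrite ltn_eqF.
    have n2 : zrow la l - zrow la j != 0 by rewrite -opprB oppr_eq0.
    have -> : zrow la l - zrow la j - 1 = - (zrow la j - zrow la l + 1) by ring.
    by rewrite -[zrow la l - zrow la j]opprB invrN mulrNN.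
  rewrite -{1}[l.+1]add0n big_addn big_mkord; apply: eq_bigr => j _.
  rewrite /G gtn_eqF; last by lia.
  rewrite /g addnC; have -> : zrow la (l.+1 + j)%N = - (l.+1 + j)%:R by rewrite /zrow la0 ?mulr0 ?sub0r //; lia.
  by rewrite opprK.
have hne (j : nat) : (l < j)%N -> zrow la l + j%:R != 0.
  move=> hj; have := @zrow_neq _ _ Hal la l j; rewrite (_ : zrow la j = - j%:R) ?opprK => [->//|].
    by rewrite ltn_eqF.
  by rewrite /zrow la0 // mulr0 sub0r.
have T := @telescope_coe (zrow la l) l (N - l.+1) hne; rewrite subnKC // in T.
rewrite [X in al^-1 * X]mulrCA T [X in al^-1 * X]mulrC mulrA; congr (_ * _).
by rewrite /zrow addrNK mulrA mulVf ?mul1r //; exact: al_neq0 Hal.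
Qed.

Lemma cnt_top la l j : young la -> plen la = l.+1 -> (j < la l)%N -> col_len la j = l.+1.
Proof.
move=> hp hl hj; have hlN : (l.+1 <= N)%N by rewrite -hl; apply: plen_le.
rewrite -[RHS](sum_ltn hlN); apply: eq_bigr => k _; congr nat_of_bool.
case: (ltnP k l.+1) => hk; first by apply: leq_trans hj _; apply: (young_mono hp).
by have := plenP k hp; rewrite hl; lia.
Qed.

Lemma cnt_rbox la l j : (l < N)%N -> (0 < la l)%N ->
  col_len la j = (col_len (rbox la l) j + (j == (la l).-1))%N.
Proof.
move=> hl hv; rewrite /col_len (bigD1 (Ordinal hl)) //= [in RHS](bigD1 (Ordinal hl)) //= rbox_at.
rewrite (eq_bigr (fun k : 'I_N => (j < rbox la l k)%N : nat)) => [|k hk]; last by rewrite rbox_ne.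
by case: (ltngtP j (la l).-1) => h; lia.
Qed.

(** Removing the last box of the last row l changes, in a row i above, only the factor in the column
    of that box, from z_i - z_l + 1 to z_i - z_l. In row l the factor c_l + l + 1 of the first box
    is lost. The quotients are those of [coe_last]. *)
Lemma yhook_rec la l : young la -> plen la = l.+1 ->
  (la l)%:R * yhook la = coe la l * (crow la l + l.+1%:R) * yhook (rbox la l).
Proof.
move=> hp hl; have hlN : (l < N)%N by rewrite -hl; apply: plen_le.
have hv : (0 < la l)%N by rewrite (plenP _ hp) hl.
have la0 i : (l < i)%N -> la i = 0%N by move=> h; have := plenP i hp; rewrite hl; lia.
have hil : removable la l by rewrite /removable hlN la0.
set v := la l in hv *.
have Erow (i : 'I_N) : (i < l)%N ->
    \prod_(j < la i) hook_factor la i j =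
    (zrow la i - zrow la l + 1) / (zrow la i - zrow la l) * \prod_(j < rbox la l i) hook_factor (rbox la l) i j.
  move=> hi; have hvi : (v.-1 < la i)%N by rewrite prednK //; apply: (young_mono hp); apply: ltnW.
  rewrite (rbox_ne la (j := i)); last by rewrite ltn_eqF.
  rewrite (bigD1 (Ordinal hvi)) //= [in RHS](bigD1 (Ordinal hvi)) //= mulrA; congr (_ * _).
    rewrite /hook_factor (rbox_ne la (j := i)); last by rewrite ltn_eqF.
    have e0 : col_len la v.-1 = l.+1 by apply: cnt_top => //; rewrite prednK.
    have -> : col_len (rbox la l) v.-1 = l.
      by have := @cnt_rbox la l v.-1 hlN hv; rewrite -/v e0 eqxx; lia.
    rewrite e0.
    have n1 : zrow la i - zrow la l != 0 by apply: zrow_neq => //; rewrite ltn_eqF.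
    have e1 : zrow la i - zrow la l = al * (la i - v)%:R + (l - i)%:R.
      by rewrite /zrow !natrB ?(ltnW hi) // -/v; [ring|apply: (young_mono hp); apply: ltnW].
    have -> : (la i - v.-1 - 1 = la i - v)%N by lia.
    have -> : (l.+1 - i - 1 = l - i)%N by lia.
    have e2 : (l - i - 1)%:R + 1 = (l - i)%:R :> F.
      by rewrite natr1; congr _%:R; lia.
    rewrite -[X in _ = _ * X]addrA e2 -e1 divfK //.
  apply: eq_bigr => j; rewrite -val_eqE /= => hj.
  rewrite /hook_factor (rbox_ne la (j := i)); last by rewrite ltn_eqF.
  by rewrite (@cnt_rbox la l j hlN hv) (negbTE hj) addn0.
have Elast : \prod_(j < v) hook_factor la l j =
    (crow la l + l.+1%:R) * \prod_(j < rbox la l l) hook_factor (rbox la l) l j.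
  have [w ev] : exists w, v = w.+1 by exists v.-1; rewrite prednK.
  rewrite rbox_at -/v ev big_ord_recl; congr (_ * _).
    rewrite /hook_factor (cnt_top hp hl) -/v ev // /crow /zrow -/v ev.
    have -> : (w.+1 - 0 - 1 = w)%N by lia.
    have -> : (l.+1 - l - 1 = 0)%N by lia.
    by rewrite -!natr1; ring.
  apply: eq_bigr => j _; rewrite /hook_factor rbox_at -/v ev lift0 /=.
  rewrite (cnt_top hp hl); last by rewrite -/v ev ltnS ltn_ord.
  have -> : col_len (rbox la l) j = l.+1.
    have := @cnt_rbox la l j hlN hv; rewrite -/v ev /= (ltn_eqF (ltn_ord j)) addn0 => <-.
    by apply: cnt_top; rewrite // -/v ev ltnW // ltnS ltn_ord.
  by congr (al * _%:R + _ + _); lia.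
have Erest (i : 'I_N) : (l < i)%N -> \prod_(j < la i) hook_factor la i j =
    \prod_(j < rbox la l i) hook_factor (rbox la l) i j.
  by move=> hi; rewrite rbox_ne ?la0 ?big_ord0 ?gtn_eqF.
pose r i : F := if (i < l)%N then (zrow la i - zrow la l + 1) / (zrow la i - zrow la l)
   else if i == l then crow la l + l.+1%:R else 1.
have Eall : yhook la = (\prod_(i < N) r i) * yhook (rbox la l).
  rewrite /yhook -big_split; apply: eq_bigr => i _ /=; rewrite /r.
  case: (ltngtP i l) => h; [exact: Erow|by rewrite Erest ?mul1r|].
  by rewrite h Elast.
rewrite Eall mulrA; congr (_ * _); rewrite (coe_last hp hl) -mulrA; congr (_ * _).
rewrite -(big_mkord xpredT r) (big_cat_nat (n := l.+1)) //=.
rewrite [X in _ * X]big_nat_cond [X in _ * X]big1 ?mulr1; last first.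
  by move=> i /andP[/andP[h _] _]; rewrite /r ltnNge (ltnW h) /= gtn_eqF.
rewrite big_nat_recr //= /r ltnn eqxx; congr (_ * _); rewrite big_mkord.
by apply: eq_bigr => i _; rewrite ltn_ord.
Qed.

Lemma mono_coef_jackF_diag n la : young la -> ysize la = n -> mono_coef (mkseq la N) (jackF n la) = yhook la.
Proof.
elim: n la => [|n IH] la hp hn.
  have h0 i := ysize0_at i hp hn.
  rewrite /yhook big1 => [|i _]; last by rewrite h0 big_ord0.
  by rewrite mono_coef_all0 // sumn_mkseq big1.
case hl : (plen la) => [|l].
  have := yexcess1 hp; rewrite hl hn addn0 /yexcess => e.
  suff : ysize la = 0%N by rewrite hn.
  by rewrite /ysize big1 // => i _; have := plenP i hp; rewrite hl; lia.
have hil : removable la l by have := removable_last hp; rewrite hn hl => ->.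
have hv : (la l)%:R != 0 :> F.
  have : (0 < la l)%N by rewrite (plenP _ hp) hl.
  by case: (la l) => // x _; apply: natr_neq0 Hal x.
apply: (mulfI hv); rewrite norm_rec // yhook_rec // IH //; first exact: young_rem.
by move: hn; rewrite (ysize_rem hil) => -[].
Qed.

End Hook.

(** * Identification with the Jack family *)

Lemma alpha_transc (m r : int) : alpha * m%:~R + r%:~R = 0 -> m = 0 /\ r = 0.
Proof.
have -> : alpha * m%:~R + r%:~R = FracField.tofrac ('X * m%:~R + r%:~R : {poly rat}).
  by rewrite rmorphD rmorphM /= !rmorph_int.
move=> /eqP; rewrite tofrac_eq0 => /eqP h.
have cI (x : int) i : (x%:~R : {poly rat})`_i = if i == 0%N then x%:~R else 0.
  by rewrite -(rmorph_int (@polyC rat)) coefC.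
have h0 := congr1 (fun p : {poly rat} => p`_0) h; have h1 := congr1 (fun p : {poly rat} => p`_1) h.
move: h0 h1; rewrite !coefD !coefXM !cI /= !coef0 add0r addr0 => /eqP + /eqP.
by rewrite !intr_eq0 => /eqP -> /eqP ->.
Qed.

Section Dominance.
Implicit Types (la mu : seq nat).

Definition psum la i := (\sum_(j < i) nth 0%N la j)%N.
(** Strictly increasing for dominance ([dom_rank_lt]), so that inductions along this partial order
    become inductions on a number. *)
Definition dom_rank n la := (\sum_(i < n.+1) psum la i)%N.

Lemma size_part n la : la \in partitions n -> (size la <= n)%N.
Proof.
rewrite mem_partitions => /andP[/andP[_ h0] /eqP <-].
elim: la h0 => [//|x la IH]; rewrite inE negb_or eq_sym -lt0n => /andP[h /IH] /=; lia.
Qed.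

Lemma part_nth_ext n la mu : la \in partitions n -> mu \in partitions n ->
  (forall i, (i < n)%N -> nth 0%N la i = nth 0%N mu i) -> la = mu.
Proof.
have key (l m : seq nat) : l \in partitions n -> m \in partitions n ->
    (forall i, (i < n)%N -> nth 0%N l i = nth 0%N m i) -> (size l <= size m)%N.
  move=> hl hm h; rewrite leqNgt; apply/negP => hlt.
  have hsz := leq_trans hlt (size_part hl).
  have := h _ hsz; rewrite (nth_default _ (leqnn (size m))) => e.
  move: hl; rewrite mem_partitions => /andP[/andP[_ /negP h0] _]; apply: h0.
  by rewrite -e mem_nth.
move=> hl hm h; apply: (@eq_from_nth _ 0%N) => [|i hi].
  by apply/eqP; rewrite eqn_leq !key // => i hi; rewrite h.
by apply: h; apply: leq_trans hi (size_part hl).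
Qed.

Lemma dom_rank_lt n la mu : la \in partitions n -> mu \in partitions n ->
  dominated mu la -> mu != la -> (dom_rank n mu < dom_rank n la)%N.
Proof.
move=> hl hm hd hne; rewrite ltn_neqAle leq_sum ?andbT => [|i _]; last exact: hd.
apply: contra hne => /eqP e; apply/eqP.
have e' i : (i <= n)%N -> psum mu i = psum la i.
  move=> hi; apply/eqP; rewrite eqn_leq hd /= leqNgt; apply/negP => hlt.
  have : (dom_rank n mu < dom_rank n la)%N.
    rewrite /dom_rank (bigD1 (Ordinal (hi : (i < n.+1)%N))) //= [X in (_ < X)%N](bigD1 (Ordinal (hi : (i < n.+1)%N))) //=.
    by rewrite -addSn leq_add // leq_sum // => k _; apply: hd.
  by rewrite e ltnn.
apply: (part_nth_ext hm hl) => i hi.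
have := e' i.+1 hi; rewrite /psum !big_ord_recr /= -/(psum mu i) -/(psum la i) e' ?(ltnW hi) //.
exact: addnI.
Qed.

Lemma sorted_nth_mono la i j : sorted geq la -> (i <= j)%N -> (nth 0 la j <= nth 0 la i)%N.
Proof.
move=> hs hij; case: (ltnP j (size la)) => hj; last by rewrite [nth 0%N la j]nth_default.
rewrite leq_eqVlt in hij; case/orP: hij => [/eqP->//|hij].
by apply: (sorted_ltn_nth (rev_trans leq_trans) 0%N hs) => //; rewrite inE // (ltn_trans hij).
Qed.

End Dominance.

Lemma jinner_term (F : fieldType) (x y p a m : F) : m != 0 ->
  x / m * (y / m) * (p * m) * a = a * p * x * y / m.
Proof. by move=> h; field. Qed.

Definition fnth (la : seq nat) : nat -> nat := nth 0%N la.

Section Family.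
Variable n : nat.
Implicit Types (la mu rho : seq nat) (a b : symf).

Let Fc k : k.+1%:R != 0 :> K. Proof. exact: natr_neq0 alpha_transc k. Qed.

Lemma young_part la : la \in partitions n -> young n (fnth la).
Proof.
move=> h; have hs := size_part h; move: h; rewrite mem_partitions => /andP[/andP[h1 _] _].
by split=> [i|]; [apply: sorted_nth_mono|rewrite /fnth nth_default].
Qed.

Lemma sum_fnth la k : (size la <= k)%N -> (\sum_(i < k) fnth la i)%N = sumn la.
Proof.
move=> h; rewrite sumnE (big_nth 0%N) big_mkord (big_ord_widen k (fnth la) h) [RHS]big_mkcond.
by apply: eq_bigr => i _; case: ltnP => // hi; rewrite /fnth nth_default.
Qed.

Lemma ysize_part la : la \in partitions n -> ysize n (fnth la) = n.
Proof.
move=> h; rewrite /ysize sum_fnth ?size_part //.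
by move: h; rewrite mem_partitions => /andP[_ /eqP].
Qed.

Definition jack_part la : seq nat -> K^o := jackF alpha n n (fnth la).
(** Passes from Taylor coefficients to coefficients of p_rho, which differ by prod_i m_i!. *)
Definition jack_symf la : symf := fun rho => jack_part la (map predn rho) / (mult_fact rho)%:R.

Lemma jack_part_sym la : la \in partitions n -> swap_inv (jack_part la).
Proof. by move=> h; apply: (jackF_sym alpha_transc (young_part h) (ysize_part h)). Qed.

Lemma mcoef_jack_symf la mu : la \in partitions n -> sumn mu = n -> mcoef (jack_symf la) mu = mono_coef mu (jack_part la).
Proof.
move=> hl hm; rewrite -(sum_parts_mono_coef Fc _ (jack_part_sym hl)) /mcoef /sum_parts; apply: eq_bigr => r _.
by rewrite /jack_symf mulrAC.
Qed.

Lemma zeeE rho : zee rho = (\prod_(i <- rho) i * mult_fact rho)%N.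
Proof.
rewrite /zee big_split /=; congr (_ * _)%N.
rewrite -(big_undup_iterop_count _ rho xpredT (fun i => i)) /=.
by apply: eq_bigr => i _; rewrite Monoid.iteropE /= iter_muln muln1.
Qed.

Lemma jinner_jack_symf la mu : la \in partitions n -> mu \in partitions n ->
  jinner n (jack_symf la) (jack_symf mu) = jpair alpha n (jack_part la) (jack_part mu).
Proof.
move=> hl hm; apply: eq_bigr => r _; rewrite /jack_symf zeeE natrM.
have -> : alpha_wt alpha r = alpha ^+ size r * (\prod_(i <- r) i)%:R.
  rewrite /alpha_wt big_split /= natr_prod; congr (_ * _).
  by elim: r => [|x r IH]; rewrite ?big_nil // big_cons IH -exprS.
have h : (mult_fact r)%:R != 0 :> K by rewrite Fcn // mult_fact_gt0.
exact: jinner_term.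
Qed.

Lemma hookH_yhook la : la \in partitions n -> hookH la = yhook alpha n (fnth la).
Proof.
move=> hl; rewrite /hookH /yhook.
pose f i := \prod_(j < fnth la i) hook_factor alpha n (fnth la) i j.
rewrite -[RHS]/(\prod_(i < n) f i).
have -> : \prod_(i < n) f i = \prod_(i < size la) f i.
  rewrite (big_ord_widen n f (size_part hl)) [RHS]big_mkcond; apply: eq_bigr => i _.
  by case: ltnP => // hi; rewrite /f /fnth nth_default // big_ord0.
apply: eq_bigr => i _; apply: eq_bigr => j _; rewrite /hook_factor /arm /leg.
congr (_ * _ + (_ - _ - _)%:R + _).
rewrite /conjp /col_len -sum1_count (big_nth 0%N) big_mkord big_mkcond.
pose g k := nat_of_bool (j < fnth la k)%N.
rewrite -[RHS]/(\sum_(k < n) g k)%N.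
have -> : (\sum_(k < n) g k = \sum_(k < size la) g k)%N.
  rewrite (big_ord_widen n g (size_part hl)) [RHS]big_mkcond; apply: eq_bigr => k _.
  case: (ltnP k (size la)) => // hk; rewrite /g.
  by have -> : fnth la k = 0%N by rewrite /fnth nth_default.
by apply: eq_bigr => k _; rewrite /g /fnth; case: (j < nth 0%N la k)%N.
Qed.

Lemma leq_sum_trunc (f : nat -> nat) i s : (forall j, (s <= j)%N -> f j = 0%N) ->
  (\sum_(0 <= j < i) f j <= \sum_(0 <= j < s) f j)%N.
Proof.
move=> hf; case: (leqP i s) => hi.
  by rewrite [X in (_ <= X)%N](big_cat_nat (leq0n i) hi) leq_addr.
rewrite (big_cat_nat (leq0n s) (ltnW hi)) /= [X in (_ + X)%N]big_nat_cond.
rewrite [X in (_ + X)%N]big1 ?addn0 //.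
by move=> k /andP[/andP[hk _] _]; apply: hf.
Qed.

Lemma dominated_tri la mu : la \in partitions n ->
  (forall t, (excess mu t <= yexcess n (fnth la) t)%N) -> dominated mu la.
Proof.
move=> hl h i; have hs : sorted geq la by move: hl; rewrite mem_partitions => /andP[/andP[]].
have hsz := size_part hl.
pose t := nth 0%N la i.
have Emu : (\sum_(j < i) nth 0%N mu j <= i * t + excess mu t)%N.
  apply: leq_trans (_ : \sum_(j < i) (t + (nth 0%N mu j - t)) <= _)%N.
    by apply: leq_sum => j _; lia.
  rewrite big_split /= sum_nat_const card_ord leq_add2l /excess (big_nth 0%N) big_mkord.
  rewrite -!(big_mkord xpredT (fun j => nth 0%N mu j - t)%N).
  by apply: leq_sum_trunc => k hk; rewrite nth_default.
have Ela : (\sum_(j < i) nth 0%N la j = i * t + yexcess n (fnth la) t)%N.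
  have -> : (\sum_(j < i) nth 0%N la j = \sum_(j < i) (t + (nth 0%N la j - t)))%N.
    by apply: eq_bigr => j _; rewrite subnKC // sorted_nth_mono // ltnW.
  rewrite big_split /= sum_nat_const card_ord; congr (_ + _)%N.
  rewrite /yexcess -!(big_mkord xpredT (fun j => nth 0%N la j - t)%N).
  have z0 j : (i <= j)%N -> (nth 0%N la j - t = 0)%N.
    by move=> hj; apply/eqP; rewrite subn_eq0 sorted_nth_mono.
  apply/eqP; rewrite eqn_leq !leq_sum_trunc // => k hk.
  by rewrite nth_default // (leq_trans hsz).
rewrite Ela; apply: leq_trans Emu _; rewrite leq_add2l; exact: h.
Qed.

Lemma mono_coef_jack_part la : la \in partitions n -> mono_coef la (jack_part la) = hookH la.
Proof.
move=> hl; rewrite hookH_yhook // -(mono_coef_jackF_diag alpha_transc (young_part hl) (ysize_part hl)).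
rewrite -(@mono_coef_nseq0 K la (n - size la)); congr mono_coef.
apply: (@eq_from_nth _ 0%N) => [|i]; rewrite size_cat size_nseq subnKC ?size_part ?size_mkseq //.
move=> hi; rewrite nth_cat nth_mkseq // /fnth; case: ltnP => h //.
by rewrite nth_nseq if_same nth_default.
Qed.

Lemma jack_symf_spec : jack_family_spec n jack_symf.
Proof.
move=> la hl; have hp := young_part hl; have hn := ysize_part hl.
split=> [mu hm||mu hm hne].
- have hs : sumn mu = n by move: hm; rewrite mem_partitions => /andP[_ /eqP].
  rewrite mcoef_jack_symf // => hcf; apply: dominated_tri => // t.
  exact: (mono_coef_jackF_dominated alpha_transc hp hn hs hcf).
- by rewrite mcoef_jack_symf ?mono_coef_jack_part //; move: hl; rewrite mem_partitions => /andP[_ /eqP].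
- rewrite jinner_jack_symf //.
  have [O1 _ _ _] := jack_orthogonality alpha_transc n n; apply: O1 => //; [exact: young_part|exact: ysize_part|].
  move=> e; case/eqP: hne; apply: (part_nth_ext hm hl) => i _.
  by rewrite -/(fnth mu i) -/(fnth la i) e.
Qed.

Lemma jack_symf_norm la : la \in partitions n -> jinner n (jack_symf la) (jack_symf la) != 0.
Proof.
move=> hl; rewrite jinner_jack_symf //; have [_ O1n _ _] := jack_orthogonality alpha_transc n n.
by apply: O1n; [exact: young_part|exact: ysize_part].
Qed.

Lemma jinner_sub a b e : jinner n (fun r => a r - b r) e = jinner n a e - jinner n b e.
Proof. by rewrite -sumrB; apply: eq_bigr => r _; ring. Qed.

Lemma jinner_sum (x : symf) (G : seq nat -> symf) e :
  jinner n (fun r => \sum_(mu <- partitions n) x mu * G mu r) e =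
  \sum_(mu <- partitions n) x mu * jinner n (G mu) e.
Proof.
rewrite /jinner; under [RHS]eq_bigr => mu _ do rewrite mulr_sumr.
rewrite exchange_big /=; apply: eq_bigr => r _; rewrite !mulr_suml; apply: eq_bigr => mu _.
by rewrite !mulrA.
Qed.

(** M holds the coefficients of the Jack functions and G is its weighted transpose. M G is the Gram
    matrix, diagonal with nonzero entries, so G is invertible, and v G = 0 forces v = 0. *)
Lemma jinner_nondeg (g : symf) : (forall mu, mu \in partitions n -> jinner n g (jack_symf mu) = 0) ->
  forall rho, rho \in partitions n -> g rho = 0.
Proof.
move=> hg; set p := size (partitions n).
pose P i := nth [::] (partitions n) i.
have hP (i : 'I_p) : P i \in partitions n by apply: mem_nth.
pose w r : K := (zee r)%:R * alpha ^+ size r.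
pose M : 'M[K]_p := \matrix_(i, j) jack_symf (P i) (P j).
pose G : 'M[K]_p := \matrix_(i, j) (w (P i) * jack_symf (P j) (P i)).
have jE a b : jinner n a b = \sum_(i < p) a (P i) * (w (P i) * b (P i)).
  rewrite /jinner (big_nth [::]) big_mkord; apply: eq_bigr => i _; rewrite /w; ring.
have EMG : M *m G = diag_mx (\row_i jinner n (jack_symf (P i)) (jack_symf (P i))).
  apply/matrixP => i j; rewrite !mxE.
  transitivity (jinner n (jack_symf (P i)) (jack_symf (P j))).
    by rewrite jE; apply: eq_bigr => k _; rewrite !mxE.
  case: eqVneq => [->|hij]; first by rewrite mulr1n.
  have [_ _ h] := jack_symf_spec (hP i); rewrite h ?hP ?mulr0n //.
  by rewrite /P (nth_uniq _ _ _ (uniq_partitions n)) // eq_sym.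
have uG : G \in unitmx.
  have : \det (M *m G) != 0.
    rewrite EMG det_diag; apply/prodf_neq0 => i _; rewrite mxE; apply: jack_symf_norm.
    exact: hP.
  by rewrite det_mulmx mulf_eq0 negb_or unitmxE unitfE => /andP[].
pose v : 'rV[K]_p := \row_i g (P i).
have v0 : v = 0.
  rewrite -[v](mulmxK uG); suff -> : v *m G = 0 by rewrite mul0mx.
  apply/rowP => j; rewrite !mxE -[RHS](hg (P j) (hP j)) jE.
  by apply: eq_bigr => k _; rewrite !mxE.
move=> rho hr; have hi : (index rho (partitions n) < p)%N by rewrite index_mem.
have := congr1 (fun u : 'rV[K]_p => u 0 (Ordinal hi)) v0; rewrite !mxE /P /=.
by rewrite nth_index.
Qed.

Lemma mcoef_sub a b mu : mcoef (fun r => a r - b r) mu = mcoef a mu - mcoef b mu.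
Proof. by rewrite -sumrB; apply: eq_bigr => r _; rewrite mulrBl. Qed.

Lemma eq_mcoef a b mu : sumn mu = n -> (forall rho, rho \in partitions n -> a rho = b rho) ->
  mcoef a mu = mcoef b mu.
Proof. by move=> hm h; rewrite /mcoef hm; apply: eq_big_seq => r hr; rewrite h. Qed.

Lemma mcoef_sum (x : symf) (G : seq nat -> symf) nu :
  mcoef (fun r => \sum_(mu <- partitions n) x mu * G mu r) nu =
  \sum_(mu <- partitions n) x mu * mcoef (G mu) nu.
Proof.
rewrite /mcoef; under [RHS]eq_bigr => mu _ do rewrite mulr_sumr.
rewrite exchange_big /=; apply: eq_bigr => r _; rewrite !mulr_suml; apply: eq_bigr => mu _.
by rewrite !mulrA.
Qed.

(* By induction on [dom_rank], [A la - jack_symf la] is orthogonal to the [jack_symf mu]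
   with mu < la, and it only involves such terms. *)
Lemma jack_family_unique (A : seq nat -> symf) : jack_family_spec n A ->
  forall la, la \in partitions n -> forall rho, rho \in partitions n -> A la rho = jack_symf la rho.
Proof.
move=> hA la; have [k] := ubnP (dom_rank n la); elim: k la => [//|k IH] la hk hl.
have smn mu : mu \in partitions n -> sumn mu = n by rewrite mem_partitions => /andP[_ /eqP].
pose g : symf := fun r => A la r - jack_symf la r.
pose x mu : K := jinner n g (jack_symf mu) / jinner n (jack_symf mu) (jack_symf mu).
have [Ad Ah Ao] := hA la hl; have [Jd Jh Jo] := jack_symf_spec hl.
have xs mu : mu \in partitions n -> dominated mu la -> mu != la -> x mu = 0.
  move=> hm hd hne; rewrite /x jinner_sub Jo // subr0.
  have e : jinner n (A la) (jack_symf mu) = jinner n (A la) (A mu).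
    apply: eq_big_seq => r hr; rewrite (IH mu) //.
    by apply: leq_trans (dom_rank_lt hl hm hd hne) _.
  by rewrite e Ao // mul0r.
have gE rho : rho \in partitions n -> g rho = \sum_(mu <- partitions n) x mu * jack_symf mu rho.
  move=> hr; apply/eqP; rewrite -subr_eq0; apply/eqP.
  pose f : symf := fun rho => g rho - \sum_(mu <- partitions n) x mu * jack_symf mu rho.
  apply: (@jinner_nondeg f) hr => mu hm.
  rewrite jinner_sub jinner_sum (bigD1_seq mu) ?uniq_partitions //= [X in _ - (_ + X)]big1_seq.
    by rewrite addr0 /x divfK ?subrr // jack_symf_norm.
  by move=> nu /andP[hne hnu]; have [_ _ h] := jack_symf_spec hnu; rewrite h ?mulr0 // eq_sym.
(* Downward induction on [dom_rank], the double sum being an upper bound for it. Once x vanishes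
   above mu, the coefficient of m_mu in g is [x mu * hookH mu]; it can be nonzero only for mu < la,
   where [xs] applies. *)
have x0 mu : mu \in partitions n -> x mu = 0.
  have [m] := ubnP (\sum_(i < n.+1) \sum_(j < i) n - dom_rank n mu)%N; elim: m mu => [//|m IHm] mu hmm hm.
  have dmb nu : nu \in partitions n -> (dom_rank n nu <= \sum_(i < n.+1) \sum_(j < i) n)%N.
    move=> hnu; apply: leq_sum => i _; apply: leq_sum => j _.
    by rewrite -[X in (_ <= X)%N](smn _ hnu); apply: leq_nth_sumn.
  have E : mcoef g mu = x mu * hookH mu.
    rewrite (@eq_mcoef g (fun rho => \sum_(mu <- partitions n) x mu * jack_symf mu rho)) ?smn //.
    rewrite mcoef_sum (bigD1_seq mu) ?uniq_partitions //= [X in _ + X]big1_seq ?addr0.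
      by have [_ -> _] := jack_symf_spec hm.
    move=> nu /andP[hne hnu]; have [hd _ _] := jack_symf_spec hnu.
    case: (eqVneq (mcoef (jack_symf nu) mu) 0) => [->|h]; first by rewrite mulr0.
    have hlt := dom_rank_lt hnu hm (hd mu hm h).
    rewrite (IHm nu) ?mul0r //; have := dmb nu hnu; have := hlt; rewrite eq_sym => /(_ hne); lia.
  case: (eqVneq (mcoef g mu) 0) => [h|h].
    move: E; rewrite h => /esym/eqP; rewrite mulf_eq0 => /orP[/eqP//|].
    by rewrite hookH_yhook // (negbTE (yhook_neq0 alpha_transc n _)).
  have hne : mu != la.
    by apply: contraNneq h => ->; rewrite mcoef_sub Ah Jh subrr.
  apply: xs => //; move: h; rewrite mcoef_sub.
  case: (eqVneq (mcoef (A la) mu) 0) => [->|h _]; last exact: Ad.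
  by rewrite sub0r oppr_eq0; apply: Jd.
move=> rho hr; apply/eqP; rewrite -subr_eq0 -/(g rho) gE // big1_seq // => mu /andP[_ hm].
by rewrite x0 // mul0r.
Qed.

Lemma mcoef_jackJ la mu : la \in partitions n -> sumn mu = n ->
  mcoef (jackJ la) mu = mono_coef mu (jack_part la).
Proof.
move=> hl hm; have hs : sumn la = n by move: hl; rewrite mem_partitions => /andP[_ /eqP].
rewrite -mcoef_jack_symf //; apply: eq_mcoef => // rho; rewrite /jackJ hs.
apply: jack_family_unique => //; apply: epsilon_spec; exists (jack_symf); exact: jack_symf_spec.
Qed.

End Family.

(** * Row sums *)

Section FR.
Variables (F : fieldType) (al : F).
Hypothesis Hal : forall m r : int, al * m%:~R + r%:~R = 0 -> m = 0 /\ r = 0.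

Definition gbinom (x : F) d : F := \prod_(i < d) (x - i%:R) / (d`!)%:R.
Definition poch d : F := \prod_(j < d) (1 + j%:R * al).

(* The column-distinct sum over the rows [s]: if the lower rows use [m] columns, which
   all lie below the first row [x], then [x - m] columns are left for this row. *)
Fixpoint row_sum (s : seq F) k : F :=
  if s is x :: s' then \sum_(m < k.+1) gbinom (x - m%:R) (k - m) * poch (k - m) * row_sum s' m
  else (k == 0%N)%:R.

Definition newton k (W : F) : F := \prod_(j < k) (W - al * j.+1%:R).

Lemma fact_neq0 d : (d`!)%:R != 0 :> F.
Proof. by have := fact_gt0 d; case: (d`!) => // x _; apply: natr_neq0 Hal x. Qed.

Lemma gbinom0 x : gbinom x 0 = 1.
Proof. by rewrite /gbinom big_ord0 divr1. Qed.

Lemma gbinom_nat (X d : nat) : gbinom X%:R d = ('C(X, d))%:R.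
Proof.
rewrite /gbinom; apply: (mulIf (fact_neq0 d)); rewrite divfK ?fact_neq0 // -natrM bin_ffact ffact_prod natr_prod.
case: (leqP d X) => h.
  by apply: eq_bigr => i _; rewrite natrB //; apply: leq_trans h; apply: ltnW.
rewrite (bigD1 (Ordinal h)) //= subrr mul0r (bigD1 (Ordinal h)) //= subnn mul0r.
by [].
Qed.

Lemma newtonS k W : newton k.+1 W = newton k W * (W - al * k.+1%:R).
Proof. by rewrite /newton big_ord_recr. Qed.

Lemma newtonS_shift k W : newton k.+1 W = (W - al) * newton k (W - al).
Proof.
rewrite /newton big_ord_recl mulr1; congr (_ * _); apply: eq_bigr => j _.
by rewrite lift0 -[j.+2%:R]natr1; ring.
Qed.

Lemma newtonD k m W : newton (m + k) W = newton m W * newton k (W - al * m%:R).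
Proof.
elim: m W => [|m IH] W; first by rewrite /newton big_ord0 mul1r mulr0 subr0.
rewrite addSn !newtonS_shift IH mulrA; congr (_ * newton _ _).
by rewrite -natr1; ring.
Qed.

Lemma newton_add_al k W : W * newton k W = newton k (W + al) * (W - al * k%:R).
Proof.
elim: k => [|k IH]; first by rewrite /newton !big_ord0 mulr0 subr0 mulr1 mul1r.
by rewrite !newtonS mulrA IH -[k.+1%:R]natr1; ring.
Qed.

(** Keeps the denominators W - c and W - al j nonzero, also after W -> W + 1. The positive integers
    are generic, which gives infinitely many values of W. *)
Definition generic W := forall i j : nat, W + i%:R - al * j%:R != 0.

Lemma generic_nat p : generic p.+1%:R.
Proof.
move=> i j; apply/eqP => h; case: (@Hal (- j%:Z) (p.+1 + i)%N) => //.
by rewrite -[RHS]h rmorphN /= !pmulrn PoszD rmorphD /=; ring.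
Qed.

Lemma generic_add1 W : generic W -> generic (W + 1).
Proof. by move=> h i j; have := h i.+1 j; rewrite -nat1r addrA. Qed.

Lemma generic_neq0 W j : generic W -> W - al * j%:R != 0.
Proof. by move=> h; have := h 0%N j; rewrite addr0. Qed.

Lemma newton_neq0 k W : generic W -> newton k W != 0.
Proof. by move=> h; apply/prodf_neq0 => j _; apply: generic_neq0. Qed.

(** The Chu-Vandermonde summation, by induction on X with W replaced by W - al; Pascal's rule splits
    off a telescoping difference. *)
Lemma chu_vandermonde (X D : nat) W : (forall j : nat, W - al * j.+1%:R != 0) -> (X <= D)%N ->
  \sum_(d < D.+1) gbinom X%:R d * poch d / newton d W =
  \prod_(j < X) ((W - al * j.+1%:R + 1) / (W - al * j.+1%:R)).
Proof.
elim: X D W => [|X IH] D W hW hD.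
  rewrite big_ord_recl big_ord0 gbinom0 /poch /newton !big_ord0 !mul1r invr1 big1 ?addr0 // => i _.
  by rewrite gbinom_nat bin0n mul0r mul0r.
case: D hD => // D; rewrite ltnS => hD.
have hW' (j : nat) : W - al - al * j.+1%:R != 0.
  by have := hW j.+1; rewrite -[j.+2%:R]natr1 (_ : W - al * (j.+1%:R + 1) = W - al - al * j.+1%:R) //; ring.
have hB k (V : F) : (forall j : nat, V - al * j.+1%:R != 0) -> newton k V != 0.
  by move=> h; apply/prodf_neq0 => j _.
rewrite (big_ord_recl D.+1) (big_ord_recl X).
have -> : \prod_(i < X) ((W - al * (lift ord0 i).+1%:R + 1) / (W - al * (lift ord0 i).+1%:R)) =
   \prod_(j < X) ((W - al - al * j.+1%:R + 1) / (W - al - al * j.+1%:R)).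
  by apply: eq_bigr => j _; rewrite lift0 -[j.+2%:R]natr1; congr (_ / _); ring.
rewrite -(IH D _ hW' hD).
have e d : gbinom X.+1%:R d.+1 * poch d.+1 / newton d.+1 W = gbinom X%:R d.+1 * poch d.+1 / newton d.+1 W
   - gbinom X%:R d * poch d / newton d W + (W - al * 1 + 1) / (W - al * 1) * (gbinom X%:R d * poch d / newton d (W - al)).
  rewrite !gbinom_nat binS natrD mulrDl mulrDl -addrA; congr (_ + _).
  have h1 := hW d; have h2 := hW 0%N; have h3 := hB d _ hW; have h4 := hB d _ hW'.
  have e1 : newton d.+1 W = newton d W * (W - al * d.+1%:R) by rewrite newtonS.
  have e2 : (W - al) * newton d (W - al) = newton d W * (W - al * d.+1%:R) by rewrite -newtonS_shift newtonS.
  have e3 : (newton d (W - al))^-1 = (W - al) / (newton d W * (W - al * d.+1%:R)).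
    by rewrite -e2 invfM mulrA divff ?mul1r //; rewrite mulr1 in h2.
  rewrite e3 e1 [poch d.+1]big_ord_recr /= -/(poch d) mulr1.
  rewrite mulr1 in h2; move: h1; rewrite -natr1 => h1.
  by field; rewrite h1 h2 h3.
transitivity (gbinom X.+1%:R 0 * poch 0 / newton 0 W + \sum_(i < D.+1) (gbinom X%:R i.+1 * poch i.+1 / newton i.+1 W
   - gbinom X%:R i * poch i / newton i W) + (W - al * 1 + 1) / (W - al * 1) * \sum_(i < D.+1) (gbinom X%:R i * poch i / newton i (W - al))).
  rewrite mulr_sumr -addrA -big_split; congr (_ + _); apply: eq_bigr => i _; exact: e.
rewrite -(big_mkord xpredT (fun i => gbinom X%:R i.+1 * poch i.+1 / newton i.+1 W - gbinom X%:R i * poch i / newton i W)).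
rewrite (telescope_sumr (fun i => gbinom X%:R i * poch i / newton i W)) // (gbinom_nat X D.+1) bin_small ?ltnS //.
by rewrite !gbinom0 !mul0r sub0r subrr add0r.
Qed.

Lemma row_sum_gt (s : seq nat) k : sorted geq s -> (head 0%N s < k)%N ->
  row_sum [seq x%:R | x <- s] k = 0.
Proof.
elim: s k => [|x s IH] k /=; first by case: k.
move=> hs hk; rewrite big1 // => m _.
case: (ltnP x m) => hm.
  rewrite IH ?mulr0 //; first exact: path_sorted hs.
  by apply: leq_ltn_trans hm; case: s hs {IH} => [|y s] //= /andP[].
have -> : x%:R - m%:R = (x - m)%:R :> F by rewrite natrB.
by rewrite gbinom_nat bin_small ?mul0r //; lia.
Qed.

Definition box_ratio W (i j : nat) : F := (W + i%:R - al * j.+1%:R + 1) / (W + i%:R - al * j.+1%:R).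

(** Let m be the number of columns used by the lower rows. The first row then contributes
    [chu_vandermonde] at W - al m, which gives its boxes from column m on. Its first m boxes turn
    [newton m W] into [newton m (W + 1)], as the lower rows need, being one row further down. *)
Lemma row_sum_product (s : seq nat) D W : sorted geq s -> (head 0%N s <= D)%N -> generic W ->
  \sum_(k < D.+1) row_sum [seq x%:R | x <- s] k / newton k W =
  \prod_(i < size s) \prod_(j < nth 0%N s i) box_ratio W i j.
Proof.
elim: s D W => [|x s IH] D W hs hD hW.
  rewrite big_ord0 big_ord_recl /= /newton big_ord0 divr1 big1 ?addr0 // => i _.
  by rewrite mul0r.
have hs' : sorted geq s by apply: path_sorted hs.
have hx : (head 0%N s <= x)%N by case: s hs {IH hs' hD} => [|y s] //= /andP[].
rewrite (big_ord_recl (size s)) /=.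
have -> : \prod_(i < size s) \prod_(j < nth 0%N s i) box_ratio W (lift ord0 i) j =
    \prod_(i < size s) \prod_(j < nth 0%N s i) box_ratio (W + 1) i j.
  apply: eq_bigr => i _; apply: eq_bigr => j _; rewrite /box_ratio lift0 -[i.+1%:R]nat1r.
  by rewrite addrA.
rewrite -(IH D (W + 1)) //; [|by apply: leq_trans hx _|exact: generic_add1].
pose T d m : F := gbinom (x%:R - m%:R) d * poch d * row_sum [seq y%:R | y <- s] m.
have E1 (k : 'I_D.+1) : (\sum_(m < k.+1) gbinom (x%:R - m%:R) (k - m) * poch (k - m) * row_sum [seq y%:R | y <- s] m) / newton k W
   = \sum_(m < D.+1) if (m <= k)%N then T (k - m)%N m / newton k W else 0.
  rewrite mulr_suml (big_ord_widen D.+1 (fun m => T (k - m)%N m / newton k W) (ltn_ord k)) [LHS]big_mkcond.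
  by apply: eq_bigr => m _; rewrite ltnS.
rewrite (eq_bigr _ (fun k _ => E1 k)) exchange_big /= mulr_sumr; apply: eq_bigr => m _.
case: (ltnP x m) => hm.
  rewrite (row_sum_gt hs') ?mul0r ?mulr0; last exact: leq_ltn_trans hm.
  by rewrite big1 // => k _; case: ifP => // _; rewrite /T (row_sum_gt hs') ?mulr0 ?mul0r //; apply: leq_ltn_trans hm.
have hmD := ltn_ord m.
have -> : \sum_(k < D.+1) (if (m <= k)%N then T (k - m)%N m / newton k W else 0) =
    \sum_(d < (D - m).+1) T d m / newton (m + d) W.
  rewrite -(big_mkord xpredT (fun k => if (m <= k)%N then T (k - m)%N m / newton k W else 0)).
  rewrite (big_cat_nat (leq0n m) (ltnW hmD)) /=.
  rewrite big_nat_cond big1 ?add0r => [|k /andP[/andP[_ hk] _]]; last by rewrite leqNgt hk.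
  rewrite -{1}[nat_of_ord m]add0n big_addn big_mkord subSn; last exact: hmD.
  by apply: eq_bigr => d _; rewrite leq_addl addnK addnC.
have E2 (d : 'I_(D - m).+1) : T d m / newton (m + d) W =
   row_sum [seq y%:R | y <- s] m / newton m W * (gbinom (x - m)%:R d * poch d / newton d (W - al * m%:R)).
  rewrite /T newtonD natrB // invfM; set b := gbinom _ _; set p := poch _; set f := row_sum _ _.
  by set u := (newton m W)^-1; set v := (newton d _)^-1; ring.
rewrite (eq_bigr _ (fun d _ => E2 d)) -mulr_sumr chu_vandermonde; [|by move=> j; rewrite -addrA -opprD -mulrDr -natrD; apply: generic_neq0|by rewrite leq_sub2r].
have -> : newton m (W + 1) = \prod_(j < m) (W - al * j.+1%:R + 1).
  by apply: eq_bigr => j _; ring.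
have -> : \prod_(j < x) box_ratio W 0 j = \prod_(j < m) ((W - al * j.+1%:R + 1) / (W - al * j.+1%:R)) *
    \prod_(j < x - m) ((W - al * m%:R - al * j.+1%:R + 1) / (W - al * m%:R - al * j.+1%:R)).
  rewrite -(big_mkord xpredT (box_ratio W 0)) (big_cat_nat (n := m)) //= big_mkord; congr (_ * _).
    by apply: eq_bigr => j _; rewrite /box_ratio addr0.
  rewrite -{1}[nat_of_ord m]add0n big_addn big_mkord; apply: eq_bigr => j _.
  by rewrite /box_ratio addr0 -addSn natrD; congr (_ / _); ring.
set R := \prod_(j < x - m) _; rewrite prodf_div -/(newton m W).
have n1 := newton_neq0 m hW; have n2 : \prod_(j < m) (W - al * j.+1%:R + 1) != 0.
  apply/prodf_neq0 => j _; have := generic_neq0 j.+1 (generic_add1 hW).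
  by rewrite (_ : W + 1 - al * j.+1%:R = W - al * j.+1%:R + 1) //; ring.
by field; rewrite n1 n2.
Qed.

(** Multiplied by [newton n W], the sum is the polynomial P n, which has infinitely many roots.
    Evaluation at al n, al (n - 1), ... then peels off the coefficients one by one. *)
Lemma newton_indep n (g : nat -> F) :
  (forall p : nat, \sum_(k < n.+1) g k / newton k p.+1%:R = 0) -> forall k, (k <= n)%N -> g k = 0.
Proof.
move=> hg.
pose P := fix P (n : nat) : {poly F} := if n is m.+1 then (g n)%:P + ('X - (al * n%:R)%:P) * P m else (g 0%N)%:P.
have PE m W : generic W -> (P m).[W] = newton m W * \sum_(k < m.+1) g k / newton k W.
  move=> hW; elim: m => [|m IH]; first by rewrite big_ord_recl big_ord0 /newton !big_ord0 hornerC divr1 addr0 mul1r.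
  have h : newton m W * (W - al * m.+1%:R) != 0 by rewrite -newtonS; apply: newton_neq0.
  rewrite big_ord_recr /= hornerD hornerM hornerC hornerXsubC IH newtonS.
  by rewrite mulrDr [X in _ = _ + X]mulrC divfK // [LHS]addrC; congr (_ + _); ring.
have P0 : P n = 0.
  apply/eqP; apply: contraT => h; have := max_poly_roots h (rs := [seq p.+1%:R | p <- iota 0 (size (P n))]).
  rewrite size_map size_iota ltnn => ->//.
    apply/allP => _ /mapP[p _ ->]; rewrite /root PE ?hg ?mulr0 //; exact: generic_nat.
  rewrite map_inj_uniq ?iota_uniq // => p q /eqP; rewrite -subr_eq0 => /eqP e.
  case: (@Hal 0 (p%:Z - q%:Z)); last by lia.
  by rewrite -[RHS]e rmorphB /= -!pmulrn -!natr1; ring.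
have step m : P m.+1 = 0 -> g m.+1 = 0 /\ P m = 0.
  move=> h; have h1 := congr1 (horner^~ (al * m.+1%:R)) h.
  move: h1; rewrite /= !hornerE subrr mul0r addr0 => h1; split=> //.
  move: h; rewrite /= h1 add0r => /eqP; rewrite mulf_eq0 polyXsubC_eq0 => /eqP//.
move=> k; elim: n P0 {hg} => [|n IH] h.
  by rewrite leqn0 => /eqP->; have := congr1 (fun p : {poly F} => p`_0) h; rewrite /= coefC coef0.
by have [h1 h2] := step _ h; rewrite leq_eqVlt => /orP[/eqP->//|]; rewrite ltnS; apply: IH.
Qed.

End FR.

(** * The recursion of the column-distinct sums *)

Section KO.
Variables (F : fieldType) (al : F).
Hypothesis Hal : forall m r : int, al * m%:~R + r%:~R = 0 -> m = 0 /\ r = 0.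
Variable N : nat.
Implicit Types (la : nat -> nat) (i j m k n : nat).

Local Notation zrow := (zrow al).
Local Notation coe := (coe al N).
Local Notation young := (young N).
Local Notation ysize := (ysize N).
Local Notation removable := (removable N).
Local Notation newton := (newton al).
Local Notation box_ratio := (box_ratio al).

Definition young_sum la k : F := row_sum al [seq x%:R | x <- mkseq la N] k.

Lemma generic_add_al p : generic al (p.+1%:R + al).
Proof.
move=> i j; apply/eqP => h; case: (@Hal (1 - j%:Z) (p.+1 + i)%N) => //.
by rewrite -[RHS]h rmorphB /= !pmulrn PoszD rmorphD /=; ring.
Qed.

Lemma young_sum_product la D W : young la -> (la 0%N <= D)%N -> generic al W ->
  \sum_(k < D.+1) young_sum la k / newton k W = \prod_(i < N) \prod_(j < la i) box_ratio W i j.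
Proof.
move=> hp hD hW; rewrite /young_sum row_sum_product ?size_mkseq //.
- by apply: eq_bigr => i _; rewrite nth_mkseq.
- apply: (homo_sorted (e := ltn)); last exact: iota_ltn_sorted.
  by move=> i j /ltnW; apply: young_mono hp.
- by case: N.
Qed.

Lemma row_shift W i x : generic al W -> generic al (W + al) ->
  \prod_(j < x) box_ratio (W + al) i j =
  (\prod_(j < x) box_ratio W i j) * ((W + i%:R + 1) / (W + i%:R)) *
  ((W + i%:R - al * x%:R) / (W + i%:R - al * x%:R + 1)).
Proof.
move=> hW hW'; have a1 x' : W + i%:R - al * x'%:R != 0 by exact: hW.
have a2 x' : W + i%:R - al * x'%:R + 1 != 0.
  by have := hW i.+1 x'; rewrite -natr1; congr (_ != 0); ring.
elim: x => [|x IH].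
  rewrite !big_ord0 mulr0 subr0; have := a1 0%N; have := a2 0%N; rewrite mulr0 subr0 => h1 h2.
  by field; rewrite h1 h2.
rewrite !big_ord_recr /= {}IH /box_ratio; have := a1 x; have := a2 x; have := a1 x.+1; have := a2 x.+1.
set p := \prod_(j < x) _; have := a1 0%N; rewrite mulr0 subr0.
have -> : W + al + i%:R - al * x.+1%:R = W + i%:R - al * x%:R by rewrite -natr1; ring.
by rewrite -natr1 => h0 h1 h2 h3 h4; field; rewrite ?h0 ?h1 ?h2 ?h3 ?h4.
Qed.

(** Shifting W by al moves each factor by one box along its row, so the quotient of each row
    telescopes to its ends ([row_shift]). The left ends (W + i + 1) / (W + i) telescope in turn to
    (W + N) / W. *)
Lemma product_shift la W : young la -> generic al W -> generic al (W + al) ->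
  W * \prod_(i < N) \prod_(j < la i) box_ratio (W + al) i j =
  (\prod_(i < N) \prod_(j < la i) box_ratio W i j) * ((W + N%:R) *
   \prod_(i < N) ((W - zrow la i) / (W - zrow la i + 1))).
Proof.
move=> hp hW hW'.
have e (i : 'I_N) : \prod_(j < la i) box_ratio (W + al) i j = (\prod_(j < la i) box_ratio W i j) *
   (((W + i.+1%:R) / (W + i%:R)) * ((W - zrow la i) / (W - zrow la i + 1))).
  by rewrite row_shift // -!mulrA -natr1 addrA /zrow opprB [in RHS]addrA [_ + i%:R - _ in RHS](_ : _ = W + i%:R - al * (la i)%:R).
rewrite (eq_bigr _ (fun (i : 'I_N) _ => e i)) big_split /= [X in W * (_ * X)]big_split /=.
have -> : \prod_(i < N) ((W + i.+1%:R) / (W + i%:R)) = (W + N%:R) / W.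
  have a i : W + i%:R != 0 by have := hW i 0%N; rewrite mulr0 subr0.
  elim: N => [|n IH]; first by rewrite big_ord0 addr0 divff //; have := a 0%N; rewrite addr0.
  rewrite big_ord_recr /= IH; have := a 0%N; rewrite addr0 => h0; have h1 := a n.
  by field; rewrite h1 h0.
have h0 : W != 0 by have := hW 0%N 0%N; rewrite mulr0 subr0 addr0.
set A := \prod_(i < N) _; set B := \prod_(i < N) _; by field.
Qed.

Lemma product_rem la W m : young la -> removable la m -> generic al W ->
  \prod_(i < N) \prod_(j < rbox la m i) box_ratio W i j =
  (\prod_(i < N) \prod_(j < la i) box_ratio W i j) * (1 - (W - zrow la m + 1)^-1).
Proof.
move=> hp hm hW; have /andP[hmN hr] := hm.
rewrite (bigD1 (Ordinal hmN)) //= [in RHS](bigD1 (Ordinal hmN)) //= rbox_at.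
have -> : \prod_(i < N | i != Ordinal hmN) \prod_(j < rbox la m i) box_ratio W i j =
   \prod_(i < N | i != Ordinal hmN) \prod_(j < la i) box_ratio W i j.
  by apply: eq_bigr => i hi; rewrite rbox_ne.
set R := \prod_(i < N | _) _; case E : (la m) hr => [//|x] _ /=.
rewrite big_ord_recr /= /box_ratio /zrow E opprB (addrA W).
have a1 : W + m%:R - al * x.+1%:R != 0 by exact: hW.
have a2 : W + m%:R - al * x.+1%:R + 1 != 0.
  by have := hW m.+1 x.+1; rewrite -[m.+1%:R]natr1; congr (_ != 0); ring.
move: a1 a2; rewrite -natr1 => a1 a2; set P := \prod_(j < x) _; field.
by rewrite ?a1 ?a2.
Qed.

Lemma shift_term (V B f k : F) : B != 0 -> V - al * k != 0 -> V != 0 ->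
  al * (k * f / B) = V * (f / B) - V * (f / (V * B / (V - al * k))).
Proof. by move=> h1 h2 h3; field; rewrite h1 h2 h3. Qed.

(* With Psi(W) the product of [young_sum_product] and Q as for [resid], this follows
   from Q(W) Psi(W) = W Psi(W + al) and the partial fractions of Q, comparing the
   coefficients of the [newton k W]^-1. *)
Lemma young_sum_rec la n k : young la -> ysize la = n -> (k <= n)%N ->
  \sum_(i < N) coe la i * young_sum (rbox la i) k = (n%:R - k%:R) * young_sum la k.
Proof.
move=> hp hn hk; apply/eqP; rewrite -subr_eq0; apply/eqP.
pose g k := \sum_(i < N) coe la i * young_sum (rbox la i) k - (n%:R - k%:R) * young_sum la k.
rewrite -/(g k); apply: (newton_indep Hal (n := n)) hk => p {k}.
set W : F := p.+1%:R; have hW : generic al W by exact: generic_nat.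
have hW' : generic al (W + al) by exact: generic_add_al.
have hD : (la 0%N <= n)%N.
  case: (posnP N) => hN; first by case: hp => _; rewrite hN => ->.
  by rewrite -hn /ysize (bigD1 (Ordinal hN)) //= leq_addr.
have hz i : W - zrow la i + 1 != 0.
  by have := hW i.+1 (la i); rewrite -[i.+1%:R]natr1 /zrow; congr (_ != 0); ring.
pose Psi := \prod_(i < N) \prod_(j < la i) box_ratio W i j.
have S1 : \sum_(k < n.+1) (\sum_(i < N) coe la i * young_sum (rbox la i) k) / newton k W =
   Psi * \sum_(i < N) (coe la i - coe la i / (W - zrow la i + 1)).
  under eq_bigr => k _ do rewrite mulr_suml.
  rewrite exchange_big mulr_sumr; apply: eq_bigr => i _.
  under eq_bigr => k _ do rewrite -mulrA.
  rewrite -mulr_sumr; case: (eqVneq (coe la i) 0) => [->|hc]; first by rewrite !mul0r subr0 mulr0.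
  have hi := coe_neq0_removable hp (ltn_ord i) hc.
  rewrite young_sum_product ?product_rem //; first by rewrite -/Psi; ring.
    exact: young_rem.
  by apply: leq_trans hD; rewrite /rbox leq_subr.
(* By [newton_add_al], W / [newton k (W + al)] is (W - al k) / [newton k W]: the shift brings in the
   factor k. *)
have S2 : al * \sum_(k < n.+1) k%:R * young_sum la k / newton k W =
   Psi * \sum_(i < N) al * coe la i / (W - zrow la i + 1).
  have Q := coe_genfun Hal (fun i : 'I_N => hz i).
  have := product_shift hp hW hW'; rewrite -Q -/Psi -(young_sum_product (D := n)) // => E.
  have -> : Psi * \sum_(i < N) al * coe la i / (W - zrow la i + 1) = W * Psi - W * \sum_(k < n.+1) young_sum la k / newton k (W + al).
    by rewrite E; ring.
  rewrite [Psi](esym (young_sum_product hp hD hW)) !mulr_sumr -sumrB; apply: eq_bigr => k _.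
  have h1 := newton_neq0 k hW'; have h2 := newton_add_al al k W; have h3 := newton_neq0 k hW.
  have h4 : W - al * k%:R != 0 by have := hW 0%N k; rewrite addr0.
  have h5 : newton k (W + al) = W * newton k W / (W - al * k%:R) by rewrite h2 mulfK.
  have h6 : W != 0 by have := hW 0%N 0%N; rewrite mulr0 subr0 addr0.
  by rewrite h5; exact: shift_term.
have e k : g k / newton k W = (\sum_(i < N) coe la i * young_sum (rbox la i) k) / newton k W -
   n%:R * (young_sum la k / newton k W) + k%:R * young_sum la k / newton k W by rewrite /g; ring.
rewrite (eq_bigr _ (fun (k : 'I_n.+1) _ => e k)) big_split sumrB /= S1 -mulr_sumr young_sum_product // -/Psi.
apply: (mulfI (al_neq0 Hal)); rewrite mulr0 mulrDr S2 sumrB sum_coe // hn.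
have E3 : \sum_(i < N) al * coe la i / (W - zrow la i + 1) = al * \sum_(i < N) (coe la i / (W - zrow la i + 1)).
  by rewrite mulr_sumr; apply: eq_bigr => i _; rewrite mulrA.
rewrite E3.
by ring.
Qed.

Lemma poch0 : poch al 0 = 1.
Proof. by rewrite /poch big_ord0. Qed.

Lemma row_sum_zeros p k : row_sum al (nseq p 0) k = (k == 0%N)%:R.
Proof.
elim: p k => [//|p IH] k /=; rewrite big_ord_recr /= subnn gbinom0 poch0 !mul1r IH.
rewrite big1 ?add0r // => m _; rewrite IH; case: eqP => [->|]; last by rewrite mulr0.
by rewrite subr0 subn0 -[0]/(0%:R) (gbinom_nat Hal) bin0n; case: k m => [[]//|k] m; rewrite !mul0r.
Qed.

(** By dominance both sides vanish or la = (k); then the coefficient is the hook product of a single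
    row, which is [poch al k]. *)
Lemma mono_coef_one_row la k : young la -> ysize la = k -> (0 < k)%N -> mono_coef [:: k] (jackF al N k la) = young_sum la k.
Proof.
move=> hp hk hk0; case: (ltnP (la 0%N) k) => h0.
  rewrite /young_sum row_sum_gt //.
  - apply/eqP; apply: contraTT h0 => h; rewrite -leqNgt.
    have := mono_coef_jackF_dominated Hal hp hk (mu := [:: k]) _ h (la 0%N); rewrite /= addn0 => /(_ erefl).
    rewrite /excess big_seq1 /yexcess big1 => [|i _]; last by apply/eqP; rewrite subn_eq0 (young_mono hp).
    by rewrite leqn0 subn_eq0.
  - apply: (homo_sorted (e := ltn)); last exact: iota_ltn_sorted.
    by move=> i j /ltnW; apply: young_mono hp.
  - by case: (N).
have hN : (0 < N)%N by case: (posnP N) hk => // e; rewrite /ysize e big_ord0; lia.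
have [h1 h2] : la 0%N = k /\ forall i : 'I_N, i != Ordinal hN -> la i = 0%N.
  have := hk; rewrite /ysize (bigD1 (Ordinal hN)) //= => e.
  have e0 : (\sum_(i < N | i != Ordinal hN) la i = 0)%N.
    by move: e; set S := (\sum_(i < N | _) _)%N; move: S => S; lia.
  split; first by rewrite e0 addn0 in e.
  by move=> i hi; apply/eqP; move/eqP: e0; rewrite sum_nat_eq0 => /forall_inP; apply.
have E : mkseq la N = k :: nseq N.-1 0%N.
  apply: (@eq_from_nth _ 0%N) => [|i]; first by rewrite size_mkseq /= size_nseq prednK.
  rewrite size_mkseq => hi; rewrite nth_mkseq //; case: i hi => [//|i] hi.
  by rewrite (h2 (Ordinal hi)) //= nth_nseq if_same.
have := mono_coef_jackF_diag Hal hp hk; rewrite {1}E -cat1s mono_coef_nseq0 => ->.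
rewrite /young_sum E /= map_nseq.
rewrite big_ord_recl /= subn0 subr0 (gbinom_nat Hal) binn mul1r row_sum_zeros mulr1 big1 ?addr0 => [|m _]; last first.
  by rewrite row_sum_zeros mulr0.
rewrite /yhook (bigD1 (Ordinal hN)) //= [X in _ * X]big1 ?mulr1 => [|i hi]; last by rewrite h2 // big_ord0.
rewrite h1 /poch (reindex_inj rev_ord_inj) /=; apply: eq_bigr => j _; rewrite /hook_factor h1.
have hj := ltn_ord j.
have -> : (k - (k - j.+1) - 1)%N = j by lia.
have -> : col_len N la (k - j.+1) = 1%N.
  rewrite /col_len (bigD1 (Ordinal hN)) //= h1 big1 => [|i hi]; last by rewrite h2.
  by rewrite addn0; case: ltnP => //; lia.
by rewrite subn0 subnn; ring.
Qed.

(** As h_1 = p_1, the coefficient at (k, 1^(m+1)) is that of d_1 J_la at (k, 1^m). The factor n - k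
    of [young_sum_rec] is m + 1 here and builds up the factorial. *)
Lemma mono_coef_hook_shape la k m : young la -> ysize la = (k + m)%N -> (0 < k)%N ->
  mono_coef (k :: nseq m 1%N) (jackF al N (k + m) la) = (m`!)%:R * young_sum la k.
Proof.
elim: m la => [|m IH] la hp hn hk.
  by rewrite addn0 in hn *; rewrite mul1r; apply: mono_coef_one_row.
have hJ := jackF_sym Hal hp hn.
have hperm : perm_eq (k :: nseq m.+1 1%N) (1%N :: k :: nseq m 1%N).
  by rewrite -[k :: _]/([:: k] ++ [:: 1%N] ++ nseq m 1%N) perm_catCA.
rewrite (mono_coef_perm (natr_neq0 Hal) hJ hperm) -[LHS]/(mono_coef (k :: nseq m 1%N) (hperp 1 (jackF al N (k + m.+1) la))) hperp1.
rewrite addnS in hn *.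
rewrite jack_d0 // (lin_comb _ _ (mono_coef_linear (natr_neq0 Hal) _)).
have := young_sum_rec hp hn (k := k); rewrite -addnS leq_addr => /(_ isT).
rewrite natrD addrC addKr => E.
rewrite factS natrM mulrAC -E mulr_suml; apply: eq_bigr => i _.
case: (eqVneq (coe la i) 0) => [->|hc]; first by rewrite scale0r !mul0r.
have hi := coe_neq0_removable hp (ltn_ord i) hc.
rewrite IH //; first by rewrite -[LHS]/(coe la i * ((m`!)%:R * young_sum (rbox la i) k)); ring.
  exact: young_rem.
by move: hn; rewrite (ysize_rem hi) => -[].
Qed.


End KO.

(** * Shifted symmetry *)

Section Univariate.
Variable F : fieldType.
Hypothesis Fc : forall n, n.+1%:R != 0 :> F.

Definition polyf (f : F -> F) := exists p : {poly F}, forall x, f x = p.[x].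

Lemma polyf_cst a : polyf (fun=> a).
Proof. by exists a%:P => x; rewrite hornerC. Qed.

Lemma polyf_id : polyf id.
Proof. by exists 'X => x; rewrite hornerX. Qed.

Lemma polyfD f g : polyf f -> polyf g -> polyf (fun x => f x + g x).
Proof. by move=> [p hp] [q hq]; exists (p + q) => x; rewrite hornerD hp hq. Qed.

Lemma polyfM f g : polyf f -> polyf g -> polyf (fun x => f x * g x).
Proof. by move=> [p hp] [q hq]; exists (p * q) => x; rewrite hornerM hp hq. Qed.

Lemma polyfB f g : polyf f -> polyf g -> polyf (fun x => f x - g x).
Proof. by move=> [p hp] [q hq]; exists (p - q) => x; rewrite hornerD hornerN hp hq. Qed.

Lemma natr_inj_char0 : injective (fun n : nat => n%:R : F).
Proof.
have key (m n : nat) : (m < n)%N -> m%:R <> n%:R :> F.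
  move=> h e; case/eqP: (Fc (n - m).-1); rewrite prednK ?subn_gt0 // natrB 1?ltnW //.
  by rewrite -e subrr.
by move=> m n e; case: (ltngtP m n) => // /key []; rewrite e.
Qed.

Lemma polyf_inj (f : F -> F) (h : nat -> F) : injective h -> polyf f ->
  (forall n, f (h n) = 0) -> forall x, f x = 0.
Proof.
move=> hh [p hp] hz x; rewrite hp; suff -> : p = 0 by rewrite horner0.
apply/eqP; apply: contraT => hne.
have := max_poly_roots hne (rs := [seq h n | n <- iota 0 (size p)]).
rewrite size_map size_iota ltnn map_inj_uniq ?iota_uniq // => -> //.
by apply/allP => _ /mapP[n _ ->]; rewrite /root -hp hz.
Qed.

Lemma polyf_nat (f : F -> F) m : polyf f -> (forall n, (m <= n)%N -> f n%:R = 0) ->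
  forall x, f x = 0.
Proof.
move=> hf hz; apply: (@polyf_inj f (fun n => (m + n)%:R)) => //; last by move=> n; apply: hz; apply: leq_addr.
by move=> i j /natr_inj_char0; apply: addnI.
Qed.

End Univariate.

Section TwoRows.
Variables (F : fieldType) (al : F).
Hypothesis Hal : forall m r : int, al * m%:~R + r%:~R = 0 -> m = 0 /\ r = 0.
Implicit Types (x y A B W : F) (k n : nat).
Let Fc n : n.+1%:R != 0 :> F. Proof. exact: natr_neq0 Hal n. Qed.
Local Notation newton := (newton al).
Local Notation row_sum := (row_sum al).

(** With V = W - al k, the polynomial V (W - A + 1) (W - B + 1) - (W + 2) (W - A) (W - B) equals -
    al k V^2 + [rec_coef1] V - [rec_coef0]. *)
Definition rec_coef1 A B k : F := 1 - (al * k%:R + 1) * (al * k%:R - A + (al * k%:R - B)) .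
Definition rec_coef0 A B k : F := (al * k%:R + 2%:R) * (al * k%:R - A) * (al * k%:R - B).

Lemma row_sum0 s : row_sum s 0 = 1.
Proof. by elim: s => [//|x s IH] /=; rewrite big_ord_recl big_ord0 /= gbinom0 poch0 IH !mul1r addr0. Qed.

Lemma gbinom1 x : gbinom x 1 = x.
Proof. by rewrite /gbinom big_ord_recl big_ord0 subr0 mulr1 divr1. Qed.

Lemma row_sum1 s : row_sum s 1 = \sum_(x <- s) x.
Proof.
elim: s => [|x s IH] /=; first by rewrite big_nil.
rewrite big_cons !big_ord_recl big_ord0 /= subr0 gbinom1 gbinom0 IH row_sum0 poch0.
by rewrite /poch big_ord_recl big_ord0 /=; ring.
Qed.

(* Q(W) Psi(W) = W Psi(W + al) for two rows; the coefficients of this recurrence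
   are symmetric in [A] and [B]. *)
Lemma two_rows_nat (X Y : nat) k : (Y <= X)%N ->
  let A := al * X%:R in let B := al * Y%:R - 1 in let u := row_sum [:: X%:R; Y%:R] in
  al * k.+2%:R * u k.+2 = (rec_coef1 A B k.+1 + al ^+ 2 * k.+1%:R) * u k.+1 - rec_coef0 A B k * u k.
Proof.
move=> hYX A B u; apply/eqP; rewrite eq_sym -subr_eq0; apply/eqP.
pose g k := (rec_coef1 A B k.+1 + al ^+ 2 * k.+1%:R) * u k.+1 - rec_coef0 A B k * u k - al * k.+2%:R * u k.+2.
rewrite -/(g k); pose n := maxn X k; apply: (newton_indep Hal (n := n)) (leq_maxr _ _) => p.
set W : F := p.+1%:R; have hW : generic al W by exact: generic_nat.
have hW' : generic al (W + al) by exact: generic_add_al.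
pose V k := W - al * k%:R.
(* The contribution of u_k to W Psi(W + al) - Q(W) Psi(W), multiplied by (W - A + 1) (W - B + 1). *)
pose T k := u k / newton k W * (- al * k%:R * V k ^+ 2 + rec_coef1 A B k * V k - rec_coef0 A B k).
have V0 j : V j != 0 by have := hW 0%N j; rewrite addr0.
have u0 j : (X < j)%N -> u j = 0.
  by move=> h; apply: (@row_sum_gt F al Hal [:: X; Y]); rewrite //= hYX.
pose bd n := (- al * n.+1%:R * V n.+1 ^+ 2 + rec_coef1 A B n.+1 * V n.+1) * u n.+1 / newton n.+1 W
   - al * n.+2%:R * u n.+2 / newton n W.
(* Since V_k / newton_k = 1 / newton_(k-1) and V_k = V_(k-1) - al, the terms of [T] move to the
   indices k - 2, k - 1 and k; [bd] is what remains at the upper end. Nothing remains at the lower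
   end because u_0 = 1 and u_1 = X + Y. *)
have tele m : \sum_(j < m.+1) g j / newton j W = \sum_(j < m.+1) T j + bd m.
  elim: m => [|m IH].
    rewrite !big_ord_recl !big_ord0 /= !addr0 /g /T /bd /newton big_ord0 big_ord_recl big_ord0.
    rewrite -!/(V _) /rec_coef1 /rec_coef0 [u 0%N]row_sum0 [u 1%N]row_sum1 !big_cons big_nil.
    have h1 : W - al != 0 by have := V0 1%N; rewrite /V mulr1.
    have -> : V 1%N = W - al by rewrite /V mulr1.
    have -> : V 0%N = W by rewrite /V mulr0 subr0.
    clear -h1; clearbody W; rewrite !mulr0 !mulr1 ?mul0r.
    by move: (u 2%N) => u2; rewrite /A /B; field; rewrite oner_neq0 h1.
  rewrite big_ord_recr [in RHS]big_ord_recr /= IH /g /T /bd !newtonS -!/(V _).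
  have := V0 m.+1; have := V0 m.+2; have := newton_neq0 m hW.
  move: (V0 m.+1) (V0 m.+2); have -> : V m.+2 = V m.+1 - al by rewrite /V -[m.+2%:R]natr1; ring.
  rewrite /rec_coef0 /rec_coef1 -[m.+3%:R]natr1 -[m.+2%:R]natr1.
  move: (V m.+1) (newton m W) (u m.+1) (u m.+2) (u m.+3) (\sum_(i < _) _) => v b u1 u2 u3 S.
  move: m.+1%:R => M h1 h2 h3 _ _; field.
  by rewrite h1 h2 h3.
rewrite tele /bd !u0 ?ltnS ?leq_maxl // 1?ltnW ?ltnS ?leq_maxl //.
rewrite !mulr0 !mul0r subrr addr0.
pose la i := if i is 0 then X else if i is 1 then Y else 0%N.
have hp : young 2 la by split=> // -[|[|i]].
have hD : (la 0%N <= n)%N by exact: leq_maxl.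
have E := product_shift hp hW hW'.
rewrite -(young_sum_product Hal hp hD hW) -(young_sum_product Hal hp hD hW') in E.
have hA : W - A + 1 != 0.
  by have := hW 1%N X; congr (_ != 0); rewrite /A; ring.
have hB : W - B + 1 != 0.
  by have := hW 2%N Y; congr (_ != 0); rewrite /B -[2%:R]natr1; ring.
have zA : zrow al la 0 = A by rewrite /zrow subr0.
have zB : zrow al la 1 = B by [].
have EP : \prod_(i < 2) ((W - zrow al la i) / (W - zrow al la i + 1)) =
    (W - A) / (W - A + 1) * ((W - B) / (W - B + 1)).
  by rewrite !big_ord_recl big_ord0 mulr1 /= zA zB.
rewrite EP in E.
transitivity ((W - A + 1) * (W - B + 1) * (W * (\sum_(k0 < n.+1) young_sum al 2 la k0 / newton k0 (W + al))
  - (\sum_(k0 < n.+1) young_sum al 2 la k0 / newton k0 W) * ((W + 2%:R) * ((W - A) / (W - A + 1) * ((W - B) / (W - B + 1)))))); last first.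
  by rewrite E subrr mulr0.
rewrite [W * _]mulr_sumr [X in _ = _ * (_ - X)]mulr_suml -sumrB [RHS]mulr_sumr; apply: eq_bigr => j _.
rewrite -[young_sum al 2 la j]/(u j) /T.
have h1 := newton_neq0 j hW'; have h2 := newton_add_al al j W; have h3 := newton_neq0 j hW.
have h5 : newton j (W + al) = W * newton j W / (W - al * j%:R) by rewrite h2 mulfK // V0.
have h6 : W != 0 by have := hW 0%N 0%N; rewrite mulr0 subr0 addr0.
rewrite h5 /rec_coef0 /rec_coef1 /V; have := V0 j; rewrite /V; clear -hA hB h3 h6 => h4.
move: (u j) (newton j W) h3 => v b hb; move: (nat_of_ord j)%:R h4 => J h4.
clearbody W A B; field.
by rewrite h4 h6 hb hA hB.
Qed.

Section Graded.
(** To be read as: f is polynomial of degree at most d. It is used for functions of N variables and,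
    with the degree ignored, for functions of one variable. *)
Variables (T : Type) (P : nat -> (T -> F) -> Prop).
Hypothesis P_cst : forall a, P 0 (fun=> a).
Hypothesis P_le : forall d e f, (d <= e)%N -> P d f -> P e f.
Hypothesis P_add : forall d f g, P d f -> P d g -> P d (fun t => f t + g t).
Hypothesis P_mul : forall d e f g, P d f -> P e g -> P (d + e) (fun t => f t * g t).

Lemma graded_sum d n (f : 'I_n -> T -> F) : (forall i, P d (f i)) -> P d (fun t => \sum_(i < n) f i t).
Proof.
elim: n f => [|n IH] f h.
  have -> : (fun t => \sum_(i < 0) f i t) = (fun=> 0) by apply/funext => t; rewrite big_ord0.
  exact: P_le (P_cst 0).
have -> : (fun t => \sum_(i < n.+1) f i t) = (fun t => \sum_(i < n) f (widen_ord (leqnSn n) i) t + f ord_max t).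
  by apply/funext => t; rewrite big_ord_recr.
by apply: P_add => //; apply: IH.
Qed.

Lemma graded_prod d n (f : 'I_n -> T -> F) : (forall i, P d (f i)) -> P (n * d) (fun t => \prod_(i < n) f i t).
Proof.
elim: n f => [|n IH] f h.
  have -> : (fun t => \prod_(i < 0) f i t) = (fun=> 1) by apply/funext => t; rewrite big_ord0.
  exact: P_cst.
have -> : (fun t => \prod_(i < n.+1) f i t) = (fun t => f ord_max t * \prod_(i < n) f (widen_ord (leqnSn n) i) t).
  by apply/funext => t; rewrite big_ord_recr mulrC.
by rewrite mulSn; apply: P_mul => //; apply: IH.
Qed.

Lemma graded_gbinom f a d : P 1 f -> P d (fun t => gbinom (f t - a) d).
Proof.
move=> hf; rewrite -[d]addn0 /gbinom; apply: P_mul; last exact: P_cst.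
rewrite -[X in P X]muln1 addn0; apply: graded_prod => i.
have -> : (fun t => f t - a - i%:R) = (fun t => f t + (- a - i%:R)) by apply/funext => t; rewrite addrA.
by apply: P_add => //; apply: P_le (P_cst _).
Qed.

Lemma graded_row_sum n (f : nat -> T -> F) k : (forall i, (i < n)%N -> P 1 (f i)) ->
  P k (fun t => row_sum (mkseq (f^~ t) n) k).
Proof.
elim: n f k => [|n IH] f k h; first by apply: P_le (P_cst _).
have -> : (fun t => row_sum (mkseq (f^~ t) n.+1) k) = (fun t => \sum_(m < k.+1)
    gbinom (f 0%N t - m%:R) (k - m) * poch al (k - m) * row_sum (mkseq (fun i => f i.+1 t) n) m).
  apply/funext => t; rewrite [mkseq _ n.+1](_ : _ = f 0%N t :: mkseq (fun i => f i.+1 t) n) //.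
  by rewrite /mkseq /= -[1%N]addn0 iotaDl -map_comp.
apply: graded_sum => m; rewrite -{1}(subnK (ltnSE (ltn_ord m))).
apply: P_mul; last by apply: IH => i hi; apply: h.
by rewrite -[X in P X]addn0; apply: P_mul => //; apply: graded_gbinom; apply: h.
Qed.

End Graded.

Lemma polyf_row_sum n (f : nat -> F -> F) k : (forall i, (i < n)%N -> polyf (f i)) ->
  polyf (fun t => row_sum (mkseq (f^~ t) n) k).
Proof.
move=> h; apply: (@graded_row_sum F (fun=> @polyf F)) => //.
- exact: polyf_cst.
- by move=> _; apply: polyfD.
- by move=> _ _; apply: polyfM.
Qed.

(** A polynomial identity known at the natural numbers Y <= X; it is extended in X for each natural
    Y, and then in Y. *)
Lemma two_rows_rec X Y k :
  let A := al * X in let B := al * Y - 1 in let u := row_sum [:: X; Y] in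
  al * k.+2%:R * u k.+2 = (rec_coef1 A B k.+1 + al ^+ 2 * k.+1%:R) * u k.+1 - rec_coef0 A B k * u k.
Proof.
pose G X Y := al * k.+2%:R * row_sum [:: X; Y] k.+2 - ((rec_coef1 (al * X) (al * Y - 1) k.+1 +
  al ^+ 2 * k.+1%:R) * row_sum [:: X; Y] k.+1 - rec_coef0 (al * X) (al * Y - 1) k * row_sum [:: X; Y] k).
suff h : G X Y = 0 by apply/eqP; rewrite -subr_eq0; apply/eqP.
have pG1 y : polyf (G^~ y).
  have pF j : polyf (fun x => row_sum [:: x; y] j).
    apply: (@polyf_row_sum 2 (fun i x => if i == 0%N then x else y)) => -[|[|//]] _ /=.
      exact: polyf_id.
    exact: polyf_cst.
  rewrite /G /rec_coef1 /rec_coef0.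
  by do ![apply: polyfB|apply: polyfD|apply: polyfM|apply: pF|apply: polyf_id|apply: polyf_cst].
have pG2 x : polyf (G x).
  have pF j : polyf (fun y => row_sum [:: x; y] j).
    apply: (@polyf_row_sum 2 (fun i y => if i == 0%N then x else y)) => -[|[|//]] _ /=.
      exact: polyf_cst.
    exact: polyf_id.
  rewrite /G /rec_coef1 /rec_coef0.
  by do ![apply: polyfB|apply: polyfD|apply: polyfM|apply: pF|apply: polyf_id|apply: polyf_cst].
apply: (polyf_nat Fc (m := 0) (pG2 X)) => y _ {Y}.
apply: (polyf_nat Fc (m := y) (pG1 y%:R)) => x hx {X}.
by rewrite /G two_rows_nat // subrr.
Qed.

(** The substitution exchanges A = al X and B = al Y - 1, so both sides have the same recurrence and
    the same first two values. *)
Lemma two_rows_swap X Y k : row_sum [:: X; Y] k = row_sum [:: Y - al^-1; X + al^-1] k.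
Proof.
have ha := al_neq0 Hal.
elim/ltn_ind: k => -[|[|k]] IH; first by rewrite !row_sum0.
  by rewrite !row_sum1 !big_cons !big_nil; ring.
have hk : al * k.+2%:R != 0 by rewrite mulf_neq0.
apply: (mulfI hk); rewrite !two_rows_rec !IH //.
have -> : al * (Y - al^-1) = al * Y - 1 by rewrite mulrBr divff.
have -> : al * (X + al^-1) - 1 = al * X by rewrite mulrDr divff // addrK.
have E1 A B j : rec_coef1 A B j = rec_coef1 B A j by rewrite /rec_coef1; ring.
have E0 A B j : rec_coef0 A B j = rec_coef0 B A j by rewrite /rec_coef0; ring.
by rewrite (E1 (al * X)) (E0 (al * X)).
Qed.

Lemma sum_triangle (G : nat -> nat -> F) k :
  \sum_(m < k.+1) \sum_(l < m.+1) G m l = \sum_(l < k.+1) \sum_(j < (k - l).+1) G (l + j)%N l.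
Proof.
elim: k => [|k IH]; first by rewrite !big_ord_recl !big_ord0 /= !addr0.
have e : \sum_(j < (k.+1 - k.+1).+1) G (k.+1 + j)%N k.+1 = G k.+1 k.+1.
  by rewrite subnn big_ord_recl big_ord0 /= addn0 addr0.
rewrite big_ord_recr /= IH [X in _ + X]big_ord_recr [RHS]big_ord_recr /= e addrA.
congr (_ + _); rewrite -big_split; apply: eq_bigr => l _ /=.
have hl := ltnSE (ltn_ord l).
have -> : (k.+1 - l)%N = (k - l).+1 by rewrite subSn.
by rewrite [RHS]big_ord_recr /= addnS subnKC.
Qed.

Lemma row_sum_seq1 y k : row_sum [:: y] k = gbinom y k * poch al k.
Proof.
rewrite /= big_ord_recl /= subr0 subn0 mulr1 big1 ?addr0 // => m _.
by rewrite mulr0.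
Qed.

(** If the rows below use l columns, the top two rows behave as a two-row diagram shortened by l.
    This reduces a swap of adjacent rows to two rows. *)
Lemma row_sum_cons2 X Y s k :
  row_sum [:: X, Y & s] k = \sum_(l < k.+1) row_sum [:: X - l%:R; Y - l%:R] (k - l)%N * row_sum s l.
Proof.
rewrite -[LHS]/(\sum_(m < k.+1) gbinom (X - m%:R) (k - m) * poch al (k - m) *
  \sum_(l < m.+1) gbinom (Y - l%:R) (m - l) * poch al (m - l) * row_sum s l).
under eq_bigr => m _ do rewrite mulr_sumr.
rewrite (sum_triangle (fun m l => gbinom (X - m%:R) (k - m) * poch al (k - m) *
  (gbinom (Y - l%:R) (m - l) * poch al (m - l) * row_sum s l))); apply: eq_bigr => l _.
rewrite -[row_sum [:: X - _; _] _]/(\sum_(j < (k - l).+1) gbinom (X - l%:R - j%:R) (k - l - j) * poch al (k - l - j) *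
  row_sum [:: Y - l%:R] j) mulr_suml; apply: eq_bigr => j _.
by rewrite row_sum_seq1 natrD opprD addrA subnDA addKn !mulrA.
Qed.

Lemma row_sum_swap X Y s k : row_sum [:: X, Y & s] k = row_sum [:: Y - al^-1, X + al^-1 & s] k.
Proof.
rewrite !row_sum_cons2; apply: eq_bigr => l _; congr (_ * _).
by rewrite two_rows_swap; congr (row_sum [:: _; _] _); ring.
Qed.

(** The substitution x_i = y_i + i / al of shifted symmetry for rows starting at index o, counted
    from 0. A swap of adjacent y is then the substitution of [row_sum_swap]. *)
Fixpoint shift_rows (o : nat) (ys : seq F) : seq F :=
  if ys is y :: ys' then y + o.+1%:R / al :: shift_rows o.+1 ys' else [::].

Lemma row_sum_shift_swap o k : swap_inv (fun ys => row_sum (shift_rows o ys) k).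
Proof.
move=> l a b s; elim: l o k => [|y l IH] o k.
  rewrite -[LHS]/(row_sum [:: _, _ & _] _) row_sum_swap /=.
  have -> : b + o.+2%:R / al - al^-1 = b + o.+1%:R / al by rewrite -[o.+2%:R]natr1; ring.
  have -> // : a + o.+1%:R / al + al^-1 = a + o.+2%:R / al by rewrite -[o.+2%:R]natr1; ring.
by apply: eq_bigr => m _; congr (_ * _); apply: IH.
Qed.

Lemma row_sum_rcons0 s k : row_sum (rcons s 0) k = row_sum s k.
Proof.
elim: s k => [|x s IH] k; first exact: (row_sum_zeros Hal 1).
by apply: eq_bigr => m _; congr (_ * _); apply: IH.
Qed.

End TwoRows.

(** * Uniqueness of shifted symmetric functions *)

Section PolyFun.
Variable F : fieldType.
Hypothesis Fc : forall n, n.+1%:R != 0 :> F.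

(* [poly_deg] and [shift_symm] are [poly_fun_deg] and [shifted_sym] over any field. *)
Definition poly_deg (N d : nat) (f : ('I_N -> F) -> F) : Prop :=
  exists s : seq (F * ('I_N -> nat)),
    all (fun t => \sum_(i < N) t.2 i <= d)%N s /\
    forall x, f x = \sum_(t <- s) t.1 * \prod_(i < N) x i ^+ t.2 i.

Lemma poly_deg_cst N a : @poly_deg N 0 (fun=> a).
Proof.
exists [:: (a, fun=> 0%N)]; split=> [|x]; first by rewrite /= big1.
by rewrite big_seq1 big1 /= ?mulr1.
Qed.

Lemma poly_deg_le N d e f : (d <= e)%N -> @poly_deg N d f -> poly_deg e f.
Proof.
move=> hde [s [hs hf]]; exists s; split=> //.
by apply: sub_all hs => t /= h; apply: leq_trans hde.
Qed.

Lemma poly_deg_var N i : @poly_deg N 1 (fun x => x i).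
Proof.
exists [:: (1, fun j => nat_of_bool (j == i))]; split=> [|x].
  by rewrite /= (bigD1 i) //= eqxx big1 // => j /negbTE->.
by rewrite big_seq1 mul1r (bigD1 i) //= eqxx big1 ?mulr1 // => j /negbTE->.
Qed.

Lemma poly_degD N d f g : @poly_deg N d f -> poly_deg d g -> poly_deg d (fun x => f x + g x).
Proof.
move=> [s [hs hf]] [t [ht hg]]; exists (s ++ t); split=> [|x]; first by rewrite all_cat hs ht.
by rewrite big_cat /= hf hg.
Qed.

Lemma poly_deg_mono N a (e : 'I_N -> nat) d f : poly_deg d f ->
  poly_deg (\sum_(i < N) e i + d) (fun x => a * \prod_(i < N) x i ^+ e i * f x).
Proof.
move=> [s [hs hf]]; exists [seq (a * t.1, fun i => (e i + t.2 i)%N) | t <- s]; split=> [|x].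
  by rewrite all_map; apply: sub_all hs => t /= h; rewrite big_split leq_add2l.
rewrite hf big_map mulr_sumr; apply: eq_bigr => t _ /=.
rewrite mulrACA -big_split; congr (_ * _); apply: eq_bigr => i _.
by rewrite exprD.
Qed.

Lemma poly_degM N d e f g : @poly_deg N d f -> poly_deg e g -> poly_deg (d + e) (fun x => f x * g x).
Proof.
move=> [s [hs hf]] hg; rewrite (_ : (fun x => _) = (fun x =>
    \sum_(t <- s) t.1 * \prod_(i < N) x i ^+ t.2 i * g x)); last first.
  by apply/funext => x; rewrite hf mulr_suml.
elim: s hs {hf} => [|t s IH] /= => [_|/andP[ht hs]].
  rewrite (_ : (fun x => _) = (fun=> 0)); first exact: poly_deg_le (poly_deg_cst _ 0).
  by apply/funext => x; rewrite big_nil.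
rewrite (_ : (fun x => _) = (fun x => t.1 * \prod_(i < N) x i ^+ t.2 i * g x +
    \sum_(t <- s) t.1 * \prod_(i < N) x i ^+ t.2 i * g x)).
  by apply: poly_degD (IH hs); apply: poly_deg_le (poly_deg_mono _ _ hg); rewrite leq_add2r.
by apply/funext => x; rewrite big_cons.
Qed.

Section Transfer.
Variables (T : Type) (P : nat -> (T -> F) -> Prop).
Hypothesis P_cst : forall a, P 0 (fun=> a).
Hypothesis P_le : forall d e f, (d <= e)%N -> P d f -> P e f.
Hypothesis P_add : forall d f g, P d f -> P d g -> P d (fun t => f t + g t).
Hypothesis P_mul : forall d e f g, P d f -> P e g -> P (d + e) (fun t => f t * g t).

Lemma graded_exp f e : P 1 f -> P e (fun t => f t ^+ e).
Proof.
move=> hf; elim: e => [|e IH]; first exact: P_cst.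
rewrite (_ : (fun t => _) = (fun t => f t * f t ^+ e)); first by rewrite -add1n; apply: P_mul.
by apply/funext => t; rewrite exprS.
Qed.

Lemma graded_monomial n (phi : 'I_n -> T -> F) (e : 'I_n -> nat) : (forall i, P 1 (phi i)) ->
  P (\sum_(i < n) e i) (fun t => \prod_(i < n) phi i t ^+ e i).
Proof.
elim: n phi e => [|n IH] phi e h.
  rewrite (_ : (fun t => _) = (fun=> 1)); first by rewrite big_ord0.
  by apply/funext => t; rewrite big_ord0.
rewrite big_ord_recl (_ : (fun t => _) = (fun t => phi ord0 t ^+ e ord0 *
    \prod_(i < n) phi (lift ord0 i) t ^+ e (lift ord0 i))).
  by apply: P_mul; [apply: graded_exp|apply: IH].
by apply/funext => t; rewrite big_ord_recl.
Qed.

Lemma poly_deg_comp N d f (phi : 'I_N -> T -> F) : @poly_deg N d f -> (forall i, P 1 (phi i)) ->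
  P d (fun t => f (phi^~ t)).
Proof.
move=> [s [hs hf]] h; rewrite (_ : (fun t => _) = (fun t =>
    \sum_(u <- s) u.1 * \prod_(i < N) phi i t ^+ u.2 i)); last by apply/funext.
elim: s hs {hf} => [|u s IH] /= => [_|/andP[hu hs]].
  rewrite (_ : (fun x => _) = (fun=> 0)); first exact: P_le (P_cst 0).
  by apply/funext => x; rewrite big_nil.
rewrite (_ : (fun t => _) = (fun t => u.1 * \prod_(i < N) phi i t ^+ u.2 i +
    \sum_(u <- s) u.1 * \prod_(i < N) phi i t ^+ u.2 i)).
  apply: P_add (IH hs); apply: P_le hu _; rewrite -[X in P X]add0n.
  by apply: P_mul => //; apply: graded_monomial.
by apply/funext => t; rewrite big_cons.
Qed.

End Transfer.

Definition upd N (x : 'I_N -> F) i t : 'I_N -> F := fun j => if j == i then t else x j.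

Lemma poly_deg_upd N d f (x : 'I_N -> F) i : poly_deg d f -> polyf (fun t => f (upd x i t)).
Proof.
move=> hf; apply: (@poly_deg_comp F (fun=> @polyf F) _ _ _ _ N d f (fun j t => upd x i t j)) => //.
- exact: polyf_cst.
- by move=> _; apply: polyfD.
- by move=> _ _; apply: polyfM.
by move=> j; rewrite /upd; case: (j == i); [apply: polyf_id|apply: polyf_cst].
Qed.

(** Division monomial by monomial, x^e - c^e being a multiple of x - c. The bound [d.-1] does not
    tell d = 0 from d = 1, so the second clause records that for d = 0 the quotient is 0. *)
Lemma poly_deg_factor N d f (i : 'I_N) c : poly_deg d f -> (forall x, x i = c -> f x = 0) ->
  exists q, [/\ poly_deg d.-1 q, d = 0%N -> forall x, q x = 0 & forall x, f x = (x i - c) * q x].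
Proof.
move=> [s [hs hf]] h0.
pose m (t : F * ('I_N -> nat)) (x : 'I_N -> F) := t.1 * \prod_(j < N) x j ^+ (if j == i then 0 else t.2 j)%N *
  \sum_(l < t.2 i) x i ^+ ((t.2 i).-1 - l) * c ^+ l.
exists (fun x => \sum_(t <- s) m t x); split.
- elim: s hs {hf} => [|t s IH] /= => [_|/andP[ht hs]].
    rewrite (_ : (fun x => _) = (fun=> 0)); first exact: poly_deg_le (poly_deg_cst _ 0).
    by apply/funext => x; rewrite big_nil.
  rewrite (_ : (fun x => _) = (fun x => m t x + \sum_(u <- s) m u x)); last by apply/funext => x; rewrite big_cons.
  apply: poly_degD (IH hs); move: ht; rewrite (bigD1 i) //= => ht.
  case E : (t.2 i) ht => [|e] ht.
    rewrite (_ : m t = (fun=> 0)); first exact: poly_deg_le (poly_deg_cst _ 0).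
    by apply/funext => x; rewrite /m E big_ord0 mulr0.
  have hle : (\sum_(j < N) (if j == i then 0 else t.2 j) + e <= d.-1)%N.
    rewrite (bigD1 i) //= eqxx add0n (eq_bigr t.2) => [|j /negbTE->//].
    by move: ht; set S := (\sum_(j < N | _) _)%N; lia.
  apply: poly_deg_le hle _; apply: poly_deg_mono; rewrite E.
  apply: (graded_sum (@poly_deg_cst N) (@poly_deg_le N) (@poly_degD N)) => l.
  have hl : (e - l + l <= e)%N by rewrite subnK // (ltnSE (ltn_ord l)).
  apply: poly_deg_le hl _; apply: poly_degM; last exact: poly_deg_le (poly_deg_cst _ _).
  by apply: (graded_exp (@poly_deg_cst N) (@poly_degM N)); apply: poly_deg_var.
- move=> d0 x; elim: s hs {hf} => [|t s IH] /=; first by rewrite big_nil.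
  rewrite {1}d0 leqn0 sum_nat_eq0 => /andP[/forallP h /IH E].
  by rewrite big_cons E addr0 /m (eqP (h i)) big_ord0 mulr0.
- move=> x; have := h0 (upd x i c); rewrite {1}/upd eqxx => /(_ erefl) E.
  have -> : f x = f x - f (upd x i c) by rewrite E subr0.
  rewrite !hf -sumrB /= mulr_sumr; apply: eq_bigr => t _.
  rewrite /m mulrCA -subrXX.
  rewrite (bigD1 i) //= [X in _ - _ * X](bigD1 i) //= [in RHS](bigD1 i) //= eqxx expr0 mul1r.
  have -> : \prod_(j < N | j != i) upd x i c j ^+ t.2 j = \prod_(j < N | j != i) x j ^+ t.2 j.
    by apply: eq_bigr => j /negbTE h; rewrite /upd h.
  have -> : \prod_(j < N | j != i) x j ^+ (if j == i then 0 else t.2 j)%N = \prod_(j < N | j != i) x j ^+ t.2 j.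
    by apply: eq_bigr => j /negbTE->.
  by rewrite /upd eqxx; ring.
Qed.

Lemma upd_id N (x : 'I_N -> F) i : upd x i (x i) = x.
Proof. by apply/funext => j; rewrite /upd; case: eqP => [->|]. Qed.

(** In the variable x_i this is a polynomial with infinitely many roots c + n + 1. *)
Lemma upd_density N d q (x : 'I_N -> F) i c : poly_deg d q ->
  (forall t, t != c -> q (upd x i t) = 0) -> q x = 0.
Proof.
move=> hq h; rewrite -(upd_id x i).
apply: (@polyf_inj F (fun t => q (upd x i t)) (fun n => c + n.+1%:R)) => [m n /addrI/(natr_inj_char0 Fc)[]//||n].
  exact: poly_deg_upd hq.
by apply: h; rewrite addrC -subr_eq0 addrK.
Qed.

(** The quotient by one factor still vanishes on the other hyperplanes: off x_i = c_i this is clear,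
    and [upd_density] gives the rest. *)
Lemma poly_deg_factors N d f (c : 'I_N -> F) (r : seq 'I_N) : uniq r -> poly_deg d f ->
  (forall i, i \in r -> forall x, x i = c i -> f x = 0) ->
  exists q, [/\ poly_deg (d - size r) q, (d < size r)%N -> forall x, q x = 0 &
    forall x, f x = \prod_(i <- r) (x i - c i) * q x].
Proof.
elim: r d f => [|i r IH] d f /=.
  by move=> _ hf _; exists f; split=> [||x]; rewrite ?subn0 // big_nil mul1r.
move=> /andP[hi hr] hf h.
have [q1 [h1 h2 h3]] := poly_deg_factor hf (h i (mem_head _ _)).
have hz j : j \in r -> forall x, x j = c j -> q1 x = 0.
  move=> hj x hx; apply: (upd_density (i := i) (c := c i) h1) => t ht.
  have hji : j != i by apply: contraNneq hi => <-.
  have := h3 (upd x i t); rewrite (h j) ?inE ?hj ?orbT //; last by rewrite /upd (negbTE hji).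
  by move=> /esym/eqP; rewrite {1}/upd eqxx mulf_eq0 subr_eq0 (negbTE ht) => /eqP.
have [q [g1 g2 g3]] := IH _ _ hr h1 hz.
exists q; split=> [||x].
- by apply: poly_deg_le g1; lia.
- case: (posnP d) => [d0 _ x|hd hd']; last by apply: g2; lia.
  case: (posnP (size r)) => [r0|hr0]; last by apply: g2; lia.
  by rewrite -[RHS](h2 d0 x) g3 (size0nil r0) big_nil mul1r.
- by rewrite h3 g3 big_cons mulrA.
Qed.

End PolyFun.

Section Unique.
Variables (F : fieldType) (al : F).
Hypothesis Hal : forall m r : int, al * m%:~R + r%:~R = 0 -> m = 0 /\ r = 0.
Let Fc n : n.+1%:R != 0 :> F. Proof. exact: natr_neq0 Hal n. Qed.

Definition shift_symm (N : nat) (f : ('I_N -> F) -> F) : Prop :=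
  forall (s : 'S_N) (y : 'I_N -> F),
    f (fun i => y (s i) + (i.+1)%:R / al) = f (fun i => y i + (i.+1)%:R / al).

Definition ext_last N (x : 'I_N -> F) c : 'I_N.+1 -> F :=
  fun i => if unlift ord_max i is Some j then x j else c.

Lemma ext_lift N (x : 'I_N -> F) c j : ext_last x c (lift ord_max j) = x j.
Proof. by rewrite /ext_last liftK. Qed.

Lemma ext_max N (x : 'I_N -> F) c : ext_last x c ord_max = c.
Proof. by rewrite /ext_last unlift_none. Qed.

Lemma poly_deg_ext N d f c : @poly_deg F N.+1 d f -> poly_deg d (fun x : 'I_N -> F => f (ext_last x c)).
Proof.
move=> hf; apply: (@poly_deg_comp F _ (@poly_deg F N) _ _ _ _ N.+1 d f (fun j x => ext_last x c j)) => //.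
- exact: poly_deg_cst.
- exact: poly_deg_le.
- exact: poly_degD.
- exact: poly_degM.
move=> j; rewrite /ext_last; case: (unlift _ j) => [k|]; first exact: poly_deg_var.
exact: poly_deg_le (poly_deg_cst _ _).
Qed.

Lemma shift_symm_ext N f c : @shift_symm N.+1 f -> shift_symm (fun x : 'I_N -> F => f (ext_last x c)).
Proof.
move=> hf s y; pose y' := ext_last y (c - N.+1%:R / al).
have E (z : 'I_N -> F) : ext_last (fun i => z i + i.+1%:R / al) c =
    (fun i => ext_last z (c - N.+1%:R / al) i + i.+1%:R / al).
  apply/funext => i; case: (unliftP ord_max i) => [j ->|->]; first by rewrite !ext_lift lift_max.
  by rewrite !ext_max subrK.
rewrite !E -[RHS](hf (lift_perm ord_max ord_max s)); congr f; apply/funext => i; congr (_ + _).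
case: (unliftP ord_max i) => [j ->|->]; first by rewrite lift_perm_lift !ext_lift.
by rewrite lift_perm_id !ext_max.
Qed.

(* Setting the last variable to [s] gives 0 by induction on [N]; by symmetry [f]
   vanishes on all the hyperplanes x_i = c_i, and the quotient by prod_i (x_i - c_i)
   has smaller degree and vanishes at the partitions shifted by [s + 1]. *)
Lemma shift_symm_unique N d (f : ('I_N -> F) -> F) s : poly_deg d f -> shift_symm f ->
  (forall la : nat -> nat, (forall i, (la i.+1 <= la i)%N) -> (\sum_(i < N) la i <= d)%N ->
     f (fun i => (la i)%:R + s) = 0) ->
  forall x, f x = 0.
Proof.
elim: N d f s => [|N IHN].
  move=> d f s _ _ h x; rewrite -[RHS](h (fun=> 0%N)) ?big_ord0 //.
  by congr f; apply/funext => -[].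
elim/ltn_ind => d IHd f s hd hs hv.
(* In the coordinates y_i = x_i - i / al every hyperplane below is y_i = c0, the last one being x =
   s for the last variable; so the product of their equations is symmetric in the y. *)
pose c0 := s - N.+1%:R / al.
pose c (i : 'I_N.+1) := c0 + i.+1%:R / al.
have Z0 x : x ord_max = s -> f x = 0.
  move=> hx; have -> : x = ext_last (fun j => x (lift ord_max j)) s.
    by apply/funext => i; case: (unliftP ord_max i) => [j ->|->]; rewrite ?ext_lift ?ext_max.
  apply: (IHN d (fun x => f (ext_last x s)) s) => {x hx}; [exact: poly_deg_ext|exact: shift_symm_ext|].
  move=> la hla hsum; pose la' i := if (i < N)%N then la i else 0%N.
  rewrite -[RHS](hv la').
  - congr f; apply/funext => i; case: (unliftP ord_max i) => [j ->|->].
      by rewrite ext_lift /la' lift_max ltn_ord.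
    by rewrite ext_max /la' ltnn add0r.
  - by move=> i; rewrite /la'; case: ltnP => // h; rewrite (ltn_trans (ltnSn i) h).
  - rewrite big_ord_recr /= /la' ltnn addn0; apply: leq_trans hsum.
    by apply: leq_sum => i _; rewrite ltn_ord.
have Zi i x : x i = c i -> f x = 0.
  move=> hx; pose y j := x j - j.+1%:R / al.
  have -> : x = (fun j => y j + j.+1%:R / al) by apply/funext => j; rewrite subrK.
  rewrite -(hs (tperm i ord_max)); apply: Z0.
  by rewrite tpermR /y hx /c addrK subrK.
have [q [q1 q2 q3]] := poly_deg_factors Fc (c := c) (enum_uniq 'I_N.+1) hd (fun i _ => Zi i).
rewrite size_enum_ord in q1 q2.
have q3' x : f x = \prod_i (x i - c i) * q x by rewrite q3 big_enum.
suff q0 : forall x, q x = 0 by move=> x; rewrite q3' q0 mulr0.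
case: (ltnP d N.+1) => hdN; first exact: q2.
apply: (IHd (d - N.+1)%N _ q (s + 1)) => //; first by lia.
- move=> t y; pose g (y : 'I_N.+1 -> F) := q (fun i => y (t i) + i.+1%:R / al) - q (fun i => y i + i.+1%:R / al).
  apply/eqP; rewrite -subr_eq0 -/(g y); apply/eqP.
  (* The quotient inherits the symmetry of f where no y_i equals c0; the coordinates in [r] are then
     released one at a time by [upd_density]. *)
  have Pg (r : seq 'I_N.+1) : forall y, (forall i, i \notin r -> y i != c0) -> g y = 0.
    have poly_deg_g : poly_deg (d - N.+1) g.
      have pq (u : 'S_N.+1) : poly_deg (d - N.+1) (fun y : 'I_N.+1 -> F => q (fun i => y (u i) + i.+1%:R / al)).
        apply: (@poly_deg_comp F _ (@poly_deg F N.+1) _ _ _ _ N.+1 (d - N.+1) q (fun j y => y (u j) + j.+1%:R / al)) => //.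
        - exact: poly_deg_cst.
        - exact: poly_deg_le.
        - exact: poly_degD.
        - exact: poly_degM.
        by move=> i; apply: poly_degD; [apply: poly_deg_var|apply: poly_deg_le (poly_deg_cst _ _)].
      rewrite (_ : g = (fun y => q (fun i => y (t i) + i.+1%:R / al) + -1 * q (fun i => y ((1%g : 'S_N.+1) i) + i.+1%:R / al))).
        by apply: poly_degD; [apply: pq|rewrite -[X in poly_deg X]add0n; apply: poly_degM; [apply: poly_deg_cst|apply: pq]].
      apply/funext => w; rewrite /g mulN1r; congr (_ - q _).
      by apply/funext => i; rewrite perm1.
    elim: r => [|j r IH] {}y hy.
      have hp : \prod_i (y i - c0) != 0.
        by apply/prodf_neq0 => i _; rewrite subr_eq0 hy.
      apply: (mulfI hp); rewrite mulr0 mulrBr.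
      apply/eqP; rewrite subr_eq0; apply/eqP.
      have qE (w : 'I_N.+1 -> F) : \prod_i (w i - c0) * q (fun i => w i + i.+1%:R / al) = f (fun i => w i + i.+1%:R / al).
        by rewrite q3'; congr (_ * _); apply: eq_bigr => i _; rewrite /c; ring.
      rewrite qE -(hs t) -[in RHS](qE (fun i => y (t i))); congr (_ * _).
      exact: (reindex_inj (@perm_inj _ t)).
    apply: (@upd_density F Fc N.+1 (d - N.+1) g y j c0).
      exact: poly_deg_g.
    move=> u hu; apply: IH => i hi; rewrite /upd; case: (eqVneq i j) => [//|hne].
    by apply: hy; rewrite inE negb_or hne.
  by apply: (Pg (enum 'I_N.+1)) => i; rewrite mem_enum.
- move=> la hla hsum.
  have := hv (fun i => (la i).+1) hla; rewrite q3'.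
  rewrite (eq_bigr (fun i : 'I_N.+1 => la i + 1)%N) // => [|i _]; last by rewrite addn1.
  rewrite big_split /= sum1_card card_ord addnC -leq_subRL // => /(_ hsum) /eqP.
  rewrite mulf_eq0 => /orP[/prodf_eq0[i _]|/eqP h]; last first.
    by rewrite -[RHS]h; congr q; apply/funext => i; rewrite -natr1; ring.
  (* At these points a factor is la_i + 1 + (N - i) / al, which cannot vanish. *)
  move=> /eqP h; have := @Hal (la i).+1 (N.+1%:Z - i.+1%:Z).
  have ha := al_neq0 Hal.
  have -> : al * (Posz (la i).+1)%:~R + (N.+1%:Z - i.+1%:Z)%:~R = 0 :> F.
    have : al * ((la i).+1%:R + s - c i) = 0 by rewrite h mulr0.
    rewrite /c /c0 => <-; rewrite rmorphB /= -!pmulrn; field; exact: ha.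
  by move=> /(_ erefl) [].
Qed.

End Unique.

(** * Column-distinct sets *)

Section ColumnDistinct.
Variables (F : fieldType) (al : F).
Hypothesis Hal : forall m r : int, al * m%:~R + r%:~R = 0 -> m = 0 /\ r = 0.

Definition col_distinct (M H : nat) (A : {set 'I_M * 'I_H}) : bool :=
  [forall a in A, forall b in A, (a.2 == b.2) ==> (a == b)].
Definition diagram M H (s : seq nat) : {set 'I_M * 'I_H} := [set b : 'I_M * 'I_H | (b.2 < nth 0%N s b.1)%N].
Definition row_weight M H (A : {set 'I_M * 'I_H}) : F := \prod_(r < M) poch al #|[set b in A | b.1 == r]|.
Definition col_distinct_sum M H s k : F :=
  \sum_(A : {set 'I_M * 'I_H} | [&& A \subset diagram M H s, #|A| == k & col_distinct A]) row_weight A.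

Lemma col_distinctP M H (A : {set 'I_M * 'I_H}) :
  reflect (forall a b, a \in A -> b \in A -> a.2 = b.2 -> a = b) (col_distinct A).
Proof.
apply: (iffP forall_inP) => h.
  move=> a b ha hb e; have /forall_inP/(_ b hb) := h a ha.
  by rewrite e eqxx => /eqP.
move=> a ha; apply/forall_inP => b hb; apply/implyP => /eqP e.
by rewrite (h a b).
Qed.

Section Step.
Variables (M H : nat).
Implicit Types (T : {set 'I_H}) (A : {set 'I_M * 'I_H}) (B : {set 'I_M.+1 * 'I_H}).

Definition glue (p : {set 'I_M * 'I_H} * {set 'I_H}) : {set 'I_M.+1 * 'I_H} :=
  [set b | if unlift ord0 b.1 is Some r then (r, b.2) \in p.1 else b.2 \in p.2].
Definition unglue B : {set 'I_M * 'I_H} * {set 'I_H} :=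
  ([set b | (lift ord0 b.1, b.2) \in B], [set c | (ord0, c) \in B]).

Lemma in_glue0 A T c : ((ord0, c) \in glue (A, T)) = (c \in T).
Proof. by rewrite inE /= unlift_none. Qed.

Lemma in_glueS A T r c : ((lift ord0 r, c) \in glue (A, T)) = ((r, c) \in A).
Proof. by rewrite inE /= liftK. Qed.

Lemma glueK : cancel glue unglue.
Proof.
move=> [A T]; rewrite /unglue; congr (_, _); apply/setP.
  by move=> [r c]; rewrite inE in_glueS.
by move=> c; rewrite inE in_glue0.
Qed.

Lemma unglueK : cancel unglue glue.
Proof.
move=> B; apply/setP => -[r c]; rewrite /unglue.
by case: (unliftP ord0 r) => [r' ->|->]; rewrite ?in_glueS ?in_glue0 inE.
Qed.

Definition cols A : {set 'I_H} := [set b.2 | b in A].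

Lemma card_row_glueS A T r :
  #|[set b in glue (A, T) | b.1 == lift ord0 r]| = #|[set b in A | b.1 == r]|.
Proof.
rewrite -(card_imset _ (_ : injective (fun b : 'I_M * 'I_H => (lift ord0 b.1, b.2)))).
  apply: eq_card => -[r' c]; rewrite !inE /=; apply/andP/imsetP => /=.
    move=> [h /eqP e]; rewrite e liftK in h *; exists (r, c) => //.
    by rewrite inE h eqxx.
  move=> [[r1 c1]]; rewrite inE => /andP[h /eqP /= <-] e.
  have e1 : r' = lift ord0 r1 := f_equal fst e.
  by have e2 : c = c1 := f_equal snd e; rewrite e1 e2 liftK h.
move=> [a b] [a' b'] /= e; have e2 : b = b' := f_equal snd e.
by rewrite -(lift_inj (f_equal fst e)) e2.
Qed.

Lemma card_row_glue0 A T : #|[set b in glue (A, T) | b.1 == ord0]| = #|T|.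
Proof.
rewrite -(card_imset _ (_ : injective (fun c : 'I_H => (ord0 : 'I_M.+1, c)))).
  apply: eq_card => -[r' c]; rewrite !inE /=; apply/andP/imsetP => /=.
    by move=> [h /eqP e]; rewrite e unlift_none in h *; exists c.
  by move=> [c1 h] [-> ->]; rewrite unlift_none.
by move=> a b [].
Qed.

Lemma wgt_glue A T : row_weight (glue (A, T)) = poch al #|T| * row_weight A.
Proof.
rewrite /row_weight big_ord_recl card_row_glue0; congr (_ * _); apply: eq_bigr => r _.
by rewrite card_row_glueS.
Qed.

Lemma card_rows N (B : {set 'I_N * 'I_H}) : #|B| = (\sum_(r < N) #|[set b in B | b.1 == r]|)%N.
Proof.
rewrite -sum1_card (partition_big (fun b : 'I_N * 'I_H => b.1) xpredT) //=; apply: eq_bigr => r _.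
by rewrite -sum1_card; apply: eq_bigl => b; rewrite inE.
Qed.

Lemma card_glue A T : #|glue (A, T)| = (#|T| + #|A|)%N.
Proof.
rewrite card_rows big_ord_recl card_row_glue0 (card_rows A); congr (_ + _)%N.
by apply: eq_bigr => r _; rewrite card_row_glueS.
Qed.

Lemma diagram_glue x s A T : (glue (A, T) \subset diagram M.+1 H (x :: s)) =
  (A \subset diagram M H s) && (T \subset [set c : 'I_H | (c < x)%N]).
Proof.
apply/subsetP/andP => [h|[/subsetP hA /subsetP hT] [r c]].
  split; apply/subsetP.
    by move=> [r c] hb; have := h (lift ord0 r, c); rewrite in_glueS !inE /= => /(_ hb).
  by move=> c hc; have := h (ord0, c); rewrite in_glue0 !inE /= => /(_ hc).
case: (unliftP ord0 r) => [r' ->|->].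
  by rewrite in_glueS => /hA; rewrite !inE.
by rewrite in_glue0 => /hT; rewrite !inE.
Qed.

Lemma col_distinct_glue A T : col_distinct (glue (A, T)) = col_distinct A && [disjoint T & cols A].
Proof.
apply/col_distinctP/andP => [h|[/col_distinctP hA hT]].
  split; first apply/col_distinctP.
    move=> [r c] [r' c'] ha hb /= e.
    have := h (lift ord0 r, c) (lift ord0 r', c'); rewrite !in_glueS => /(_ ha hb e) e'.
    by rewrite -(lift_inj (f_equal fst e')) e.
  apply/pred0P => c /=; apply/negbTE/negP => /andP[hc /imsetP[[r c'] hA /= e]].
  have := h (ord0, c) (lift ord0 r, c'); rewrite in_glue0 in_glueS => /(_ hc hA e) e'.
  by have := neq_lift ord0 r; rewrite -(f_equal fst e' : ord0 = lift ord0 r) eqxx.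
move=> [r c] [r' c'] /= + + e; rewrite -{}e {c'}.
have dis r1 : c \in T -> (r1, c) \in A -> False.
  move=> h1 h2; move/pred0P: hT => /(_ c) /=; rewrite h1 /= => /negbT/negP; apply.
  by apply/imsetP; exists (r1, c).
case: (unliftP ord0 r) => [r1 ->|->]; case: (unliftP ord0 r') => [r2 ->|->]; rewrite ?in_glueS ?in_glue0 //.
- by move=> h1 h2; have e := hA _ _ h1 h2 erefl; rewrite (f_equal fst e : r1 = r2).
- by move=> h1 /dis /(_ h1).
- by move=> /dis h1 /h1.
Qed.

Lemma card_cols A : col_distinct A -> #|cols A| = #|A|.
Proof. by move=> /col_distinctP h; apply: card_in_imset => a b ha hb; apply: h. Qed.

Lemma cols_sub x s A : sorted geq (x :: s) -> A \subset diagram M H s ->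
  cols A \subset [set c : 'I_H | (c < x)%N].
Proof.
move=> hs /subsetP hA; apply/subsetP => _ /imsetP[b /hA + ->]; rewrite !inE => h.
apply: leq_trans h _; case: (ltnP b.1 (size s)) => hb; last by rewrite nth_default.
have /(order_path_min (rev_trans leq_trans))/(all_nthP 0%N) := hs; exact.
Qed.

(** The lower rows lie in the first x columns, so m boxes there in distinct columns leave x - m
    columns for the first row, whichever boxes they are. *)
Lemma col_distinct_sum_rec x s k : sorted geq (x :: s) -> (x <= H)%N ->
  col_distinct_sum M.+1 H (x :: s) k = \sum_(m < k.+1) ('C(x - m, k - m))%:R * poch al (k - m) * col_distinct_sum M H s m.
Proof.
move=> hs hx; rewrite /col_distinct_sum (reindex glue) /=; last by exists unglue => ? _; [apply: glueK|apply: unglueK].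
pose X : {set 'I_H} := [set c : 'I_H | (c < x)%N].
have cX : #|X| = x.
  have wi : injective (widen_ord hx) by move=> i j /(congr1 val) /= /val_inj.
  have := card_imset (mem 'I_x) wi; rewrite card_ord => <-.
  apply: eq_card => c; rewrite inE; apply/idP/imsetP => [h|[i _ ->]]; last exact: (ltn_ord i).
  by exists (Ordinal h) => //; apply: val_inj.
transitivity (\sum_(A : {set 'I_M * 'I_H} | (A \subset diagram M H s) && col_distinct A)
   \sum_(T : {set 'I_H} | (T \subset X :\: cols A) && (#|T| + #|A| == k)%N) poch al #|T| * row_weight A).
  rewrite pair_big_dep /=; apply: eq_big => [[A T]|[A T] _]; last exact: wgt_glue.
  rewrite diagram_glue col_distinct_glue card_glue subsetD /=.
  by case: (A \subset _); case: (col_distinct A); case: (T \subset _); case: (_ == k); case: [disjoint _ & _].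
have E (A : {set 'I_M * 'I_H}) : (A \subset diagram M H s) && col_distinct A ->
   \sum_(T : {set 'I_H} | (T \subset X :\: cols A) && (#|T| + #|A| == k)%N) poch al #|T| * row_weight A =
   \sum_(m < k.+1 | #|A| == m) ('C(x - m, k - m))%:R * poch al (k - m) * row_weight A.
  move=> /andP[hA hc]; case: (leqP #|A| k) => hk.
    rewrite (big_pred1 (Ordinal (hk : #|A| < k.+1)%N)) => [/=|m]; last by apply/eqP/eqP => [e|->//]; apply: val_inj.
    have -> : (x - #|A|)%N = #|X :\: cols A|.
      by rewrite cardsD (setIidPr (cols_sub hs hA)) cX card_cols.
    rewrite -cards_draws -sum1_card natr_sum !mulr_suml; apply: eq_big => T.
      by rewrite inE -[in RHS](eqn_add2r #|A|) subnK.
    by move=> /andP[_ /eqP <-]; rewrite mul1r addnK.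
  rewrite !big_pred0 // => [m|T]; last by apply/andP => -[_ /eqP]; lia.
  by apply/eqP; have := ltn_ord m; lia.
rewrite (eq_bigr _ E); under [RHS]eq_bigr => m _ do rewrite mulr_sumr.
rewrite (exchange_big_dep (fun A : {set 'I_M * 'I_H} => (A \subset diagram M H s) && col_distinct A)) /=; last first.
  by move=> m A _ /and3P[-> _ ->].
apply: eq_bigr => A /andP[-> ->]; apply: eq_bigl => m; by rewrite andbT.
Qed.

End Step.

Lemma col_distinct_sumE H s k : sorted geq s -> (head 0%N s <= H)%N ->
  col_distinct_sum (size s) H s k = row_sum al [seq x%:R | x <- s] k.
Proof.
elim: s k => [|x s IH] k hs hH.
  have e0 (A : {set 'I_0 * 'I_H}) : A = set0 by apply/setP => -[[]].
  case: k => [|k]; rewrite /col_distinct_sum /=.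
    rewrite (big_pred1 set0) => [|A]; first by rewrite /row_weight big_ord0.
    rewrite /= [A]e0 eqxx sub0set cards0 /=; apply/col_distinctP => a b; by rewrite inE.
  by rewrite big_pred0 // => A; rewrite [A]e0 cards0 andbF.
have hs' := path_sorted hs.
have hx : (head 0%N s <= x)%N by case: s hs {IH hs' hH} => [|y s] //= /andP[].
rewrite [size _]/= col_distinct_sum_rec // -[RHS]/(\sum_(m < k.+1) gbinom (x%:R - m%:R) (k - m) * poch al (k - m) *
  row_sum al [seq y%:R | y <- s] m); apply: eq_bigr => m _.
rewrite IH //; last exact: leq_trans hx hH.
(* For m > x the truncated x - m differs from the subtraction in the field, but the lower rows then
   contribute 0. *)
case: (ltnP x m) => hm; first by rewrite (row_sum_gt Hal hs' (leq_ltn_trans hx hm)) !mulr0.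
by congr (_ * _ * _); rewrite -natrB // (gbinom_nat Hal).
Qed.

End ColumnDistinct.

(** * The shifted Jack function of a row *)

Section Vals.
Variables (F : fieldType) (al : F).
Hypothesis Hal : forall m r : int, al * m%:~R + r%:~R = 0 -> m = 0 /\ r = 0.
Implicit Types (k N : nat).

Definition ord_vals N (x : 'I_N -> F) : seq F := [seq x i | i <- enum 'I_N].

Lemma size_ord_vals N (x : 'I_N -> F) : size (ord_vals x) = N.
Proof. by rewrite size_map size_enum_ord. Qed.

Lemma nth_ord_vals N (x : 'I_N -> F) (i : 'I_N) : nth 0 (ord_vals x) i = x i.
Proof. by rewrite (nth_map i) ?size_enum_ord // nth_ord_enum. Qed.

Lemma eq_ord_vals N (x : 'I_N -> F) s : size s = N -> (forall i : 'I_N, x i = nth 0 s i) -> ord_vals x = s.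
Proof.
move=> hs h; apply: (@eq_from_nth _ 0) => [|i]; rewrite size_ord_vals ?hs // => hi.
by rewrite -[i]/(nat_of_ord (Ordinal hi)) nth_ord_vals h.
Qed.

Lemma size_shift_rows o ys : size (shift_rows al o ys) = size ys.
Proof. by elim: ys o => [//|y ys IH] o /=; rewrite IH. Qed.

Lemma nth_shift_rows o ys i : (i < size ys)%N -> nth 0 (shift_rows al o ys) i = nth 0 ys i + (o + i).+1%:R / al.
Proof.
elim: ys o i => [//|y ys IH] o [|i] /=; first by rewrite addn0.
by rewrite ltnS => /IH ->; rewrite addnS.
Qed.

Lemma row_sum_shift_symm N k : shift_symm al (fun x : 'I_N -> F => row_sum al (ord_vals x) k).
Proof.
have E (z : 'I_N -> F) : ord_vals (fun i => z i + i.+1%:R / al) = shift_rows al 0 (ord_vals z).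
  by apply: eq_ord_vals => [|i]; rewrite ?size_shift_rows ?nth_shift_rows ?size_ord_vals // nth_ord_vals.
move=> s y; rewrite !E; apply: (swap_inv_perm (row_sum_shift_swap Hal 0 k)).
rewrite /ord_vals (map_comp y s); apply: perm_map.
apply: uniq_perm => [||i]; rewrite ?(map_inj_uniq perm_inj) ?enum_uniq // mem_enum.
by apply/mapP; exists (s^-1%g i); rewrite ?mem_enum // permKV.
Qed.

Lemma row_sum_poly_deg N k : poly_deg k (fun x : 'I_N -> F => row_sum al (ord_vals x) k).
Proof.
pose f i (x : 'I_N -> F) := if insub i is Some j then x j else 0.
rewrite (_ : (fun x => _) = (fun x => row_sum al (mkseq (f^~ x) N) k)).
  apply: (graded_row_sum al (@poly_deg_cst F N) (@poly_deg_le F N) (@poly_degD F N) (@poly_degM F N)) => i hi.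
  by rewrite /f insubT; apply: poly_deg_var.
apply/funext => x; congr (row_sum _ _ _); apply: eq_ord_vals => [|i]; first by rewrite size_mkseq.
by rewrite nth_mkseq // /f valK.
Qed.

Lemma row_sum_cat0 s p k : row_sum al (s ++ nseq p 0) k = row_sum al s k.
Proof.
elim: p => [|p IH]; first by rewrite cats0.
by rewrite -addn1 nseqD catA cats1 row_sum_rcons0.
Qed.

End Vals.

Lemma poly_fun_degE N d f : @poly_fun_deg N d f = @poly_deg K N d f.
Proof. by []. Qed.

Lemma coldist_sumE k la : coldist_sum k la = col_distinct_sum alpha (size la) (head 0%N la) la k.
Proof. by []. Qed.

(** The factor k! comes from the prescribed value at (k): the second hook product of a row is k!
    alpha^k ([hook_row]). *)
Definition row_jack k : shfam := fun N x => (k`!)%:R * row_sum alpha (ord_vals x) k.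

Lemma row_jack_stable k N (x : 'I_N -> K) : row_jack k (ext0 x) = row_jack k x.
Proof.
rewrite /row_jack -(row_sum_rcons0 alpha_transc (ord_vals x)); congr (_ * row_sum _ _ _).
apply: eq_ord_vals => [|i]; first by rewrite size_rcons size_ord_vals.
rewrite nth_rcons size_ord_vals /ext0; case: (unliftP ord_max i) => [j ->|->].
  by rewrite lift_max ltn_ord nth_ord_vals.
by rewrite ltnn eqxx.
Qed.

Lemma row_jack_eval k la : shf_eval (row_jack k) la = (k`!)%:R * row_sum alpha [seq x%:R | x <- la] k.
Proof.
rewrite /shf_eval /row_jack; congr (_ * row_sum _ _ _); apply: eq_ord_vals => [|i]; first by rewrite size_map.
by rewrite (nth_map 0%N).
Qed.

Lemma hook_row k : hookH [:: k] * hookH' [:: k] / alpha ^+ k = (k`!)%:R * poch alpha k.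
Proof.
have ha : alpha != 0 by exact: al_neq0 alpha_transc.
have ->: hookH [:: k] = poch alpha k.
  rewrite /hookH big_ord_recl big_ord0 mulr1 /poch [RHS](reindex_inj rev_ord_inj) /=.
  apply: eq_bigr => j _; have hj := ltn_ord j.
  rewrite /arm /leg /conjp /= hj subn0 subnn addr0 addrC mulrC.
  by congr (_ + _%:R * _); lia.
have -> : hookH' [:: k] = (k`!)%:R * alpha ^+ k.
  rewrite /hookH' big_ord_recl big_ord0 mulr1 /=.
  rewrite (eq_bigr (fun j : 'I_k => alpha * (k - j)%:R)) => [|j _].
    rewrite big_split /= prodr_const card_ord mulrC; congr (_ * _).
    rewrite -natr_prod fact_prod big_add1 /= big_mkord (reindex_inj rev_ord_inj) /=; congr (_%:R).
    by apply: eq_bigr => j _; have hj := ltn_ord j; lia.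
  have hj := ltn_ord j.
  rewrite /arm /leg /conjp /= hj subn0 subnn addr0.
  have -> : (k - j = (k - j - 1).+1)%N by lia.
  by rewrite -[in RHS]natr1 mulrDr mulr1 subn1.
by rewrite mulrA mulfK ?expf_neq0 // mulrC.
Qed.

Lemma row_sum_row k : row_sum alpha [:: k%:R] k = poch alpha k.
Proof. by rewrite row_sum_seq1 (gbinom_nat alpha_transc) binn mul1r. Qed.

(** A partition of size at most k other than (k) has fewer than k columns, hence the vanishing. *)
Lemma row_jack_spec k : (1 <= k)%N -> shifted_jack_spec [:: k] (row_jack k).
Proof.
move=> hk; split.
- move=> N; rewrite /= addn0 poly_fun_degE /row_jack -[X in poly_deg X]add0n.
  by apply: poly_degM; [apply: poly_deg_cst|apply: row_sum_poly_deg].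
- by move=> N s y; rewrite /row_jack; congr (_ * _); apply: (row_sum_shift_symm alpha_transc k s y).
- by move=> N x; apply: row_jack_stable.
move=> la /andP[hs h0] hsum; rewrite row_jack_eval; rewrite /= addn0 in hsum *.
case: eqP => [->|hne]; first by rewrite hook_row row_sum_row.
rewrite (row_sum_gt alpha_transc hs) ?mulr0 //.
rewrite ltnNge; apply/negP => hh; apply: hne.
case: la h0 hsum hh {hs} => [|x la] /=; first by lia.
rewrite inE negb_or => /andP[_ h0] hsum hh.
have -> : x = k by move: hsum; move: (sumn la) => S; lia.
have : sumn la = 0%N by move: hsum; move: (sumn la) => S; lia.
case: la h0 {hsum} => [//|y la]; rewrite inE negb_or /= => /andP[hy _] /eqP.
by rewrite addn_eq0 eq_sym (negbTE hy).
Qed.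

Lemma shf_eval_pad (F : shfam) mu N : (forall N (x : 'I_N -> K), F N.+1 (ext0 x) = F N x) ->
  (size mu <= N)%N -> F N (fun i => (nth 0%N mu i)%:R) = shf_eval F mu.
Proof.
move=> hst; elim: N => [|N IH].
  by rewrite leqn0 => /eqP/size0nil ->.
rewrite leq_eqVlt => /orP[/eqP e|]; first by rewrite /shf_eval; case: _ / e.
rewrite ltnS => h; rewrite -(IH h) -[RHS]hst.
suff -> : (fun i : 'I_N.+1 => (nth 0%N mu i)%:R : K) = ext0 (fun i : 'I_N => (nth 0%N mu i)%:R) by [].
apply/funext => i; rewrite /ext0; case: (unliftP ord_max i) => [j ->|->]; first by rewrite lift_max.
by rewrite nth_default.
Qed.

Lemma nth_filter_pos s i : sorted geq s -> nth 0%N [seq x <- s | 0 < x]%N i = nth 0%N s i.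
Proof.
elim: s i => [//|x s IH] i hs; have hs' := path_sorted hs.
case: x hs => [|x] hs /=; last by case: i => //= i; apply: IH.
have -> : s = nseq (size s) 0%N.
  apply/all_pred1P; have := order_path_min (rev_trans leq_trans) hs.
  by apply: sub_all => y; rewrite /= leqn0.
rewrite -[_ :: nseq _ _]/(nseq (size s).+1 0%N) nth_nseq if_same.
by rewrite (_ : [seq _ <- _ | _] = [::]) ?nth_nil //; elim: (size s).
Qed.

Lemma sumn_filter_pos s : sumn [seq x <- s | 0 < x]%N = sumn s.
Proof. by elim: s => [//|[|x] s IH] /=; rewrite IH. Qed.

(** [row_jack] witnesses that the [epsilon] choice meets its specification. The difference of the
    two in [size la] variables has degree at most k and vanishes at all partitions of size at most
    k, so [shift_symm_unique] applies. *)
Lemma shifted_jack_eval k la : (1 <= k)%N ->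
  shf_eval (shifted_jack [:: k]) la = shf_eval (row_jack k) la.
Proof.
move=> hk; have hS := row_jack_spec hk.
have hJ : shifted_jack_spec [:: k] (shifted_jack [:: k]).
  by apply: epsilon_spec; exists (row_jack k).
case: hS => S1 S2 S3 S4; case: hJ => J1 J2 J3 J4.
pose N := size la; pose D (x : 'I_N -> K) := shifted_jack [:: k] x + -1 * row_jack k x.
suff D0 x : D x = 0.
  have := D0 (fun i => (nth 0%N la i)%:R); rewrite /D mulN1r => /eqP.
  by rewrite subr_eq0 => /eqP.
apply: (shift_symm_unique (al := alpha) alpha_transc (d := k) (f := D) (s := 0)).
- have := J1 N; have := S1 N; rewrite /= addn0 => h1 h2.
  apply: poly_degD; first exact: h2.
  by rewrite -[X in poly_deg X]add0n; apply: poly_degM; [apply: poly_deg_cst|apply: h1].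
- by move=> s y; rewrite /D (J2 N s y) (S2 N s y).
- move=> l hl hsum; pose mu := [seq x <- mkseq l N | 0 < x]%N.
  have hmono i j : (i <= j)%N -> (l j <= l i)%N.
    by move=> /subnKC <-; elim: (j - i)%N => [|m IH]; rewrite ?addn0 // addnS (leq_trans (hl _)).
  have hsrt : sorted geq (mkseq l N).
    apply: (homo_sorted (e := ltn)); last exact: iota_ltn_sorted.
    by move=> i j /ltnW; apply: hmono.
  have -> : (fun i : 'I_N => (l i)%:R + 0 : K) = (fun i => (nth 0%N mu i)%:R).
    by apply/funext => i; rewrite addr0 nth_filter_pos // nth_mkseq.
  have hsz : (size mu <= N)%N by rewrite size_filter (leq_trans (count_size _ _)) // size_mkseq.
  have hmu : is_part mu.
    rewrite /is_part sorted_filter //; last exact: rev_trans leq_trans.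
    by rewrite mem_filter.
  have hsm : (sumn mu <= sumn [:: k])%N.
    rewrite sumn_filter_pos /= addn0; apply: leq_trans hsum.
    by rewrite sumnE big_map -{1}[N]subn0 -/(index_iota 0 N) big_mkord.
  rewrite /D !shf_eval_pad //.
  by rewrite J4 // S4 // mulN1r subrr.
Qed.

Lemma Ko_row_sum k la : (1 <= k)%N -> is_part la -> Ko k la = row_sum alpha [seq x%:R | x <- la] k.
Proof.
move=> hk hp; rewrite /Ko; set n := sumn la; case: leqP => hkn; last first.
  have [hs _] := andP hp; rewrite (row_sum_gt alpha_transc hs) //; apply: leq_ltn_trans hkn.
  by rewrite /n; case: la {hp hs n} => [|x la] //=; apply: leq_addr.
have hl : la \in partitions n by rewrite mem_partitions; apply/andP.
rewrite (mcoef_jackJ hl); last by rewrite /= sumn_nseq mul1n subnKC.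
have := ysize_part hl; rewrite -{2}(subnKC hkn) => hn.
have := mono_coef_hook_shape alpha_transc (young_part hl) hn hk; rewrite {1}(subnKC hkn) => E.
rewrite /jack_part E mulrC mulKf ?(fact_neq0 alpha_transc) //.
rewrite /young_sum -[RHS](row_sum_cat0 alpha_transc _ (n - size la)); congr (row_sum _ _ _).
apply: (@eq_from_nth _ 0) => [|i]; rewrite ?size_cat !size_map ?size_iota ?size_nseq ?subnKC ?size_part //.
move=> hi; rewrite (nth_map 0%N) ?size_mkseq // nth_mkseq // nth_cat size_map /fnth.
case: ltnP => h; first by rewrite (nth_map 0%N).
by rewrite nth_nseq if_same nth_default.
Qed.

Theorem theorem5p9 (k : nat) (la : seq nat) :
  (1 <= k)%N -> is_part la ->
  shf_eval (shifted_jack [:: k]) la / (k`!)%:R = Ko k la /\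
  Ko k la = coldist_sum k la.
Proof.
move=> hk hp; have [hs _] := andP hp.
rewrite shifted_jack_eval // row_jack_eval Ko_row_sum // mulrC mulKf ?(fact_neq0 alpha_transc) //; split=> //.
by rewrite coldist_sumE (col_distinct_sumE alpha_transc).
Qed.
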